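(* Let $(\Omega^\delta;a^\delta,b^\delta)$ be a simply connected FK-domain with Dobrushin boundary conditions on a $\delta$-isoradial graph, and let $F^\delta(\xi)$ be the holomorphic fermion of the critical FK-Ising model, defined on edges $\xi$ of $\Lambda$ in $\Omega^\delta$. Let $z\in\mathrm{Int}\,\Omega^\delta_\diamondsuit$ be the center of an inner rhombus $u_1w_1u_2w_2$ ($u_{1,2}\in\Gamma$, $w_{1,2}\in\Gamma^*$). Then there exists a complex number $F^\delta(z)$ such that $$F^\delta([u_jw_k])=\mathrm{Proj}\big[F^\delta(z);[i(w_k-u_j)]^{-\frac12}\big],\qquad j,k=1,2.$$
   Context: **Lattice.** Let $\delta>0$. A planar graph $\Gamma$ embedded in $\mathbb C$ is $\delta$-isoradial if each face is inscribed in a circle of radius $\delta$; the circle centers are assumed to lie inside the faces and are the vertices of the dual graph $\Gamma^*$. Vertices of $\Gamma$ are ''black'', vertices of $\Gamma^*$ ''white''. $\Lambda=\Gamma\cup\Gamma^*$, with edges $[uw]$ joining $u\in\Gamma$ to the center $w\in\Gamma^*$ of an incident face; the faces of $\Lambda$ are rhombi $u_1w_1u_2w_2$ with side $\delta$. All rhombi angles lie in $[\eta,\pi-\eta]$ for some fixed $\eta>0$. $\theta(z)$ is the half-angle of the rhombus centered at $z$ at its black vertices, and $\theta^*=\frac\pi2-\theta$. **Projection.** $\mathrm{Proj}[X;u]=\mathrm{Re}\big(X\frac{\overline u}{|u|}\big)\frac u{|u|}=\frac X2+\frac{\overline X u^2}{2|u|^2}$ (independent of the sign of $u$). **FK-domain.**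 $\Omega^\delta$ is a simply connected polygonal domain composed of inner rhombi (centers $\mathrm{Int}\,\Omega^\delta_\diamondsuit$) and boundary half-rhombi (triangles cut off from rhombi by a diagonal lying on $\partial\Omega^\delta$). Counterclockwise, the boundary consists of a white arc (a path of $\Gamma^*$ from $a_{\mathrm w}$ to $b_{\mathrm w}$), the edge $b^\delta=[b_{\mathrm w}b_{\mathrm b}]$ of $\Lambda$, a black arc (a path of $\Gamma$ from $b_{\mathrm b}$ to $a_{\mathrm b}$), and the edge $a^\delta=[a_{\mathrm b}a_{\mathrm w}]$ of $\Lambda$. It is assumed that $b_{\mathrm b}-b_{\mathrm w}=i\delta$. **Critical FK-Ising model (loop representation).** In each inner rhombus one chooses one of two pairs of disjoint arcs joining midpoints of its sides: either the arcs around $w_1$ and $w_2$ (then $\theta_{\mathrm{config}}(z)=\theta(z)$) or the arcs around $u_1$ and $u_2$ (then $\theta_{\mathrm{config}}(z)=\theta^*(z)$). In each boundary half-rhombus the midpoints of its two $\Lambda$-sides are joined by an arc. Each configuration consists of loops and one interface $\gamma^\delta$ from $a^\delta$ to $b^\delta$. The probability of a configuration is proportional to $\sqrt2^{\,\#\mathrm{loops}}\prod_{z\in\mathrm{Int}\,\Omega^\delta_\diamondsuit}\sin\frac12\theta_{\mathrm{config}}(z)$. **Fermion.** For an edge $\xi=[\xi_{\mathrm b}\xi_{\mathrm w}]$ of $\Lambda$ in $\Omega^\delta$, $$F^\delta(\xi)=(2\delta)^{-\frac12}\,\mathbb E\big[\mathbf 1(\xi\in\gamma^\delta)\,e^{-\frac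 i2\mathrm{wind}(\gamma^\delta;b^\delta\rightsquigarrow\xi)}\big],$$ where $\mathbf 1(\xi\in\gamma^\delta)$ is the indicator that the interface intersects $\xi$, $\mathrm{wind}(\gamma;b\rightsquigarrow\xi)=\mathrm{wind}(\gamma;a\rightsquigarrow\xi)-\mathrm{wind}(\gamma;a\rightsquigarrow b)$, and $\mathrm{wind}(\gamma;a\rightsquigarrow\cdot)$ is the total signed turn (in radians) of $\gamma$, drawn so that it crosses edges of $\Lambda$ orthogonally. *)

(* Defs.v *)
From HB Require Import structures.
From mathcomp Require Import all_boot all_order all_algebra.
From mathcomp Require Import all_classical all_reals all_analysis.
From mathcomp Require Import complex.

Set Implicit Arguments.
Unset Strict Implicit.
Unset Printing Implicit Defensive.

Import Order.TTheory GRing.Theory Num.Theory.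
Import numFieldNormedType.Exports.

Local Open Scope classical_set_scope.
Local Open Scope ring_scope.

(* The plane is R[i]; its topology is the one carried by the
   alias (R[i])^o. *)

Section Plane.
Variable R : realType.
Local Notation C := R[i].
Implicit Types (p q z u w : C) (A : set C).

Definition expi (t : R) : C := (cos t +i* sin t)%C.

(* Principal argument, in ]-pi, pi] for z != 0. *)
Definition arg z : R :=
  let t := acos (complex.Re z / complex.Re `|z|) in
  if 0 <= complex.Im z then t else - t.

Definition Proj (X u : C) : C :=
  (complex.Re (X * (u^*)%C / `|u|))%:C%C * (u / `|u|).

Definition segment p q : set C :=
  [set p + t%:C%C * (q - p) | t in `[0, 1]%classic].

Definition open_set A : Prop := open (A : set (R[i])^o).

Definition unit_interval : set R := `[0, 1]%classic.

(* A is connected and every loop in A can be contracted to its base point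
   inside A. *)
Definition simply_connected A : Prop :=
  connected (A : set (R[i])^o) /\
  forall g : R -> (R[i])^o,
    {within unit_interval, continuous g} ->
    g 0 = g 1 -> (forall s, unit_interval s -> A (g s)) ->
    exists H : R * R -> (R[i])^o,
      [/\ {within unit_interval `*` unit_interval, continuous H},
          forall s, unit_interval s -> H (s, 0) = g s /\ H (s, 1) = g 0,
          forall t, unit_interval t -> H (0, t) = g 0 /\ H (1, t) = g 0 &
          forall s t, unit_interval s -> unit_interval t -> A (H (s, t))].

(* A lies (does not lie) immediately to the left (right) of the open segment
   oriented from p to q. *)
Definition on_left A p q : Prop :=
  forall t : R, 0 < t < 1 ->
    \forall e \near (0 : R)^'+, A (p + (t +i* e)%C * (q - p)).
Definition off_right A p q : Prop :=
  forall t : R, 0 < t < 1 ->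
    \forall e \near (0 : R)^'+, ~ A (p + (t -i* e)%C * (q - p)).

Definition left_of p q z : Prop :=
  0 < complex.Im ((z - p) * ((q - p)^*)%C).

End Plane.

Section Lattice.
Variable R : realType.
Local Notation C := R[i].

Record plane_graph := PlaneGraph {
  vertex : set C;
  adj : C -> C -> Prop }.

Implicit Types (G : plane_graph) (p : seq C) (u w : C).

(* Edges are drawn as straight segments: this is no restriction below, where
   all faces are polygons. *)
Record planar_embedded G : Prop := PlanarEmbedded {
  adj_vertex : forall u v, adj G u v -> vertex G u;
  adj_sym : forall u v, adj G u v -> adj G v u;
  adj_irrefl : forall u, ~ adj G u u;
  vertex_on_edge : forall u v x,
    adj G u v -> vertex G x -> segment u v x -> x = u \/ x = v;
  edge_cross : forall u v u' v' x, adj G u v -> adj G u' v' ->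
    segment u v x -> segment u' v' x ->
    [\/ (u' = u /\ v' = v), (u' = v /\ v' = u), x = u | x = v];
  locally_finite : forall M : C, finite_set [set u | vertex G u /\ `|u| <= M] }.

Definition skeleton G : set C :=
  vertex G `|` [set x | exists u v, adj G u v /\ segment u v x].

Definition is_face G (f : set C) : Prop :=
  exists2 x, ~ skeleton G x &
    f = connected_component (~` skeleton G : set (R[i])^o) x.

(* p lists points of the circle of radius delta around w, in counterclockwise
   order and going around at most once. *)
Definition ccw_on_circle (delta : R) w p : Prop :=
  exists al : nat -> R,
    [/\ forall k, (k < size p)%N -> p`_k = w + delta%:C%C * expi (al k),
        forall j k, (j < k < size p)%N -> al j < al k &
        forall k, (k < size p)%N -> al k < al 0%N + 2 * pi].

(* Interior of the convex polygon with vertices p (in counterclockwise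
   order); (rot 1 p)`_k is the vertex following p`_k. *)
Definition polygon_interior p : set C :=
  [set z | forall k, (k < size p)%N -> left_of p`_k (rot 1 p)`_k z].

(* The face of G with boundary cycle p is inscribed in the circle of radius
   delta whose center w lies in the face. *)
Definition inscribed_face (delta : R) G w p : Prop :=
  [/\ (2 < size p)%N,
      forall k, (k < size p)%N -> adj G p`_k (rot 1 p)`_k,
      ccw_on_circle delta w p,
      polygon_interior p w &
      is_face G (polygon_interior p)].

Definition isoradial (delta : R) G : Prop :=
  planar_embedded G /\
  forall f, is_face G f ->
    exists w p, inscribed_face delta G w p /\ f = polygon_interior p.

(* [uw] is an edge of Lambda: w is the center of a face incident to u. *)
Definition Lambda_adj (delta : R) G u w : Prop :=
  exists2 p, inscribed_face delta G w p & u \in p.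

Record rhombus := Rhombus { ru1 : C; rw1 : C; ru2 : C; rw2 : C }.
Implicit Type r : rhombus.

(* The rhombus u1 w1 u2 w2 is a face of Lambda: its black diagonal is an edge
   of G and w1, w2 are the centers of the two faces incident to that edge. *)
Definition is_rhombus (delta : R) G r : Prop :=
  [/\ adj G (ru1 r) (ru2 r), rw1 r <> rw2 r,
      Lambda_adj delta G (ru1 r) (rw1 r) /\ Lambda_adj delta G (ru1 r) (rw2 r) &
      Lambda_adj delta G (ru2 r) (rw1 r) /\ Lambda_adj delta G (ru2 r) (rw2 r)].

Definition theta r : R :=
  `|arg ((rw2 r - ru1 r) / (rw1 r - ru1 r))| / 2.
Definition theta_star r : R := pi / 2 - theta r.

Definition angles_bounded (delta eta : R) G : Prop :=
  forall r, is_rhombus delta G r ->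
    eta <= 2 * theta r <= pi - eta /\ eta <= 2 * theta_star r <= pi - eta.

Definition rhombus_set r : set C :=
  [set z | exists s t : R, [/\ 0 <= s <= 1, 0 <= t <= 1 &
    z = ru1 r + s%:C%C * (rw1 r - ru1 r) + t%:C%C * (rw2 r - ru1 r)]].

(* Half-rhombus cut off by the boundary diagonal oriented from hsrc to hdst;
   hapex is the third vertex of the triangle. *)
Definition half : eqType := (C * C * C)%type.
Implicit Type h : half.
Definition hsrc h : C := h.1.1.
Definition hdst h : C := h.1.2.
Definition hapex h : C := h.2.

Definition is_white_half (delta : R) G h : Prop :=
  exists u, is_rhombus delta G (Rhombus (hapex h) (hsrc h) u (hdst h)).
Definition is_black_half (delta : R) G h : Prop :=
  exists w, is_rhombus delta G (Rhombus (hsrc h) (hapex h) (hdst h) w).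

Definition half_set h : set C :=
  [set z | exists s t : R, [/\ 0 <= s, 0 <= t, s + t <= 1 &
    z = hapex h + s%:C%C * (hsrc h - hapex h) + t%:C%C * (hdst h - hapex h)]].

End Lattice.

Section FKDomain.
Variable R : realType.
Local Notation C := R[i].

(* white_halves (resp. black_halves) lists the half-rhombi met along the white
   arc from aw to bw (resp. the black arc from bb to ab), in that order. *)
Record fk_data := FKData {
  ninner : nat;
  inner : 'I_ninner -> rhombus R;
  white_halves : seq (half R);
  black_halves : seq (half R);
  ab : C; aw : C; bb : C; bw : C }.

Implicit Type D : fk_data.

Definition cells D : seq (set C) :=
  [seq rhombus_set (inner k) | k <- enum 'I_(ninner D)]
  ++ [seq half_set h | h <- white_halves D ++ black_halves D].

Definition boundary D : set C :=
  [set z | exists2 h, h \in white_halves D ++ black_halves D &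
                      segment (hsrc h) (hdst h) z]
  `|` segment (ab D) (aw D) `|` segment (bw D) (bb D).

(* Removing the whole boundary path, rather than taking the interior of the
   union of the cells, allows for slits: both half-rhombi adjacent to a slit
   are then boundary half-rhombi. *)
Definition Omega D : set C :=
  [set z | exists2 k, (k < size (cells D))%N & nth set0 (cells D) k z]
  `\` boundary D.

Record fk_domain (delta : R) (G : plane_graph R) D : Prop := FKDomain {
  fk_inner : forall k, is_rhombus delta G (@inner D k);
  fk_white : forall h, h \in white_halves D -> is_white_half delta G h;
  fk_black : forall h, h \in black_halves D -> is_black_half delta G h;
  fk_a : Lambda_adj delta G (ab D) (aw D);
  fk_b : Lambda_adj delta G (bb D) (bw D);
  fk_ab : (ab D, aw D) <> (bb D, bw D);
  (* the boundary diagonals form paths from aw to bw and from bb to ab *)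
  fk_white_arc : rcons (map (@hsrc R) (white_halves D)) (bw D)
                 = aw D :: map (@hdst R) (white_halves D);
  fk_black_arc : rcons (map (@hsrc R) (black_halves D)) (ab D)
                 = bb D :: map (@hdst R) (black_halves D);
  fk_disjoint : trivIset [set k | (k < size (cells D))%N]
    (fun k => interior (nth set0 (cells D) k : set (R[i])^o));
  fk_open : open_set (Omega D);
  fk_simply_connected : simply_connected (Omega D);
  (* the boundary is traversed counterclockwise *)
  fk_ccw : forall h, h \in white_halves D ++ black_halves D ->
    left_of (hsrc h) (hdst h) (hapex h);
  fk_ccw_a : on_left (Omega D) (ab D) (aw D) /\
             off_right (Omega D) (ab D) (aw D);
  fk_ccw_b : on_left (Omega D) (bw D) (bb D) /\
             off_right (Omega D) (bw D) (bb D);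
  fk_b_normalized : bb D - bw D = 'i%C * delta%:C%C }.

End FKDomain.

Section Model.
Variable R : realType.
Local Notation C := R[i].
Variable D : fk_data R.

(* The edge [uw] of Lambda, u black and w white, is the pair (u, w). *)
Definition edge : Type := (C * C)%type.

Definition rhombus_edges (r : rhombus R) : seq edge :=
  [:: (ru1 r, rw1 r); (ru1 r, rw2 r); (ru2 r, rw1 r); (ru2 r, rw2 r)].

Definition white_half_arc (h : half R) : edge * edge :=
  ((hapex h, hsrc h), (hapex h, hdst h)).
Definition black_half_arc (h : half R) : edge * edge :=
  ((hsrc h, hapex h), (hdst h, hapex h)).
Definition half_arcs : seq (edge * edge) :=
  map white_half_arc (white_halves D) ++ map black_half_arc (black_halves D).

Definition edges : seq edge :=
  flatten [seq rhombus_edges (@inner R D k) | k <- enum 'I_(ninner D)]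
  ++ flatten [seq [:: e.1; e.2] | e <- half_arcs].

Definition edge_a : edge := (ab D, aw D).
Definition edge_b : edge := (bb D, bw D).

(* c k is true when the arcs in the k-th inner rhombus go around w1 and w2,
   false when they go around u1 and u2. *)
Definition config : finType := {ffun 'I_(ninner D) -> bool}.
Implicit Type c : config.

(* An arc is represented by the pair of edges whose midpoints it joins. *)
Definition rhombus_arcs (around_white : bool) (r : rhombus R) :
    seq (edge * edge) :=
  if around_white then
    [:: ((ru1 r, rw1 r), (ru2 r, rw1 r)); ((ru1 r, rw2 r), (ru2 r, rw2 r))]
  else
    [:: ((ru1 r, rw1 r), (ru1 r, rw2 r)); ((ru2 r, rw1 r), (ru2 r, rw2 r))].

Definition arcs c : seq (edge * edge) :=
  flatten [seq rhombus_arcs (c k) (@inner R D k) | k <- enum 'I_(ninner D)]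
  ++ half_arcs.

Definition arc_rel c : rel edge :=
  fun e f => ((e, f) \in arcs c) || ((f, e) \in arcs c).

(* The edges successively crossed by the interface: the (unique) simple path
   of arcs from a to b. *)
Definition interface c : seq edge :=
  edge_a :: xget [::] [set g : seq edge |
    [&& path (arc_rel c) edge_a g, uniq (edge_a :: g) & last edge_a g == edge_b]].

(* The loops are the connected components, other than the interface, of the
   graph of arcs on the edges of Lambda in the domain. *)
Definition nloops c : nat :=
  n_comp [rel e f : seq_sub edges | arc_rel c (ssval e) (ssval f)]
         [pred e : seq_sub edges | ssval e \notin interface c].

Definition theta_config c (k : 'I_(ninner D)) : R :=
  if c k then theta (@inner R D k) else theta_star (@inner R D k).

Definition weight c : R :=
  Num.sqrt 2 ^+ nloops c * \prod_(k < ninner D) sin (theta_config c k / 2).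

Definition prob c : R := weight c / \sum_(c' : config) weight c'.

(* Signed turn of an arc around a common endpoint v of the edges e and f,
   drawn orthogonally to both: the oriented angle at v from e to f. *)
Definition turn (e f : edge) : R :=
  if e.1 == f.1 then arg ((f.2 - e.1) / (e.2 - e.1))
  else arg ((f.1 - e.2) / (e.1 - e.2)).

Definition wind_from_a c (xi : edge) : R :=
  let g := interface c in
  \sum_(0 <= k < index xi g) turn (nth edge_a g k) (nth edge_a g k.+1).

Definition wind_from_b c (xi : edge) : R :=
  wind_from_a c xi - wind_from_a c edge_b.

Definition fermion (delta : R) (xi : edge) : C :=
  ((Num.sqrt (2 * delta))^-1)%:C%C *
  \sum_(c : config) (prob c)%:C%C *
    (if xi \in interface c then expi (- (wind_from_b c xi / 2)) else 0).

End Model.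

(* Main.v *)
Require Import Defs.
From mathcomp Require Import all_boot all_order all_algebra fingroup perm.
From mathcomp Require Import all_classical all_reals all_analysis.
From mathcomp Require Import complex.
From mathcomp Require Import ring lra zify.
Import Order.TTheory GRing.Theory Num.Theory.
Local Open Scope ring_scope.

(** An interface always leaves an edge of Lambda with its black end on the left,
    so that [expi] of its winding at an edge is read off the direction of that
    edge: each value of the fermion lies on the line of [Proj].  Opposite sides
    of a rhombus give orthogonal lines, so the projection property is equivalent
    to the equality of the sums of the fermion over the two pairs of opposite
    sides, one being the sides through which the rhombus can be entered.

    This equality holds for the joint contribution of two configurations which
    differ in the rhombus only.  The successor maps on edges differ by a
    transposition; if the interface meets the rhombus, one configuration has one
    more loop, which the other one inserts into its interface.  Comparing the
    windings requires the total turning of this loop modulo 4 pi, which is 2 pi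
    by Hopf's Umlaufsatz for the simple polygon through the midpoints of the
    crossed edges.  The cancellation is then a trigonometric identity.

    Each edge other than [a] and [b] has exactly one arc on either side: its
    midpoint lies in the open domain, off the boundary, and the corner triangles
    cut off by distinct arcs are disjoint. *)

Set Implicit Arguments.
Unset Strict Implicit.
Unset Printing Implicit Defensive.

(** Adding one artificial link from [b] to [a] makes each configuration a permutation [sigma] of the
    edges, whose cycles are the loops and the closed-up interface. Flipping a rhombus multiplies
    [sigma] by a transposition, so the possible ways in which the interface meets the rhombus reduce
    to merging or splitting cycles, and [nloops] changes by exactly one.

    The direction of the inserted loop is never determined: windings enter halved, and [2 * pi] and
    [- (2 * pi)] have the same effect there. The midpoint polygon turns as much as the loop because
    the chord of an arc makes equal angles with the two crossing directions, so its exterior angles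
    are averages of consecutive turns.

    The factor [Num.sqrt 2] of the additional loop meets the [pi / 4] in
    [theta_star / 2 = pi / 4 - theta / 2]; this is how the critical weights make the contributions
    cancel.

    The normalization at [b] makes [edge_normal] there the positive real [delta], which fixes the
    lines of all values. The number sought is the sum of the fermion over two opposite sides, either
    pair giving the same sum. *)

Section Plane.
Variable R : realType.
Local Notation C := R[i].
Implicit Types (x y z v w p q d : C) (r t a b : R).

(** * Polar form and principal arguments *)

Definition dot x y : R := complex.Re x * complex.Re y + complex.Im x * complex.Im y.
Definition cross x y : R := complex.Re x * complex.Im y - complex.Im x * complex.Re y.

Lemma ReZ r z : complex.Re (r%:C%C * z) = r * complex.Re z.
Proof. by case: z => a b; simpc. Qed.

Lemma ImZ r z : complex.Im (r%:C%C * z) = r * complex.Im z.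
Proof. by case: z => a b; simpc. Qed.

Lemma expi0 : expi 0 = 1 :> C.
Proof. by rewrite /expi cos0 sin0. Qed.

Lemma expiD a b : expi (a + b) = expi a * expi b.
Proof.
rewrite /expi cosD sinD; simpc; congr (_ +i* _)%C; ring.
Qed.

Lemma expi_neq0 a : expi a != 0.
Proof.
apply/eqP => /(f_equal (fun z => z * expi (- a))).
by rewrite -expiD subrr expi0 mul0r => /eqP; rewrite oner_eq0.
Qed.

Lemma expiN a : expi (- a) = (expi a)^-1.
Proof.
apply: (mulfI (expi_neq0 a)).
by rewrite -expiD subrr expi0 divff ?expi_neq0.
Qed.

Lemma expiB a b : expi (a - b) = expi a / expi b.
Proof. by rewrite expiD expiN. Qed.

Lemma expi2pi : expi (2 * pi) = 1 :> C.
Proof. by rewrite /expi mulr_natl cos2pi sin2pi. Qed.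

Lemma expi_pi : expi pi = -1 :> C.
Proof. by rewrite /expi cospi sinpi; congr Complex; rewrite oppr0. Qed.

Lemma expi_pihalf : expi (pi / 2) = 'i%C :> C.
Proof. by rewrite /expi cos_pihalf sin_pihalf. Qed.

Lemma norm_expi a : `|expi a| = 1.
Proof. by rewrite /expi; simpc; rewrite cos2Dsin2 sqrtr1. Qed.

Lemma argE r t : 0 < r -> - pi < t <= pi -> arg (r%:C%C * expi t) = t.
Proof.
move=> r0 /andP[t1 t2].
have e1 : (r%:C%C * expi t)%R = (r * cos t +i* (r * sin t))%C.
  by rewrite /expi; simpc.
have nE : complex.Re `|(r%:C%C * expi t)%R| = r.
  by rewrite normrM norm_expi mulr1 normc_def /= expr0n addr0 sqrtr_sqr gtr0_norm.
rewrite /arg nE e1 /= (mulrC r (cos t)) mulfK ?gt_eqF //.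
have [t0|t0] := leP 0 t.
  rewrite pmulr_rge0 // sin_ge0_pi ?t0 ?t2 //.
  by rewrite cosK // in_itv /= t0.
have: sin t < 0 by rewrite -oppr_gt0 -sinN sin_gt0_pi // oppr_gt0 t0 /=; lra.
move=> st; rewrite pmulr_rge0 // leNgt st /=.
by rewrite cosKN ?opprK // (ltW t1) ltW.
Qed.

Lemma polarP z : z != 0 -> exists r t, [/\ 0 < r, - pi < t <= pi & z = r%:C%C * expi t].
Proof.
case: z => a b; rewrite eq_complex /= negb_and => z0.
set r := Num.sqrt (a ^+ 2 + b ^+ 2).
have s0 : 0 < a ^+ 2 + b ^+ 2.
  by case/orP: z0 => h; [apply: ltr_wpDr|apply: ltr_wpDl]; rewrite ?sqr_ge0 // exprn_even_gt0.
have r0 : 0 < r by rewrite sqrtr_gt0.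
have rE : r ^+ 2 = a ^+ 2 + b ^+ 2 by rewrite sqr_sqrtr // ltW.
have rn0 : r != 0 by rewrite gt_eqF.
have c1 : -1 <= a / r <= 1.
  rewrite ler_pdivlMr // ler_pdivrMr // mulN1r mul1r.
  have := sqr_ge0 b; move: rE r0 => /= *; apply/andP; split; nra.
have sE : sin (acos (a / r)) = `|b| / r.
  rewrite sin_acos // -[RHS]ger0_norm ?divr_ge0 ?normr_ge0 ?(ltW r0) // -sqrtr_sqr.
  congr (Num.sqrt _); rewrite !expr_div_n real_normK ?num_real // rE.
  have : a ^+ 2 + b ^+ 2 != 0 by rewrite gt_eqF.
  by move=> *; field.
have [b0|b0] := leP 0 b.
  exists r, (acos (a / r)); split => //.
    by rewrite acos_lepi // andbT (lt_le_trans _ (acos_ge0 c1)) // oppr_lt0 pi_gt0.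
  rewrite /expi acosK ?in_itv //= sE ger0_norm //; simpc.
  by congr (_ +i* _)%C; field.
exists r, (- acos (a / r)); split => //.
  have : acos (a / r) != pi.
    apply/eqP => e; move: sE; rewrite e sinpi => /esym/eqP; rewrite mulf_eq0 normr_eq0 invr_eq0.
    by rewrite lt_eqF //= (negbTE rn0).
  have := acos_lepi c1; have := acos_ge0 c1; have := pi_gt0 R.
  move=> p0 h1 h2 h3; apply/andP; split; last by lra.
  by rewrite ltrN2 lt_neqAle h3.
rewrite /expi cosN sinN acosK ?in_itv //= sE ltr0_norm //; simpc.
by congr (_ +i* _)%C; field.
Qed.

Lemma arg_bounds z : z != 0 -> - pi < arg z <= pi.
Proof. by move=> /polarP[r [t [r0 ht ->]]]; rewrite argE. Qed.

Lemma expi_arg z : z != 0 -> z = (complex.Re `|z|)%:C%C * expi (arg z).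
Proof.
move=> /polarP[r [t [r0 ht ->]]]; rewrite argE //.
by rewrite normrM norm_expi mulr1 normc_def /= expr0n addr0 sqrtr_sqr gtr0_norm.
Qed.

Lemma Re_norm_gt0 z : z != 0 -> 0 < complex.Re `|z|.
Proof. by move=> z0; rewrite -normr_gt0 in z0; move: z0; rewrite ltcE => /andP[_]. Qed.

Lemma expi_argE z : z != 0 -> expi (arg z) = z / `|z|.
Proof.
move=> z0; have n0 : `|z| != 0 by rewrite normr_eq0.
apply: (mulIf n0); rewrite divfK // mulrC.
by rewrite [RHS](expi_arg z0).
Qed.

Lemma arg_half z : 0 < complex.Re z -> - (pi / 2) < arg z < pi / 2.
Proof.
move=> rz; have z0 : z != 0 by case: z rz => a b /= a0; rewrite eq_complex /= gt_eqF.
have := arg_bounds z0; have := rz; rewrite {1}(expi_arg z0).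
move: (arg z) => t.
rewrite ReZ pmulr_rgt0 ?Re_norm_gt0 // => c0.
have p0 := pi_gt0 R => /andP[t1 t2].
apply/andP; split; rewrite ltNge; apply/negP => ht; move: c0; rewrite ltNge => /negP; apply.
- have : 0 <= cos (t + pi) by apply: cos_ge0_pihalf; lra.
  by rewrite cosDpi oppr_ge0.
- have : 0 <= cos (t - pi) by apply: cos_ge0_pihalf; lra.
  by rewrite -cosN opprB -[pi - t]addrC cosDpi cosN oppr_ge0.
Qed.

Lemma dot_Re d z : d != 0 -> (0 < complex.Re (z / d)) = (0 < dot d z).
Proof.
case: d => a b; case: z => c e; rewrite eq_complex /= negb_and => h.
have s0 : 0 < a ^+ 2 + b ^+ 2.
  by case/orP: h => h; [apply: ltr_wpDr|apply: ltr_wpDl]; rewrite ?sqr_ge0 // exprn_even_gt0.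
rewrite /dot /= !mulrA -mulrN opprK mulrA -mulrDl mulrC pmulr_rgt0 ?invr_gt0 //.
by rewrite mulrC (mulrC e).
Qed.

(* Both directions lie in the open half-plane around [d], so principal
   arguments measured from [d] differ by less than [pi]. *)
Lemma arg_halfplane d z w : 0 < dot d z -> 0 < dot d w ->
  arg (w / z) = arg (w / d) - arg (z / d).
Proof.
move=> dz dw.
have d0 : d != 0 by apply: contraL dz => /eqP->; rewrite /dot /= !mul0r addr0 ltxx.
have z0 : z != 0 by apply: contraL dz => /eqP->; rewrite /dot /= !mulr0 addr0 ltxx.
have w0 : w != 0 by apply: contraL dw => /eqP->; rewrite /dot /= !mulr0 addr0 ltxx.
have zd : z / d != 0 by rewrite mulf_neq0 ?invr_eq0.
have wd : w / d != 0 by rewrite mulf_neq0 ?invr_eq0.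
have hz := arg_half (etrans (dot_Re z d0) dz).
have hw := arg_half (etrans (dot_Re w d0) dw).
have -> : w / z = (w / d) / (z / d) by field; rewrite d0 z0.
rewrite {1}(expi_arg zd) {1}(expi_arg wd) invfM mulrACA -expiN -expiD.
rewrite -fmorphV -rmorphM argE ?mulr_gt0 ?invr_gt0 ?Re_norm_gt0 //.
by have := pi_gt0 R; lra.
Qed.

End Plane.

(** * Hopf's theorem on the total turning of a simple polygon *)

Section Hopf.
Import numFieldNormedType.Exports.
Variable R : realType.
Local Notation C := R[i].
Implicit Types (x y z v w p q d : C) (r t : R).

Lemma dotDr x y z : dot x (y + z) = dot x y + dot x z.
Proof. by case: x y z => [? ?] [? ?] [? ?]; rewrite /dot; simpc => /=; ring. Qed.

Lemma dotBr x y z : dot x (y - z) = dot x y - dot x z.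
Proof. by case: x y z => [? ?] [? ?] [? ?]; rewrite /dot; simpc => /=; ring. Qed.

Lemma dotZr x r y : dot x (r%:C%C * y) = r * dot x y.
Proof. by case: x y => [? ?] [? ?]; rewrite /dot; simpc => /=; ring. Qed.

Lemma dot_ge0 x : 0 <= dot x x.
Proof. by rewrite /dot -!expr2 addr_ge0 ?sqr_ge0. Qed.

Lemma dot_gt0 x : (0 < dot x x) = (x != 0).
Proof.
case: x => a b; rewrite lt_def dot_ge0 andbT /dot /= -!expr2 paddr_eq0 ?sqr_ge0 //.
by rewrite !sqrf_eq0 eq_complex.
Qed.

(* The separating direction is the point of the parallelogram closest to 0. *)
Lemma parallelogram_separation (a b c : C) :
  (forall s t : R, 0 <= s <= 1 -> 0 <= t <= 1 ->
     a + s%:C%C * b + t%:C%C * c != 0 :> C) ->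
  exists d, forall s t : R, 0 <= s <= 1 -> 0 <= t <= 1 ->
    0 < dot d (a + s%:C%C * b + t%:C%C * c).
Proof.
move=> nz; pose V (s t : R) : C := a + s%:C%C * b + t%:C%C * c.
pose f (p : R * R) := dot (V p.1 p.2) (V p.1 p.2).
have fc : continuous f.
  have -> : f = (fun p : R * R =>
     (complex.Re a + p.1 * complex.Re b + p.2 * complex.Re c) *
     (complex.Re a + p.1 * complex.Re b + p.2 * complex.Re c) +
     (complex.Im a + p.1 * complex.Im b + p.2 * complex.Im c) *
     (complex.Im a + p.1 * complex.Im b + p.2 * complex.Im c)).
    apply/funext => -[s t]; rewrite /f /V /dot /=.
    by case: (a) (b) (c) => [? ?] [? ?] [? ?]; simpc.
  have lin (x y z : R) : continuous (fun p : R * R => x + p.1 * y + p.2 * z).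
    move=> p; apply: cvgD; first apply: cvgD; first exact: cvg_cst.
      by apply: cvgM; [exact: cvg_fst|exact: cvg_cst].
    by apply: cvgM; [exact: cvg_snd|exact: cvg_cst].
  by move=> p; apply: cvgD; apply: cvgM; apply: lin.
have cpt : compact (`[0, 1]%classic `*` `[0, 1]%classic : set (R * R)).
  by apply: compact_setX; exact: segment_compact.
have [|[s0 t0] st0 dmin] := compact_EVT_min _ cpt (continuous_subspaceT fc).
  by exists (0, 0); split; rewrite /= in_itv /= lexx ler01.
move: st0; rewrite inE /= => -[]; rewrite /= !in_itv /= => hs0 ht0.
exists (V s0 t0) => s t hs ht; rewrite -/(V s t).
set d := V s0 t0; set v := V s t.
have dd : 0 < dot d d by rewrite dot_gt0; apply: nz.
have conv (e : R) : 0 <= e <= 1 -> dot d d <= dot (d + e%:C%C * (v - d)) (d + e%:C%C * (v - d)).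
  move=> he.
  have -> : d + e%:C%C * (v - d) = V (s0 + e * (s - s0)) (t0 + e * (t - t0)).
    rewrite /d /v /V; move: (a) (b) (c) => [a1 a2] [b1 b2] [c1 c2].
    by simpc; congr (_ +i* _)%C; ring.
  have c01 (e0 x x0 : R) : 0 <= e0 <= 1 -> 0 <= x0 <= 1 -> 0 <= x <= 1 -> 0 <= x0 + e0 * (x - x0) <= 1.
    by move=> /andP[? ?] /andP[? ?] /andP[? ?]; apply/andP; split; nra.
  by apply: (dmin (_, _)); rewrite inE; split; rewrite /= in_itv /=; apply: c01.
suff : 0 <= dot d (v - d) by rewrite dotBr subr_ge0; exact: lt_le_trans.
rewrite leNgt; apply/negP => D0.
set D := dot d (v - d) in D0 *.
set N := dot (v - d) (v - d).
have expand e : dot (d + e%:C%C * (v - d)) (d + e%:C%C * (v - d)) = dot d d + 2 * e * D + e ^+ 2 * N.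
  rewrite /D /N; move: (v - d) => w; case: (d) (w) => [d1 d2] [w1 w2].
  by rewrite /dot; simpc => /=; ring.
(* The squared length along the segment is a quadratic in [e] with negative slope at 0. Its vertex
   [- D / N] contradicts minimality when it lies in the unit interval; otherwise [e = 1] does. *)
have [ND|ND] := leP (- D) N.
  have N0 : 0 < N by lra.
  have := conv (- D / N); rewrite expand.
  have -> : 0 <= - D / N <= 1.
    by rewrite ler_pdivrMr // mul1r ND divr_ge0 // ltW // oppr_gt0.
  move=> /(_ isT).
  rewrite -addrA.
  have -> : 2 * (- D / N) * D + (- D / N) ^+ 2 * N = - (D ^+ 2 / N) by field; rewrite gt_eqF.
  have : 0 < D ^+ 2 / N by rewrite divr_gt0 // exprn_even_gt0 //= lt_eqF.
  lra.
have := conv 1; rewrite expand ler01 lexx => /(_ isT); lra.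
Qed.

(** The turn from [x] to [y] is made in two stages through the third side [x + y] of the triangle.
    Since a turn of [pi] is excluded, the open half-plane around the bisector [d] contains all three
    directions and no multiple of [2 * pi] appears. *)
Lemma arg_addr x y : x != 0 -> y != 0 -> arg (y / x) < pi ->
  arg ((x + y) / x) + arg (y / (x + y)) = arg (y / x).
Proof.
move=> x0 y0 ht; set t := arg (y / x) in ht *.
have yx : y / x != 0 by rewrite mulf_neq0 ?invr_eq0.
have /andP[t1 _] : - pi < t <= pi by exact: arg_bounds.
set d := x * expi (t / 2).
have d0 : d != 0 by rewrite mulf_neq0 ?expi_neq0.
have c0 : 0 < cos (t / 2) by apply: cos_gt0_pihalf; lra.
have dx : 0 < dot d x.
  rewrite -dot_Re //; have -> : x / d = expi (- (t / 2)).
    by rewrite /d expiN; field; rewrite x0 expi_neq0.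
  by rewrite /expi /= cosN.
have dy : 0 < dot d y.
  rewrite -dot_Re //; have -> : y / d = (complex.Re `|y / x|)%:C%C * expi (t / 2).
    have -> : y / d = (y / x) * expi (- (t / 2)).
      by rewrite /d expiN; field; rewrite x0 expi_neq0.
    rewrite {1}(expi_arg yx) -/t -mulrA -expiD; congr (_ * expi _); lra.
  by rewrite ReZ mulr_gt0 ?Re_norm_gt0.
have dxy : 0 < dot d (x + y) by rewrite dotDr addr_gt0.
rewrite (arg_halfplane dx dxy) (arg_halfplane dxy dy) /t (arg_halfplane dx dy); lra.
Qed.

(** Nonzero numbers with argument in [0, [pi]). The positive real axis is included because the
    lowest vertex of a polygon may share its height with others. *)
Definition upper z := (0 < complex.Im z) || ((complex.Im z == 0) && (0 < complex.Re z)).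

Lemma upper_neq0 z : upper z -> z != 0.
Proof. by case: z => a b; rewrite /upper eq_complex /= => /orP[/gt_eqF->|/andP[_ /gt_eqF->]]; rewrite ?andbF. Qed.

Lemma arg_upper z : upper z -> 0 <= arg z < pi.
Proof.
move=> uz; have z0 := upper_neq0 uz; have [r [t [r0 ht zE]]] := polarP z0.
rewrite zE argE //; move: uz; rewrite zE /upper /expi; simpc => /=.
have p0 := pi_gt0 R; case/andP: ht => t1 t2.
rewrite !pmulr_rgt0 // mulf_eq0 gt_eqF //= => h.
apply/andP; split.
  rewrite leNgt; apply/negP => t0.
  have s0 : sin t < 0 by rewrite -oppr_gt0 -sinN sin_gt0_pi // oppr_gt0 t0 /=; lra.
  by move: h; rewrite lt_eqF //= orbF ltNge ltW.
rewrite lt_neqAle t2 andbT; apply/eqP => tE; move: h.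
by rewrite tE sinpi cospi ltxx eqxx /= oppr_gt0 ltNge ler01.
Qed.

Lemma arg_div_upper z w : upper z -> upper w -> arg (w / z) = arg w - arg z.
Proof.
move=> uz uw; have z0 := upper_neq0 uz; have w0 := upper_neq0 uw.
have := arg_upper uz; have := arg_upper uw => hw hz.
rewrite {1}(expi_arg z0) {1}(expi_arg w0) invfM mulrACA -expiN -expiD.
rewrite -fmorphV -rmorphM argE ?mulr_gt0 ?invr_gt0 ?Re_norm_gt0 //.
by have := pi_gt0 R; lra.
Qed.

(** To be applied with [w] and [z] pointing from the lowest vertex to the next and to the previous
    one: exterior angle plus signed interior angle. The sign of [pi] is the sense in which the
    polygon is traversed. *)
Lemma arg_div_upperN z w : upper z -> upper w -> arg (- w / z) < pi ->
  arg z - arg w + arg (- w / z) = pi \/ arg z - arg w + arg (- w / z) = - pi.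
Proof.
move=> uz uw; have z0 := upper_neq0 uz; have w0 := upper_neq0 uw.
have p0 := pi_gt0 R; have := arg_upper uz; have := arg_upper uw => hw hz.
have E s : expi s = -1 :> C -> - pi < arg w - arg z + s <= pi ->
    arg (- w / z) = arg w - arg z + s.
  move=> sE hs; rewrite -mulN1r -sE {1}(expi_arg z0) {1}(expi_arg w0) invfM.
  have -> (k : C) (l m n : C) : k * (l * m) * ((complex.Re `|z|)%:C%C^-1 * n) =
     (l * (complex.Re `|z|)%:C%C^-1) * (m * n * k) by ring.
  rewrite -expiN -!expiD -fmorphV -rmorphM argE ?mulr_gt0 ?invr_gt0 ?Re_norm_gt0 //.
have [lt|le] := ltP (arg z) (arg w) => h.
  right; rewrite (E (- pi)); [lra| |lra].
  by rewrite expiN expi_pi invrN1.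
by left; rewrite (E pi); [lra|exact: expi_pi|lra].
Qed.

(* Discrete form of Hopf's homotopy: the angle is transported from the diagonal
   of the triangle [i < j] to its other two sides, one square at a time. *)
Lemma staircase_sum n (h v : nat -> nat -> R) :
  (forall i j, (i.+1 < j)%N -> (j < n.+2 + (0 < i))%N ->
     h i j + v i j.+1 = v i j + h i.+1 j) ->
  \sum_(k < n.+2) (h k k.+1 + v k k.+2) =
  \sum_(j < n.+1) h 0%N j.+1 + (v 0%N n.+2 + h 1%N n.+2) +
  \sum_(i < n.+1) v i.+1 n.+3.
Proof.
move=> sq.
(* Moves a vertical segment one column to the right by adding up the squares between the two
   columns; [step] repeats this along the diagonal. The last column is treated apart, starting from
   row 1. *)
have shift a m j : (a + m < j)%N -> (j < n.+2 + (0 < a))%N ->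
    \sum_(i < m) v (a + i)%N j.+1 =
    \sum_(i < m) v (a + i)%N j + h (a + m)%N j - h a j.
  elim: m => [|m IH] amj jn; first by rewrite !big_ord0 addn0; lra.
  rewrite !big_ord_recr /= IH //; last by lia.
  have := sq (a + m)%N j; rewrite addnS => /(_ ltac:(lia) ltac:(lia)); lra.
have step m : (m <= n.+1)%N ->
    \sum_(k < m) (h k k.+1 + v k k.+2) =
    \sum_(j < m) h 0%N j.+1 + \sum_(i < m) v i m.+1.
  elim: m => [|m IH] lem; first by rewrite !big_ord0 addr0.
  rewrite !big_ord_recr /= IH 1?ltnW //.
  have := shift 0%N m m.+1; rewrite !add0n => ->; [lra|lia|lia].
rewrite big_ord_recr /= step // [X in _ = _ + X]big_ord_recr /=.
have := shift 1%N n n.+2 (ltac:(lia)) (ltac:(lia)); rewrite !add1n.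
under [X in _ = _ + (X + _)]eq_bigr do rewrite -add1n.
move=> ->; rewrite [X in _ + X + _ = _]big_ord_recl /=.
by under [X in _ + (_ + X) + _ = _]eq_bigr do rewrite /bump; lra.
Qed.

(* The polygon with vertices [P] is traversed once every [n] steps, and its
   half-open sides are pairwise disjoint. *)
Definition simple_polygon n (P : nat -> C) : Prop :=
  (forall k, P (k + n)%N = P k) /\
  forall i j (s t : R), 0 <= s < 1 -> 0 <= t < 1 ->
    P i + s%:C%C * (P i.+1 - P i) = P j + t%:C%C * (P j.+1 - P j) ->
    i = j %[mod n].

Lemma simple_polygon_neq n P i j : simple_polygon n P ->
  (i %% n != j %% n)%N -> P i - P j != 0.
Proof.
move=> [_ sP] ij; rewrite subr_eq0; apply: contra ij => /eqP e; apply/eqP.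
by apply: (sP _ _ 0 0); rewrite ?lexx ?ltr01 // !mul0r !addr0.
Qed.

(** The differences between points of side [j] and points of side [i] fill a parallelogram with
    these four corners. It misses 0 because non-adjacent sides are disjoint, so an open half-plane
    contains it. *)
Lemma simple_polygon_separation n P i j : simple_polygon n P ->
  [&& i %% n != j %% n, i.+1 %% n != j %% n & i %% n != j.+1 %% n]%N ->
  exists d, [/\ 0 < dot d (P j - P i), 0 < dot d (P j.+1 - P i),
                0 < dot d (P j - P i.+1) & 0 < dot d (P j.+1 - P i.+1)].
Proof.
move=> [_ sP] /and3P[n1 n2 n3].
have [|d hd] := @parallelogram_separation (P j - P i) (P j.+1 - P j) (P i - P i.+1).
  move=> t s ht hs; apply/negP => /eqP e.
  have E : P i + s%:C%C * (P i.+1 - P i) = P j + t%:C%C * (P j.+1 - P j).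
    by apply/eqP; rewrite -subr_eq0 -oppr_eq0 -e; apply/eqP; ring.
  (* Sides are half-open in [simple_polygon]: an endpoint with parameter 1 is read as parameter 0 of
     the following side, and each resulting coincidence of indices is excluded. *)
  have {e} : (s = 1 \/ 0 <= s < 1) /\ (t = 1 \/ 0 <= t < 1).
    split; [case: (eqVneq s 1) => [->|?]|case: (eqVneq t 1) => [->|?]]; try by left.
      by right; rewrite lt_neqAle; case/andP: hs => -> ->; rewrite andbT.
    by right; rewrite lt_neqAle; case/andP: ht => -> ->; rewrite andbT.
  have z0 : 0 <= (0 : R) < 1 by lra.
  have full k : P k + 1%:C%C * (P k.+1 - P k) = P k.+1 + 0%:C%C * (P k.+2 - P k.+1).
    by rewrite !(rmorph1, rmorph0); ring.
  have [ss|] := eqVneq (i.+1 %% n)%N (j.+1 %% n)%N.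
    by move/eqP: ss n1; rewrite -addn1 -(addn1 j) eqn_modDr => ->.
  move/eqP => n4 [[s1|s1] [t1|t1]].
  - by move: E; rewrite s1 t1 !full => /(sP _ _ _ _ z0 z0).
  - by move: E; rewrite s1 full => /(sP _ _ _ _ z0 t1) /eqP; rewrite (negbTE n2).
  - by move: E; rewrite t1 full => /(sP _ _ _ _ s1 z0) /eqP; rewrite (negbTE n3).
  - by move: E => /(sP _ _ _ _ s1 t1) /eqP; rewrite (negbTE n1).
have z01 : 0 <= (0 : R) <= 1 by rewrite lexx ler01.
have o01 : 0 <= (1 : R) <= 1 by rewrite lexx ler01.
exists d; split; [have := hd 0 0 z01 z01|have := hd 1 0 o01 z01|
                  have := hd 0 1 z01 o01|have := hd 1 1 o01 o01];
 congr (0 < dot d _); rewrite !(rmorph1, rmorph0); ring.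
Qed.

(** A turn of [pi] would make a side run back over the preceding one. *)
Lemma simple_polygon_turn n P k : (1 < n)%N -> simple_polygon n P ->
  arg ((P k.+2 - P k.+1) / (P k.+1 - P k)) < pi.
Proof.
move=> n1 sP.
have nS j : P j.+1 - P j != 0.
  apply: simple_polygon_neq sP _; rewrite -addn1 -{2}(addn0 j) eqn_modDl mod0n modn_small //.
set z := _ / _.
have z0 : z != 0 by rewrite mulf_neq0 ?invr_eq0.
rewrite lt_neqAle; case/andP: (arg_bounds z0) => _ ->; rewrite andbT.
apply/eqP => zpi; have := expi_arg z0; rewrite zpi expi_pi.
set r := complex.Re `|z|; have r0 : 0 < r by exact: Re_norm_gt0.
move=> zE; have E : P k.+2 - P k.+1 = - r%:C%C * (P k.+1 - P k).
  by rewrite mulNr -mulrN1 mulrAC -zE /z divfK.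
(* The point at parameter [e] of the backtracking side sits at parameter [1 - r * e] of the side
   before. This choice makes the two parameters equal and puts them strictly between 0 and 1. *)
pose e := (1 + r)^-1.
have re : (r * e + e = 1) by rewrite /e; field; rewrite gt_eqF //; lra.
have e0 : 0 < e by rewrite invr_gt0; lra.
have := sP.2 k k.+1 (1 - r * e) e.
have -> : (0 <= 1 - r * e < 1) by apply/andP; split; nra.
have -> : (0 <= e < 1) by apply/andP; split; nra.
move=> /(_ isT isT); rewrite E.
have -> : P k + (1 - r * e)%:C%C * (P k.+1 - P k) = P k.+1 + e%:C%C * (- r%:C%C * (P k.+1 - P k)).
  rewrite rmorphB rmorph1 rmorphM; ring.
move=> /(_ erefl) /eqP; rewrite -{1}(addn0 k) -addn1 eqn_modDl mod0n modn_small //.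
Qed.

Lemma simple_polygon_shift n P m : simple_polygon n P ->
  simple_polygon n (fun k => P (k + m)%N).
Proof.
move=> [pP sP]; split=> [k|i j s t hs ht]; first by rewrite addnAC pP.
rewrite !addSn => /(sP _ _ _ _ hs ht) /eqP; rewrite eqn_modDr => /eqP //.
Qed.

(** After the homotopy, the bottom row follows the directions from [P 0] to the other vertices and
    the last column their opposites. Staying in a half-plane, each telescopes to the interior angle
    at [P 0]. The corner of the staircase and the last turn both equal the exterior angle there, so
    the total is twice plus or minus [pi]. *)
Lemma turning_sum_lowest n P : simple_polygon n.+3 P ->
  (forall k, (0 < k < n.+3)%N -> upper (P k - P 0%N)) ->
  let s := \sum_(k < n.+3) arg ((P k.+2 - P k.+1) / (P k.+1 - P k)) in
  s = 2 * pi \/ s = - (2 * pi).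
Proof.
move=> sP low s.
pose V i j := P j - P i.
pose h i j := arg (V i j.+1 / V i j); pose v i j := arg (V i.+1 j / V i j).
have PN k : P (k + n.+3)%N = P k by exact: sP.1.
have nS j : P j.+1 - P j != 0.
  apply: simple_polygon_neq sP _; rewrite -addn1 -{2}(addn0 j) eqn_modDl mod0n modn_small //.
have tr k : arg ((P k.+2 - P k.+1) / (P k.+1 - P k)) = h k k.+1 + v k k.+2.
  rewrite /h /v /V; have -> : P k.+2 - P k = (P k.+1 - P k) + (P k.+2 - P k.+1) by ring.
  by rewrite arg_addr ?nS // (@simple_polygon_turn n.+3).
(* Sides [i] and [j] are not adjacent in this range. For [i = 0] the side [j = n.+2] is left out
   because it ends at [P 0]. *)
have sq i j : (i.+1 < j)%N -> (j < n.+2 + (0 < i))%N -> h i j + v i j.+1 = v i j + h i.+1 j.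
  move=> ij jn.
  have [|d [d1 d2 d3 d4]] := @simple_polygon_separation _ P i j sP.
    have jn3 : (j < n.+3)%N by lia.
    rewrite !(@modn_small i) ?(@modn_small i.+1) ?(@modn_small j) //; [|lia|lia].
    apply/and3P; split; [lia|lia|].
    have [jne|jne] := eqVneq j n.+2; last by rewrite modn_small; lia.
    rewrite jne modnn; case: (i) jn => [|k]; rewrite ?jne //; lia.
  by rewrite /h /v /V (arg_halfplane d1 d2) (arg_halfplane d2 d4) (arg_halfplane d1 d3)
    (arg_halfplane d3 d4); lra.
have P3 : P n.+3 = P 0%N by rewrite -[in RHS](PN 0%N) add0n.
have P4 : P n.+4 = P 1%N by rewrite -[in RHS](PN 1%N) add1n.
have up k : (k < n.+2)%N -> upper (V 0%N k.+1) by move=> kn; apply: low; lia.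
have hs : \sum_(j < n.+1) h 0%N j.+1 = arg (V 0%N n.+2) - arg (V 0%N 1%N).
  rewrite -(telescope_sumr (fun j => arg (V 0%N j.+1)) (leq0n n.+1)) big_mkord.
  by apply: eq_bigr => j _; rewrite /h arg_div_upper // up //; have := ltn_ord j; lia.
have vs : \sum_(i < n.+1) v i.+1 n.+3 = arg (V 0%N n.+2) - arg (V 0%N 1%N).
  rewrite -hs; apply: eq_bigr => j _; rewrite /v /h /V P3; congr (arg _).
  by rewrite -(opprB _ (P 0%N)) -(opprB (P j.+1)) invrN mulrNN.
have x0 : V 0%N n.+2 != 0 by apply: upper_neq0; apply: up.
have y0 : V 0%N 1%N != 0 by apply: upper_neq0; apply: up.
have lt : arg (- V 0%N 1%N / V 0%N n.+2) < pi.
  have := @simple_polygon_turn n.+3 P n.+2 isT sP; rewrite P4 P3 /V.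
  by rewrite -(opprB (P n.+2)) invrN mulrN -mulNr.
have mid : v 0%N n.+2 + h 1%N n.+2 = arg (- V 0%N 1%N / V 0%N n.+2).
  rewrite -arg_addr ?oppr_eq0 // /v /h /V P3.
  by congr (arg (_ / _) + arg (_ / _)); ring.
have last : arg ((P n.+4 - P n.+3) / (P n.+3 - P n.+2)) = arg (- V 0%N 1%N / V 0%N n.+2).
  by rewrite P4 P3 /V -(opprB (P n.+2)) invrN mulrN -mulNr.
have -> : s = \sum_(k < n.+2) (h k k.+1 + v k k.+2) + arg (- V 0%N 1%N / V 0%N n.+2).
  by rewrite /s big_ord_recr /= last; congr (_ + _); apply: eq_bigr => k _; rewrite tr.
rewrite (staircase_sum sq) hs vs mid.
by case: (arg_div_upperN (up _ _) (up _ _) lt) => // e; [left|right]; lra.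
Qed.

(* Hopf's Umlaufsatz. *)
Theorem turning_sum n P : (2 < n)%N -> simple_polygon n P ->
  let s := \sum_(k < n) arg ((P k.+2 - P k.+1) / (P k.+1 - P k)) in
  s = 2 * pi \/ s = - (2 * pi).
Proof.
case: n => [|[|[|n]]] // _ sP s.
(* The lowest vertex, and the leftmost one among those of equal height, so that every other vertex
   is seen from it in a direction satisfying [upper]. *)
case: (@arg_minP _ _ _ ord0 predT (fun k : 'I_n.+3 => complex.Im (P k)) isT) => m0 _ min0.
case: (@arg_minP _ _ _ m0 (fun k : 'I_n.+3 => complex.Im (P k) == complex.Im (P m0))
  (fun k => complex.Re (P k)) (eqxx _)) => m /eqP imm minm.
pose Q k := P (k + m)%N.
have sQ : simple_polygon n.+3 Q by exact: simple_polygon_shift.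
have PN k : P (k %% n.+3)%N = P k.
  rewrite [in RHS](divn_eq k n.+3) addnC; elim: (k %/ n.+3)%N => [|q ->]; first by rewrite mul0n addn0.
  by rewrite mulSn (addnC n.+3) addnA sP.1.
have -> : s = \sum_(k < n.+3) arg ((Q k.+2 - Q k.+1) / (Q k.+1 - Q k)).
  rewrite /s (reindex_inj (addrI m)) /=; apply: eq_bigr => k _.
  rewrite /Q; have E j : P ((m + k) %% n.+3 + j)%N = P (k + j + m)%N.
    by rewrite -[LHS]PN modnDml PN; congr P; lia.
  have := E 0%N; have := E 1%N; have := E 2%N.
  by rewrite !(addn0, addn1, addn2) => -> -> ->.
apply: turning_sum_lowest => // k kn.
have nz := @simple_polygon_neq _ Q k 0%N sQ.
have {nz} : Q k - Q 0%N != 0 by apply: nz; rewrite mod0n modn_small; lia.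
have lt : ((k + m) %% n.+3 < n.+3)%N by rewrite ltn_mod.
have := min0 (Ordinal lt) isT; have := minm (Ordinal lt).
rewrite /= PN -imm -/(Q k) /Q add0n => h1 h2.
rewrite /upper; move: h1 h2; case: (P m) (P (k + m)%N) => [a b] [c d]; rewrite eq_complex /=.
move=> h1 h2; rewrite !subr_gt0 !subr_eq0 => ne.
have [e|db] := eqVneq d b; last by rewrite lt_neqAle eq_sym db h2.
by rewrite e ltxx /= lt_neqAle eq_sym; move: ne; rewrite e eqxx andbT => ->; rewrite h1 // e.
Qed.
End Hopf.

(** * Vector identities in real coordinates *)

Section Coordinates.
Variable R : realType.
Local Notation C := R[i].
Implicit Types (x y z : C) (r : R).

Lemma ReD x y : complex.Re (x + y) = complex.Re x + complex.Re y.
Proof. by case: x y => [? ?] [? ?]. Qed.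
Lemma ImD x y : complex.Im (x + y) = complex.Im x + complex.Im y.
Proof. by case: x y => [? ?] [? ?]. Qed.
Lemma ReN x : complex.Re (- x) = - complex.Re x.
Proof. by case: x. Qed.
Lemma ImN x : complex.Im (- x) = - complex.Im x.
Proof. by case: x. Qed.
Lemma ReM x y : complex.Re (x * y) =
  complex.Re x * complex.Re y - complex.Im x * complex.Im y.
Proof. by case: x y => [? ?] [? ?]. Qed.
Lemma ImM x y : complex.Im (x * y) =
  complex.Re x * complex.Im y + complex.Im x * complex.Re y.
Proof. by case: x y => [? ?] [? ?]. Qed.
Lemma Re0 : complex.Re (0 : C) = 0. Proof. by []. Qed.
Lemma Im0 : complex.Im (0 : C) = 0. Proof. by []. Qed.
Lemma ReR r : complex.Re r%:C%C = r. Proof. by []. Qed.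
Lemma ImR r : complex.Im r%:C%C = 0. Proof. by []. Qed.
Lemma Rei : complex.Re ('i%C : C) = 0. Proof. by []. Qed.
Lemma Imi : complex.Im ('i%C : C) = 1. Proof. by []. Qed.
Lemma Re_expi r : complex.Re (expi r) = cos r. Proof. by []. Qed.
Lemma Im_expi r : complex.Im (expi r) = sin r. Proof. by []. Qed.
Lemma Reconj x : complex.Re (x^*)%C = complex.Re x. Proof. by case: x. Qed.
Lemma Imconj x : complex.Im (x^*)%C = - complex.Im x. Proof. by case: x. Qed.

Definition reimE :=
  (ReD, ImD, ReN, ImN, ReZ, ImZ, ReM, ImM, Re0, Im0, ReR, ImR, Rei, Imi, Reconj, Imconj, Re_expi, Im_expi).

Lemma complex_ext x y : complex.Re x = complex.Re y -> complex.Im x = complex.Im y -> x = y.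
Proof. by case: x y => [? ?] [? ?] /= -> ->. Qed.

Lemma dot_eq0 x : dot x x = 0 -> x = 0.
Proof.
move=> e; apply/eqP; rewrite -[_ == _]negbK -dot_gt0 e ltxx //.
Qed.

(** Cramer's rule. *)
Lemma cross_basis a b z : cross a b != 0 ->
  z = (cross z b / cross a b)%:C%C * a + (cross a z / cross a b)%:C%C * b :> C.
Proof.
by move=> ab; apply: complex_ext; rewrite !reimE; move: ab; rewrite /cross => ab; field.
Qed.

Lemma cross_coord a b s t :
  cross (s%:C%C * a + t%:C%C * b) b = s * cross a b /\
  cross a (s%:C%C * a + t%:C%C * b) = t * cross a b :> R.
Proof. by rewrite /cross !reimE; split; ring. Qed.

Lemma normE z : `|z| = (Num.sqrt (dot z z))%:C%C.
Proof. by rewrite normc_def /dot !expr2. Qed.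

Lemma cauchy_strict a b r : dot a a = r -> dot b b = r -> a != b -> dot a b < r.
Proof.
move=> ha hb ab; have : 0 < dot (a - b) (a - b) by rewrite dot_gt0 subr_eq0.
have -> : dot (a - b) (a - b) = dot a a + dot b b - 2 * dot a b.
  by rewrite /dot !reimE; ring.
by rewrite ha hb; lra.
Qed.

End Coordinates.

(** * Polygons inscribed in a circle *)

Section Polygon.
Import numFieldNormedType.Exports.
Variable R : realType.
Local Notation C := R[i].
Implicit Types (x y z w d : C) (p q : seq C) (delta : R) (G : plane_graph R).

Lemma left_ofE x y z : left_of x y z = (0 < cross (y - x) (z - x)) :> Prop.
Proof. by rewrite /left_of /cross !reimE; congr (is_true (0 < _)); ring. Qed.

Definition cyc p k : C := p`_(k %% size p).

Lemma nth_rot1 p k : (k < size p)%N -> (rot 1 p)`_k = cyc p k.+1.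
Proof.
case: p => [|x s] //= kn; rewrite rot1_cons nth_rcons /cyc /=.
have [lt|ge] := ltnP k (size s); first by rewrite modn_small ?ltnS.
have -> : k = size s by apply/eqP; rewrite eqn_leq ge -ltnS kn.
by rewrite eqxx modnn.
Qed.

Lemma polygon_interiorP p z : (0 < size p)%N ->
  polygon_interior p z <-> forall k, 0 < cross (cyc p k.+1 - cyc p k) (z - cyc p k).
Proof.
move=> p0; split=> h k.
  have kp : (k %% size p < size p)%N by rewrite ltn_mod.
  have := h _ kp; rewrite left_ofE nth_rot1 // /cyc -addn1 modnDml addn1; apply.
by move=> kp; rewrite left_ofE nth_rot1 //; have := h k; rewrite {2 3}/cyc modn_small.
Qed.

Lemma polygon_convex p x y s : (0 < size p)%N -> 0 <= s <= 1 ->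
  polygon_interior p x -> polygon_interior p y ->
  polygon_interior p (x + s%:C%C * (y - x)).
Proof.
move=> p0 /andP[s0 s1] /(polygon_interiorP _ p0) hx /(polygon_interiorP _ p0) hy.
apply/polygon_interiorP => // k; have := hx k; have := hy k.
set a := cyc p k; set b := cyc p k.+1; move: a b => a b.
have -> : cross (b - a) (x + s%:C%C * (y - x) - a) =
  (1 - s) * cross (b - a) (x - a) + s * cross (b - a) (y - a).
  by rewrite /cross !reimE; ring.
by move=> h1 h2; nra.
Qed.

Lemma expi_chord a b : expi b - expi a =
  (2 * sin ((b - a) / 2))%:C%C * ('i%C * expi ((a + b) / 2)) :> C.
Proof.
have -> : b = (a + b) / 2 + (b - a) / 2 by field.
set m := (a + b) / 2; set h := (b - a) / 2.
have -> : a = m - h by rewrite /m /h; field.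
have -> : (m + h - (m - h)) / 2 = h by field.
have -> : (m - h + (m + h)) / 2 = m by field.
by apply: complex_ext; rewrite !reimE ?cosB ?sinB ?cosD ?sinD; ring.
Qed.

(** The signed area of a triangle inscribed in a circle is proportional to the product of the sines
    of half the differences of its three angles; the order of the angles [al] determines the
    signs. *)
Lemma ccw_vertex_left delta w p j k : (0 < size p)%N -> ccw_on_circle delta w p ->
  0 <= cross (cyc p k.+1 - cyc p k) (cyc p j - cyc p k).
Proof.
move=> p0 [al [pE incr wrap]].
set n := size p in p0 pE incr wrap *.
have cE i : cyc p i = w + delta%:C%C * expi (al (i %% n)%N) by rewrite /cyc pE // ltn_mod.
rewrite !cE; set a := al (k %% n)%N; set b := al (j %% n)%N; set c := al (k.+1 %% n)%N.
have kn : (k %% n < n)%N by rewrite ltn_mod.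
have jn : (j %% n < n)%N by rewrite ltn_mod.
have -> : cross (w + delta%:C%C * expi c - (w + delta%:C%C * expi a))
                (w + delta%:C%C * expi b - (w + delta%:C%C * expi a)) =
          delta ^+ 2 * cross (expi c - expi a) (expi b - expi a).
  by rewrite /cross !reimE; ring.
rewrite !expi_chord.
have -> : cross ((2 * sin ((c - a) / 2))%:C%C * ('i%C * expi ((a + c) / 2)))
                ((2 * sin ((b - a) / 2))%:C%C * ('i%C * expi ((a + b) / 2))) =
   4 * (sin ((c - a) / 2) * sin ((b - a) / 2) * sin ((b - c) / 2)).
  have -> : (b - c) / 2 = (a + b) / 2 - (a + c) / 2 by field.
  by rewrite /cross !reimE sinB; ring.
apply: mulr_ge0; first exact: sqr_ge0.
apply: mulr_ge0 => //.
have mono i l : (i <= l < n)%N -> al i <= al l.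
  move=> /andP[]; rewrite leq_eqVlt => /orP[/eqP-> //|il ln].
  by apply: ltW; apply: incr; rewrite il.
have wrap2 i l : (i < n)%N -> (l < n)%N -> al i < al l + 2 * pi.
  by move=> hi hl; apply: (lt_le_trans (wrap _ hi)); rewrite lerD2r mono.
have sge (x y : R) : y <= x < y + 2 * pi -> 0 <= sin ((x - y) / 2).
  by move=> h; apply: sin_ge0_pi; lra.
have sN (x y : R) : sin ((x - y) / 2) = - sin ((y - x) / 2).
  by rewrite -sinN; congr sin; field.
(* The side that closes the polygon leads back to the smallest angle [al 0], so the first two sines
   are nonpositive there. *)
have [lt|ge] := ltnP (k %% n).+1 n.
  have cE' : c = al (k %% n).+1 by rewrite /c -addn1 -modnDml addn1 modn_small.
  have ac : 0 <= sin ((c - a) / 2).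
    by apply: sge; rewrite cE' mono ?leqnSn //= wrap2.
  rewrite -mulrA; apply: mulr_ge0 => //.
  have [jk|kj] := leqP (j %% n) (k %% n).
    rewrite sN (sN b) mulrNN; apply: mulr_ge0; apply: sge.
      by rewrite mono ?jk //= wrap2.
    by rewrite cE' mono ?lt ?andbT /= ?wrap2 // ltnW.
  by apply: mulr_ge0; apply: sge; rewrite ?cE' mono /= ?wrap2 ?kj ?(ltnW kj).
have ke : (k %% n).+1 = n by apply/eqP; rewrite eqn_leq ge kn.
have cE' : c = al 0%N by rewrite /c -addn1 -modnDml addn1 ke modnn.
have jk : (j %% n <= k %% n)%N by rewrite -ltnS ke.
rewrite sN (sN b a) mulrNN; apply: mulr_ge0; last first.
  by apply: sge; rewrite cE' mono //= wrap2.
by apply: mulr_ge0; apply: sge; rewrite ?cE' mono //= ?wrap2 // jk.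
Qed.

(* Otherwise the slopes of the vertices, seen from [w] in the half-plane around
   [d], would increase all the way around the polygon. *)
Lemma not_in_halfplane p w d : (0 < size p)%N ->
  polygon_interior p w -> exists k, dot d (cyc p k - w) <= 0.
Proof.
move=> p0 /(polygon_interiorP _ p0) hw.
apply: contrapT => H.
have pos k : 0 < dot d (cyc p k - w).
  by rewrite ltNge; apply/negP => h; apply: H; exists k.
pose T k := cross d (cyc p k - w) / dot d (cyc p k - w).
have dd : 0 < dot d d.
  rewrite dot_gt0; apply: contraL (pos 0%N) => /eqP ->.
  by rewrite /dot !reimE !mul0r addr0 ltxx.
have incr k : T k < T k.+1.
  rewrite /T ltr_pdivrMr // mulrAC ltr_pdivlMr // -subr_gt0.
  have := hw k; move: (cyc p k) (cyc p k.+1) => a b h.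
  have -> : cross d (b - w) * dot d (a - w) - cross d (a - w) * dot d (b - w) =
    dot d d * cross (b - a) (w - a).
    by rewrite /cross /dot !reimE; ring.
  exact: mulr_gt0.
have lt m k : (m < k)%N -> T m < T k.
  elim: k => // k IH; rewrite ltnS leq_eqVlt => /orP[/eqP->|/IH h] //.
  exact: lt_trans h _.
have := lt 0%N (size p) p0; have -> : T (size p) = T 0%N by rewrite /T /cyc modnn mod0n.
by rewrite ltxx.
Qed.

(** Seen from [w], the point [z] lies in the sector of some side. In the basis of the two radii
    bounding it, the coordinates are nonnegative with sum less than 1, and the two radii have length
    [delta]. *)
Lemma polygon_in_disc delta p w z : 0 < delta -> (0 < size p)%N ->
  ccw_on_circle delta w p -> polygon_interior p w -> polygon_interior p z ->
  dot (z - w) (z - w) < delta ^+ 2.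
Proof.
move=> d0 p0 circ hw hz.
have norm k : dot (cyc p k - w) (cyc p k - w) = delta ^+ 2.
  case: circ => al [pE _ _]; rewrite /cyc pE ?ltn_mod //.
  set t := al _; have := cos2Dsin2 t; rewrite /dot !reimE => h.
  by transitivity (delta ^+ 2 * (cos t ^+ 2 + sin t ^+ 2)); [ring|rewrite h mulr1].
set y := z - w.
pose f k := cross (cyc p k - w) y.
have fE k (s : R) : f k = dot (complex.Im y -i* complex.Re y)%C (cyc p k - w).
  by rewrite /f /cross /dot /= !reimE; ring.
have [k1 h1] := not_in_halfplane (complex.Im y -i* complex.Re y)%C p0 hw.
rewrite -fE // in h1.
have [k2 h2] := not_in_halfplane (- (complex.Im y -i* complex.Re y)%C) p0 hw.
have {}h2 : 0 <= f k2.
  by rewrite fE // -oppr_le0; move: h2; rewrite /dot !reimE; lra.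
(* [f] takes a nonnegative and a nonpositive value, so it falls through 0 between two consecutive
   vertices: otherwise positivity would propagate all around the cycle. *)
have [k [fk fk1]] : exists k, 0 <= f k /\ f k.+1 <= 0.
  apply: contrapT => H.
  have step k : 0 <= f k -> 0 < f k.+1.
    by move=> hk; rewrite ltNge; apply/negP => h; apply: H; exists k.
  have pos m : 0 < f (k2 + m.+1)%N.
    by elim: m => [|m IH]; rewrite addnS; apply: step; rewrite ?addn0 // ltW.
  have per m k : f (k + m * size p)%N = f k by rewrite /f /cyc addnC modnMDl.
  have le : (k2.+1 <= k2.+1 * size p)%N by rewrite leq_pmulr.
  have := pos (k1 + k2.+1 * size p - k2.+1)%N.
  have -> : (k2 + (k1 + k2.+1 * size p - k2.+1).+1 = k1 + k2.+1 * size p)%N by lia.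
  by rewrite per ltNge h1.
have ab_le : dot (cyc p k - w) (cyc p k.+1 - w) <= delta ^+ 2.
  have [->|ne] := eqVneq (cyc p k - w) (cyc p k.+1 - w); first by rewrite norm.
  exact/ltW/cauchy_strict.
have X0 : 0 < cross (cyc p k - w) (cyc p k.+1 - w).
  move/(polygon_interiorP _ p0): hw => /(_ k); congr (0 < _).
  by rewrite /cross !reimE; ring.
have side : 0 < cross (cyc p k - w) (cyc p k.+1 - w) - cross y (cyc p k.+1 - w) - cross (cyc p k - w) y.
  move/(polygon_interiorP _ p0): hz => /(_ k); congr (0 < _).
  by rewrite /y /cross !reimE; ring.
have a0 : 0 <= cross y (cyc p k.+1 - w).
  by rewrite -oppr_le0; move: fk1; congr (_ <= 0); rewrite /f /cross; ring.
have yE := cross_basis y (lt0r_neq0 X0).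
rewrite -/(f k) in side yE.
move: (norm k) (norm k.+1) ab_le X0 side a0 yE fk => na nb.
set X := cross _ _; set s := cross _ _; set t := f k => ab X0 side s0 yE t0.
set a := cyc p k - w in na ab yE; set b := cyc p k.+1 - w in nb ab yE.
set al := s / X in yE; set be := t / X in yE.
have al0 : 0 <= al by rewrite divr_ge0 // ltW.
have be0 : 0 <= be by rewrite divr_ge0 // ltW.
have lt1 : al + be < 1 by rewrite -mulrDl ltr_pdivrMr // mul1r; lra.
have -> : dot y y = al ^+ 2 * dot a a + be ^+ 2 * dot b b + 2 * (al * be) * dot a b.
  by rewrite {1 2}yE /dot !reimE; ring.
rewrite na nb.
have : al * be * dot a b <= al * be * delta ^+ 2 by rewrite ler_wpM2l // mulr_ge0.
have : (al + be) ^+ 2 * delta ^+ 2 < delta ^+ 2.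
  by rewrite gtr_pMl ?exprn_gt0 // expr_lt1 // addr_ge0.
by lra.
Qed.

Lemma inscribed_size delta G w p : inscribed_face delta G w p -> (0 < size p)%N.
Proof. by case=> h *; lia. Qed.

Lemma inscribed_vertex_norm delta G w p u : inscribed_face delta G w p -> u \in p ->
  dot (u - w) (u - w) = delta ^+ 2.
Proof.
case=> _ _ [al [pE _ _]] _ _ up; rewrite -(nth_index 0 up) pE ?index_mem //.
move: (al _) => t; have := cos2Dsin2 t; rewrite /dot !reimE => h.
by transitivity (delta ^+ 2 * (cos t ^+ 2 + sin t ^+ 2)); [ring|rewrite h mulr1].
Qed.

Lemma inscribed_segment delta G w p u t : inscribed_face delta G w p -> u \in p ->
  0 <= t < 1 -> polygon_interior p (w + t%:C%C * (u - w)).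
Proof.
move=> F up /andP[t0 t1]; have p0 := inscribed_size F; case: F => _ _ circ hw _.
apply/polygon_interiorP => // k; move/(polygon_interiorP _ p0): hw => /(_ k).
have ui : u = cyc p (index u p) by rewrite /cyc modn_small ?index_mem // nth_index.
have := ccw_vertex_left (index u p) k p0 circ; rewrite -ui.
move: (cyc p k) (cyc p k.+1) => a b.
have -> : cross (b - a) (w + t%:C%C * (u - w) - a) =
  (1 - t) * cross (b - a) (w - a) + t * cross (b - a) (u - a).
  by rewrite /cross !reimE; ring.
by move=> h1 h2; nra.
Qed.

(* Two different circles of the same radius: some vertex of the second polygon
   lies outside the first disc. *)
Lemma inscribed_center_unique delta G w p v q : 0 < delta ->
  inscribed_face delta G w p -> inscribed_face delta G v q ->
  polygon_interior p = polygon_interior q -> w = v.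
Proof.
move=> d0 Fp Fq pq; have p0 := inscribed_size Fp; have q0 := inscribed_size Fq.
have hv : polygon_interior q v by case: Fq.
have [k] := not_in_halfplane (w - v) q0 hv.
set u := cyc q k => hu.
have uq : u \in q by rewrite mem_nth // ltn_mod.
have nu := inscribed_vertex_norm Fq uq.
apply/eqP; rewrite -subr_eq0; apply/eqP; apply: dot_eq0; set d := w - v in hu *.
have disc (t : R) : 0 <= t < 1 -> dot (t%:C%C * (u - v) - d) (t%:C%C * (u - v) - d) < delta ^+ 2.
  move=> ht; have := inscribed_segment Fq uq ht; rewrite -pq.
  case: Fp => _ _ circ hw _ /(polygon_in_disc d0 p0 circ hw); congr (dot _ _ < _); rewrite /d; ring.
have disc2 (t : R) : 0 <= t < 1 -> t ^+ 2 * delta ^+ 2 + dot d d < delta ^+ 2.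
  move=> /[dup] /andP[t0 _] /disc; apply: le_lt_trans.
  have -> : dot (t%:C%C * (u - v) - d) (t%:C%C * (u - v) - d) =
    t ^+ 2 * dot (u - v) (u - v) + dot d d - 2 * t * dot d (u - v).
    by rewrite /dot !reimE; ring.
  by rewrite nu; nra.
apply/eqP; rewrite eq_le dot_ge0 andbT leNgt; apply/negP => dd.
set D := delta ^+ 2 in disc2; have D0 : 0 < D by rewrite exprn_gt0.
have := disc2 0; rewrite lexx ltr01 => /(_ isT); rewrite expr0n /= mul0r add0r => dD.
(* Chosen so that [2 * e * D] is [dot d d]: at [t = 1 - e] the left side of [disc2] becomes
   [D + e ^+ 2 * D]. *)
set e := dot d d / (2 * D).
have e0 : 0 < e by rewrite divr_gt0 // mulr_gt0.
have e1 : e <= 1 by rewrite ler_pdivrMr ?mulr_gt0 //; lra.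
have eD : 2 * e * D = dot d d by rewrite /e; field; rewrite gt_eqF.
have := disc2 (1 - e); rewrite subr_ge0 e1 ltrBlDr ltrDl e0 => /(_ isT).
have -> : (1 - e) ^+ 2 * D = D - 2 * e * D + e ^+ 2 * D by ring.
rewrite eD; have : 0 <= e ^+ 2 * D by rewrite mulr_ge0 ?sqr_ge0 // ltW.
lra.
Qed.

Lemma inscribed_polygon_face delta G w p : inscribed_face delta G w p ->
  polygon_interior p = connected_component (~` skeleton G : set (R[i])^o)%classic w.
Proof.
case=> _ _ _ hw [x _ E]; rewrite E; apply: (@same_connected_component (R[i])^o).
by move: hw; rewrite E.
Qed.

Lemma inscribed_vertex delta G w p u : planar_embedded G ->
  inscribed_face delta G w p -> u \in p -> vertex G u.
Proof.
move=> pe [_ hadj _ _ _] up; rewrite -(nth_index 0 up).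
by apply: adj_vertex pe _ _ (hadj _ _); rewrite index_mem.
Qed.

End Polygon.

(** * Faces, edge midpoints and rhombi of an isoradial graph *)

Section LatticeGeometry.
Import numFieldNormedType.Exports.
Variable R : realType.
Local Notation C := R[i].
Implicit Types (x y z u w d : C) (p q : seq C).
Variables (delta : R) (G : plane_graph R).
Hypothesis delta_gt0 : 0 < delta.
Hypothesis planarG : planar_embedded G.

Definition face w : set C :=
  connected_component (~` skeleton G : set (R[i])^o)%classic w.

Lemma Lambda_norm u w : Lambda_adj delta G u w -> dot (u - w) (u - w) = delta ^+ 2.
Proof. by case=> p F up; apply: inscribed_vertex_norm F up. Qed.

Lemma Lambda_vertex u w : Lambda_adj delta G u w -> vertex G u.
Proof. by case=> p F up; apply: inscribed_vertex F up. Qed.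

Lemma face_segment u w t : Lambda_adj delta G u w -> 0 <= t < 1 ->
  face w (w + t%:C%C * (u - w)).
Proof.
by case=> p F up ht; rewrite /face -(inscribed_polygon_face F); apply: inscribed_segment F up ht.
Qed.

Lemma face_convex u w x y s : Lambda_adj delta G u w -> 0 <= s <= 1 ->
  face w x -> face w y -> face w (x + s%:C%C * (y - x)).
Proof.
case=> p F up hs; rewrite /face -(inscribed_polygon_face F).
by apply: polygon_convex => //; apply: inscribed_size F.
Qed.

Lemma face_skeleton w z : face w z -> ~ skeleton G z.
Proof. by move=> /connected_component_sub. Qed.

(** Identifies white vertices: a single common point forces the faces, hence their circumcenters, to
    agree. *)
Lemma face_center u w u' w' z : Lambda_adj delta G u w -> Lambda_adj delta G u' w' ->
  face w z -> face w' z -> w = w'.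
Proof.
move=> [p F up] [q F' uq] h h'; apply: (inscribed_center_unique delta_gt0 F F').
rewrite (inscribed_polygon_face F) (inscribed_polygon_face F').
rewrite (@same_connected_component (R[i])^o _ _ _ h).
by rewrite (@same_connected_component (R[i])^o _ _ _ h').
Qed.

Definition mid (e : C * C) : C := (1 / 2)%:C%C * (e.1 + e.2).

Lemma midE u w : mid (u, w) = w + (1 / 2)%:C%C * (u - w).
Proof. by rewrite /mid; apply: complex_ext; rewrite !reimE /=; field. Qed.

Lemma mid_face u w : Lambda_adj delta G u w -> face w (mid (u, w)).
Proof. by move=> L; rewrite midE; apply: face_segment L _; lra. Qed.

Lemma skeleton_vertex u : vertex G u -> skeleton G u.
Proof. by left. Qed.

Lemma skeleton_segment u u' t : adj G u u' -> 0 <= t <= 1 ->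
  skeleton G (u + t%:C%C * (u' - u)).
Proof. by move=> h ht; right; exists u, u'; split=> //; exists t => //=; rewrite in_itv. Qed.

Lemma scaled_norm_eq (x y : C) (t : R) : 0 <= t -> x = t%:C%C * y ->
  dot x x = delta ^+ 2 -> dot y y = delta ^+ 2 -> x = y.
Proof.
move=> t0 xE nx ny; suff t1 : t = 1 by rewrite xE t1 rmorph1 mul1r.
have D0 : 0 < delta ^+ 2 by rewrite exprn_gt0.
have : t ^+ 2 * delta ^+ 2 = delta ^+ 2.
  by rewrite -{2}nx xE -ny /dot !reimE; ring.
move=> h; have {h} /eqP : t ^+ 2 = 1 by apply: (mulIf (lt0r_neq0 D0)); rewrite h mul1r.
by rewrite sqrf_eq1 => /orP[/eqP //|/eqP tN]; lra.
Qed.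

(** Every point of an edge but its black end lies in the face of its white end, so both edges have
    the same white end; a radius is then determined by its direction. *)
Lemma mid_on_edge u w u' w' t : Lambda_adj delta G u w -> Lambda_adj delta G u' w' ->
  0 <= t <= 1 -> mid (u, w) = u' + t%:C%C * (w' - u') -> (u, w) = (u', w').
Proof.
move=> L L' /andP[t0 t1] mE; have fm := mid_face L.
have [te|tn] := eqVneq t 0.
  case: (face_skeleton fm); rewrite mE te rmorph0 mul0r addr0.
  by apply: skeleton_vertex; apply: Lambda_vertex L'.
have mE' : mid (u, w) = w' + (1 - t)%:C%C * (u' - w').
  by rewrite mE; apply: complex_ext; rewrite !reimE; ring.
have f' : face w' (mid (u, w)).
  rewrite mE'; apply: face_segment L' _; move: t0; rewrite le_eqVlt eq_sym (negbTE tn) /=.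
  by move=> t0; lra.
have ww := face_center L L' fm f'; subst w'.
have uu : u - w = u' - w.
  apply: (@scaled_norm_eq _ _ (2 * (1 - t))); rewrite ?(Lambda_norm L) ?(Lambda_norm L') //.
    by lra.
  have : (1 / 2)%:C%C * (u - w) = (1 - t)%:C%C * (u' - w).
    by apply: (addrI w); rewrite -midE.
  move=> h; have -> : u - w = 2%:C%C * ((1 / 2)%:C%C * (u - w)).
    by apply: complex_ext; rewrite !reimE; field.
  by rewrite h mulrA -rmorphM.
by congr (_, _); apply: (addIr (- w)).
Qed.

Lemma mid_inj u w u' w' : Lambda_adj delta G u w -> Lambda_adj delta G u' w' ->
  mid (u, w) = mid (u', w') -> (u, w) = (u', w').
Proof.
move=> L L' e; apply: (mid_on_edge (t := 1 / 2) L L'); first by lra.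
by rewrite e /mid /=; apply: complex_ext; rewrite !reimE; field.
Qed.

(** The midpoint lies in the face of [w1], whence [w = w1]. If both coefficients were positive, the
    radius towards [u] would cross the chord from [u1] to [u2] before reaching the circle, although
    a radius avoids the skeleton up to its end. *)
Lemma mid_in_triangle u w u1 u2 w1 (al be : R) :
  Lambda_adj delta G u w -> adj G u1 u2 ->
  Lambda_adj delta G u1 w1 -> Lambda_adj delta G u2 w1 ->
  0 <= al -> 0 <= be -> al + be <= 1 ->
  mid (u, w) = w1 + al%:C%C * (u1 - w1) + be%:C%C * (u2 - w1) ->
  w = w1 /\ (u = u1 \/ u = u2).
Proof.
move=> L adj12 L1 L2 al0 be0 ab1 mE; have fm := mid_face L.
have s1 : al + be < 1.
  rewrite lt_neqAle ab1 andbT; apply/eqP => s1; apply: (face_skeleton fm).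
  have -> : mid (u, w) = u1 + be%:C%C * (u2 - u1).
    rewrite mE; have -> : al = 1 - be by lra.
    by apply: complex_ext; rewrite !reimE; ring.
  by apply: skeleton_segment adj12 _; lra.
have f1 : face w1 (mid (u, w)).
  have [s0|sn] := eqVneq (al + be) 0.
    have a0 : al = 0 by lra.
    have b0 : be = 0 by lra.
    have := @face_segment _ _ 0 L1; rewrite lexx ltr01 => /(_ isT).
    by rewrite mE a0 b0 !rmorph0 !mul0r !addr0.
  have sp : 0 < al + be by rewrite lt_neqAle eq_sym sn addr_ge0.
  have ht : 0 <= al + be < 1 by rewrite s1 ltW.
  have := face_convex (s := be / (al + be)) L1 _ (face_segment L1 ht) (face_segment L2 ht).
  rewrite divr_ge0 ?(ltW sp) //= ler_pdivrMr // mul1r lerDr al0 => /(_ isT).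
  congr (face _ _); rewrite mE; apply: complex_ext; rewrite !reimE; field; exact: sn.
have ww := face_center L L1 fm f1; split=> //; subst w1.
set a := u1 - w in mE; set b := u2 - w in mE.
have uE : u - w = (2 * al)%:C%C * a + (2 * be)%:C%C * b.
  have : (1 / 2)%:C%C * (u - w) = al%:C%C * a + be%:C%C * b.
    by apply: (addrI w); rewrite -midE mE addrA.
  move=> h; have -> : u - w = 2%:C%C * ((1 / 2)%:C%C * (u - w)).
    by apply: complex_ext; rewrite !reimE; field.
  by rewrite h; apply: complex_ext; rewrite !reimE; ring.
have nu := Lambda_norm L; have na := Lambda_norm L1; have nb := Lambda_norm L2.
have [a0|an] := eqVneq al 0.
  right; apply: (addIr (- w)); apply: (scaled_norm_eq (t := 2 * be)) => //; first by lra.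
  by rewrite uE a0 mulr0 rmorph0 mul0r add0r.
have [b0|bn] := eqVneq be 0.
  left; apply: (addIr (- w)); apply: (scaled_norm_eq (t := 2 * al)) => //; first by lra.
  by rewrite uE b0 mulr0 rmorph0 mul0r addr0.
exfalso.
have ap : 0 < al by rewrite lt_neqAle eq_sym an.
have bp : 0 < be by rewrite lt_neqAle eq_sym bn.
have u12 : a != b.
  apply/eqP => /addIr e; apply: (adj_irrefl planarG (u := u1)); by rewrite {2}e.
have ab := cauchy_strict na nb u12.
have D0 : 0 < delta ^+ 2 by rewrite exprn_gt0.
(* The radius meets the line through [u1] and [u2] at parameter [S^-1]; the strict Cauchy-Schwarz
   inequality for two distinct radii gives [1 < S]. *)
set S := 2 * al + 2 * be.
have S1 : 1 < S.
  have : delta ^+ 2 < S ^+ 2 * delta ^+ 2.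
    rewrite -{1}nu uE.
    have -> : dot ((2 * al)%:C%C * a + (2 * be)%:C%C * b) ((2 * al)%:C%C * a + (2 * be)%:C%C * b) =
      4 * al ^+ 2 * dot a a + 4 * be ^+ 2 * dot b b + 8 * (al * be) * dot a b.
      by rewrite /dot !reimE; ring.
    rewrite na nb /S.
    have : al * be * dot a b < al * be * delta ^+ 2 by rewrite ltr_pM2l // mulr_gt0.
    by lra.
  rewrite -{1}[delta ^+ 2]mul1r ltr_pM2r // => h.
  rewrite ltNge; apply/negP => S1; move: h; rewrite ltNge => /negP; apply.
  by rewrite expr_le1 // /S; lra.
have Sp : 0 < S by lra.
have ht : 0 <= S^-1 < 1 by rewrite invr_ge0 ltW //= invf_lt1.
apply: (face_skeleton (face_segment L ht)).
have -> : w + S^-1%:C%C * (u - w) = u1 + (2 * be / S)%:C%C * (u2 - u1).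
  rewrite uE /a /b; apply: complex_ext; rewrite !reimE /S; field; rewrite -/S; exact: lt0r_neq0.
apply: skeleton_segment adj12 _; rewrite divr_ge0 ?mulr_ge0 ?(ltW Sp) //=.
by rewrite ler_pdivrMr // /S; lra.
Qed.

(** Equality of the four sides makes the diagonals [c] and [d] orthogonal, and the defect [e] from a
    parallelogram orthogonal to both, hence zero. *)
Lemma rhombus_parallelogram r : is_rhombus delta G r ->
  rw1 r + rw2 r = ru1 r + ru2 r /\ cross (rw1 r - ru1 r) (rw2 r - ru1 r) != 0.
Proof.
case: r => u1 w1 u2 w2 [/= adj12 w12 [L11 L12] [L21 L22]].
have := Lambda_norm L11; have := Lambda_norm L12.
have := Lambda_norm L21; have := Lambda_norm L22 => n22 n21 n12 n11.
set c := u2 - u1; set d := w1 - w2; set e := w1 + w2 - u1 - u2.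
have c0 : 0 < dot c c.
  rewrite dot_gt0 subr_eq0; apply/eqP => ue; apply: (adj_irrefl planarG (u := u1)).
  by rewrite -{2}ue.
have d0 : 0 < dot d d by rewrite dot_gt0 subr_eq0; apply/eqP.
have dc : dot d c = 0.
  have -> : dot d c = 1 / 2 * (dot (u1 - w1) (u1 - w1) - dot (u1 - w2) (u1 - w2)
      - dot (u2 - w1) (u2 - w1) + dot (u2 - w2) (u2 - w2)).
    by rewrite /dot !reimE; field.
  by rewrite n11 n12 n21 n22; ring.
have ce : dot c e = 0.
  have -> : dot c e = 1 / 2 * (dot (u1 - w1) (u1 - w1) + dot (u1 - w2) (u1 - w2)
      - dot (u2 - w1) (u2 - w1) - dot (u2 - w2) (u2 - w2)).
    by rewrite /dot !reimE; field.
  by rewrite n11 n12 n21 n22; ring.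
have de : dot d e = 0.
  have -> : dot d e = 1 / 2 * (dot (u1 - w1) (u1 - w1) - dot (u1 - w2) (u1 - w2)
      + dot (u2 - w1) (u2 - w1) - dot (u2 - w2) (u2 - w2)).
    by rewrite /dot !reimE; field.
  by rewrite n11 n12 n21 n22; ring.
have cd : cross c d != 0.
  suff : cross c d ^+ 2 != 0 by rewrite sqrf_eq0.
  have -> : cross c d ^+ 2 = dot c c * dot d d - dot d c ^+ 2 by rewrite /cross /dot; ring.
  by rewrite dc expr0n subr0 mulf_neq0 // gt_eqF.
have e0 : e = 0.
  apply: complex_ext; rewrite ?Re0 ?Im0; apply: (mulIf cd); rewrite mul0r.
    have -> : complex.Re e * cross c d = complex.Im d * dot c e - complex.Im c * dot d e.
      by rewrite /cross /dot; ring.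
    by rewrite ce de !mulr0 subr0.
  have -> : complex.Im e * cross c d = complex.Re c * dot d e - complex.Re d * dot c e.
    by rewrite /cross /dot; ring.
  by rewrite ce de !mulr0 subr0.
have ws : w1 + w2 = u1 + u2 by apply/eqP; rewrite -subr_eq0 opprD addrA -/e e0.
split=> //; apply: contra cd => /eqP h.
have -> : c = (w1 - u1) + (w2 - u1).
  by rewrite /c addrACA ws; ring.
have -> : cross (w1 - u1 + (w2 - u1)) d = - 2 * cross (w1 - u1) (w2 - u1).
  by rewrite /d /cross !reimE; ring.
by rewrite h mulr0.
Qed.

Lemma rhombus_swap_w u1 w1 u2 w2 : is_rhombus delta G (Rhombus u1 w1 u2 w2) ->
  is_rhombus delta G (Rhombus u1 w2 u2 w1).
Proof. by case=> /= ? ? [? ?] [? ?]; split=> //= e; auto. Qed.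

Lemma rhombus_swap_u u1 w1 u2 w2 : is_rhombus delta G (Rhombus u1 w1 u2 w2) ->
  is_rhombus delta G (Rhombus u2 w1 u1 w2).
Proof. by case=> /= ? ? [? ?] [? ?]; split=> //=; apply: adj_sym. Qed.

Lemma mid_in_rhombus r u w : is_rhombus delta G r -> Lambda_adj delta G u w ->
  rhombus_set r (mid (u, w)) -> (u, w) \in rhombus_edges r.
Proof.
move=> hr L [s [t [/andP[s0 s1] /andP[t0 t1] mE]]].
have [par _] := rhombus_parallelogram hr.
case: r hr par mE => u1 w1 u2 w2 /= [/= adj12 _ [L11 L12] [L21 L22]] par mE.
rewrite !inE !xpair_eqE.
(* The black diagonal [s = t] separates the triangle at [w1] from the one at [w2]. *)
have [le|/ltW le] := leP t s.
  have [] := mid_in_triangle (al := 1 - s) (be := t) L adj12 L11 L21; [lra|lra|lra| |].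
    rewrite mE; have -> : w2 = u1 + u2 - w1 by rewrite -par; ring.
    by apply: complex_ext; rewrite !reimE; ring.
  by move=> -> [] ->; rewrite !eqxx ?orbT.
have [] := mid_in_triangle (al := 1 - t) (be := s) L adj12 L12 L22; [lra|lra|lra| |].
  rewrite mE; have -> : w1 = u1 + u2 - w2 by rewrite -par; ring.
  by apply: complex_ext; rewrite !reimE; ring.
by move=> -> [] ->; rewrite !eqxx ?orbT.
Qed.

End LatticeGeometry.

(** * Corner triangles cut off by arcs *)

Section Corner.
Variable R : realType.
Local Notation C := R[i].
Local Notation edge := (edge R).
Implicit Types (e f : edge) (x y z v : C) (r s t : R).

(* The arc joining [e] and [f] cuts off the corner [cor e f] of a triangle whose
   other vertices are [oth e f] on [e] and [oth f e] on [f]. *)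
Definition cor e f : C := if e.1 == f.1 then e.1 else e.2.
Definition oth e f : C := if e.1 == f.1 then e.2 else e.1.

Definition open_corner e f : set C := [set z | exists s t : R,
  [/\ 0 < s, 0 < t, s + t < 1 &
    z = cor e f + s%:C%C * (oth e f - cor e f) + t%:C%C * (oth f e - cor e f)]].
Definition closed_corner e f : set C := half_set (oth e f, oth f e, cor e f).

(* Positive when the corner lies to the left of [e], oriented from its black
   end to its white end. *)
Definition orient e f : R := cross (e.2 - e.1) (oth f e - e.1).

(** The alternatives mirror the test in [cor], which therefore returns a common endpoint; the
    condition on [orient] makes the triangle nondegenerate. *)
Definition corner_pair e f : Prop :=
  [/\ e.1 = f.1 \/ (e.1 <> f.1 /\ e.2 = f.2) & orient e f != 0].

Lemma corC e f : corner_pair e f -> cor f e = cor e f.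
Proof. by case: e f => [a b] [c d] [/= h _]; rewrite /cor /= (eq_sym c); case: eqP h => [-> //|ne] [/ne //|[_ ->]]. Qed.

Lemma turnE e f : turn e f = arg ((oth f e - cor e f) / (oth e f - cor e f)).
Proof. by rewrite /turn /oth /cor (eq_sym f.1); case: ifP. Qed.

Lemma orientE e f : corner_pair e f ->
  orient e f = (if e.1 == f.1 then 1 else -1) *
    cross (oth e f - cor e f) (oth f e - cor e f).
Proof.
move=> _; rewrite /orient /oth /cor (eq_sym f.1); case: ifP => _; first by rewrite mul1r.
by rewrite /cross !reimE; ring.
Qed.

Lemma orientC e f : corner_pair e f -> orient f e = - orient e f.
Proof.
move=> h; have := corC h; case: h => h _; rewrite /orient /oth /cor (eq_sym f.1).
case: eqP h => [e1 _ _|_ [//|[_ e2 _]]]; rewrite -?e1 -?e2 /cross !reimE; ring.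
Qed.

Lemma corner_pairC e f : corner_pair e f -> corner_pair f e.
Proof.
move=> h; split; last by rewrite orientC // oppr_eq0; case: h.
by case: h => -[->|[h ->]] _; [left|right; split=> // /esym].
Qed.

Lemma cross_corner_neq0 e f : corner_pair e f ->
  cross (oth e f - cor e f) (oth f e - cor e f) != 0.
Proof. by move=> h; have [_] := h; rewrite orientE // mulf_eq0 negb_or => /andP[]. Qed.

Lemma open_cornerC e f : corner_pair e f -> open_corner f e = open_corner e f.
Proof.
move=> h; rewrite /open_corner (corC h); apply/seteqP; split=> z [s [t [? ? ? ->]]];
 exists t, s; split=> //; rewrite 1?addrC //; ring.
Qed.

Lemma closed_cornerC e f : corner_pair e f -> closed_corner f e = closed_corner e f.
Proof.
move=> h; rewrite /closed_corner /half_set /hapex /hsrc /hdst /= (corC h).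
by apply/seteqP; split=> z [s [t [? ? ? ->]]]; exists t, s; split=> //; rewrite 1?addrC //; ring.
Qed.

Lemma open_corner_closed e f z : open_corner e f z -> closed_corner e f z.
Proof. by case=> s [t [? ? ? ->]]; exists s, t; split=> //; apply: ltW. Qed.

Lemma mid_corner e f : corner_pair e f ->
  mid e = cor e f + (1 / 2)%:C%C * (oth e f - cor e f).
Proof.
by move=> h; rewrite /mid /cor /oth; case: ifP => _; apply: complex_ext; rewrite !reimE; field.
Qed.

Lemma mid_closed_corner e f : corner_pair e f -> closed_corner e f (mid e).
Proof.
move=> h; exists (1 / 2), 0; split; [lra|lra|lra|].
by rewrite (mid_corner h) /hapex /hsrc /= rmorph0 mul0r addr0.
Qed.

Lemma chord_open_corner e f t : corner_pair e f -> 0 < t < 1 ->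
  open_corner e f (mid e + t%:C%C * (mid f - mid e)).
Proof.
move=> h /andP[t0 t1]; exists ((1 - t) / 2), (t / 2); split; [lra|lra|lra|].
rewrite (mid_corner h) (mid_corner (corner_pairC h)) (corC h).
by apply: complex_ext; rewrite !reimE; field.
Qed.

Lemma corner_coord e f z s t : corner_pair e f ->
  z = cor e f + s%:C%C * (oth e f - cor e f) + t%:C%C * (oth f e - cor e f) ->
  s = cross (z - cor e f) (oth f e - cor e f) / cross (oth e f - cor e f) (oth f e - cor e f) /\
  t = cross (oth e f - cor e f) (z - cor e f) / cross (oth e f - cor e f) (oth f e - cor e f).
Proof.
move=> h ->; have X0 := cross_corner_neq0 h.
have -> (v a b : C) : v + a + b - v = a + b by ring.
have [-> ->] := cross_coord (oth e f - cor e f) (oth f e - cor e f) s t.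
by rewrite !mulfK.
Qed.

Lemma mid_open_corner e f : corner_pair e f -> ~ open_corner e f (mid e).
Proof.
move=> h [s [t [s0 t0 st zE]]]; have [_ tE] := corner_coord h zE.
move: t0; rewrite tE (mid_corner h).
have -> (v a : C) : v + a - v = a by ring.
set a := oth e f - _.
have -> : cross a ((1 / 2)%:C%C * a) = 0 by rewrite /cross !reimE; ring.
by rewrite mul0r ltxx.
Qed.

(** The direction in which [e] is crossed with its black end on the left; the projection lines are
    spanned by the square roots of its inverse. *)
Definition edge_normal e : C := 'i%C * (e.2 - e.1).

(** Leaving the midpoint along the normal, the coordinate towards the far vertex of the corner
    starts from 0 with the sign of [r * orient e f]. The drift [k] of the other coordinate, which
    starts from 1/2, is harmless for small [eps]. *)
Lemma near_mid_coord e f (r : R) : corner_pair e f ->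
  exists k : R, forall eps : R,
    mid e + (eps * r)%:C%C * edge_normal e =
    cor e f + (1 / 2 + eps * k)%:C%C * (oth e f - cor e f) +
      (eps * (r * dot (e.2 - e.1) (e.2 - e.1) / orient e f))%:C%C * (oth f e - cor e f).
Proof.
move=> h; have X0 := cross_corner_neq0 h; have [_ O0] := h.
set a := oth e f - cor e f; set b := oth f e - cor e f.
exists (r * (cross (edge_normal e) b / cross a b)) => eps.
rewrite (mid_corner h) {1}(cross_basis (edge_normal e) X0) -/a -/b.
have -> : cross a (edge_normal e) = dot (e.2 - e.1) (e.2 - e.1) * (if e.1 == f.1 then 1 else -1).
  rewrite /a /edge_normal /oth /cor; case: ifP => _; rewrite /cross /dot !reimE; ring.
have -> : orient e f = (if e.1 == f.1 then 1 else -1) * cross a b by exact: orientE.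
move: X0; rewrite -/a -/b => X0; have X0' := X0; rewrite /cross in X0'.
case: ifP => _; apply: complex_ext; rewrite !reimE; field; rewrite ?X0 ?X0' //.
Qed.

Lemma near_mid_open_corner e f (r : R) : corner_pair e f -> e.1 != e.2 ->
  0 < r * orient e f -> exists2 q : R, 0 < q &
    forall eps, 0 < eps < q -> open_corner e f (mid e + (eps * r)%:C%C * edge_normal e).
Proof.
move=> h e12 ro; have [k kE] := near_mid_coord r h.
set k2 := _ / orient e f in kE.
have k2p : 0 < k2.
  have -> : k2 = dot (e.2 - e.1) (e.2 - e.1) * (r * orient e f) / (orient e f ^+ 2).
    by rewrite /k2; field; case: h.
  apply: divr_gt0; first by apply: mulr_gt0 => //; rewrite dot_gt0 subr_eq0 eq_sym.
  by rewrite exprn_even_gt0 //=; case: h.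
(* Below this bound both increments are less than 1/4 in absolute value, so the first coordinate
   stays above 1/4 and the sum below 3/4. *)
exists (4 * (`|k| + k2))^-1 => [|eps /andP[eps0]].
  by rewrite invr_gt0 mulr_gt0 // ltr_wpDl ?normr_ge0.
rewrite -[_^-1]mul1r ltr_pdivlMr; last by rewrite mulr_gt0 // ltr_wpDl ?normr_ge0.
move=> epsE; rewrite kE; exists (1 / 2 + eps * k), (eps * k2); split=> //.
- have : - `|k| <= k by rewrite lerNl -normrN ler_norm.
  by nra.
- exact: mulr_gt0.
- have := ler_norm k; nra.
Qed.

Lemma far_affine (a b : R) : a < 0 -> exists2 q : R, 0 < q & forall eps, 0 < eps < q -> a + eps * b < 0.
Proof.
move=> a0; exists (- a / (`|b| + 1)) => [|eps /andP[e0]].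
  by rewrite divr_gt0 ?oppr_gt0 // ltr_wpDl ?normr_ge0.
rewrite ltr_pdivlMr ?ltr_wpDl ?normr_ge0 // => h; have := ler_norm b; nra.
Qed.

(** A closed triangle is given by three affine inequalities; one that fails at [m] still fails on a
    short piece of the ray. *)
Lemma far_closed_corner e f (m n : C) : corner_pair e f -> ~ closed_corner e f m ->
  exists2 q : R, 0 < q & forall eps, 0 < eps < q -> ~ closed_corner e f (m + eps%:C%C * n).
Proof.
move=> h mN; set a := oth e f - cor e f; set b := oth f e - cor e f.
have X0 : cross a b != 0 by exact: cross_corner_neq0.
have lin1 (c v d : C) (x : R) : cross (c + x%:C%C * n - v) d = cross (c - v) d + x * cross n d.
  by rewrite /cross !reimE; ring.
have lin2 (c v d : C) (x : R) : cross d (c + x%:C%C * n - v) = cross d (c - v) + x * cross d n.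
  by rewrite /cross !reimE; ring.
pose sm := cross (m - cor e f) b / cross a b; pose tm := cross a (m - cor e f) / cross a b.
pose sn := cross n b / cross a b; pose tn := cross a n / cross a b.
have mE : m = cor e f + sm%:C%C * a + tm%:C%C * b.
  by rewrite -addrA -cross_basis // addrC subrK.
have far eps : closed_corner e f (m + eps%:C%C * n) ->
    [/\ 0 <= sm + eps * sn, 0 <= tm + eps * tn & (sm + eps * sn) + (tm + eps * tn) <= 1].
  move=> [s [t [s0 t0 st zE]]]; have [sE tE] := corner_coord h zE.
  have <- : s = sm + eps * sn.
    by rewrite sE lin1 mulrDl -mulrA.
  have <- : t = tm + eps * tn.
    by rewrite tE lin2 mulrDl -mulrA.
  by [].
have [s0|/(far_affine sn)[q q0 hq]] := leP 0 sm; last first.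
  by exists q => // eps /hq lt /far[]; rewrite leNgt lt.
have [t0|/(far_affine tn)[q q0 hq]] := leP 0 tm; last first.
  by exists q => // eps /hq lt /far[_]; rewrite leNgt lt.
have [st|st] := leP (sm + tm) 1; first by case: mN; exists sm, tm.
have : 1 - (sm + tm) < 0 by lra.
move=> /(far_affine (- (sn + tn)))[q q0 hq].
by exists q => // eps /hq lt /far[_ _]; lra.
Qed.

Lemma far_segment p q m n : p != q :> C -> ~ segment p q m ->
  exists2 r : R, 0 < r & forall eps, 0 < eps < r -> ~ segment p q (m + eps%:C%C * n).
Proof.
move=> pq mN; set d := q - p; have d0 : 0 < dot d d by rewrite dot_gt0 subr_eq0 eq_sym.
have seg z : segment p q z -> [/\ cross d (z - p) = 0, 0 <= dot d (z - p) & dot d (z - p) <= dot d d].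
  case=> t /=; rewrite in_itv /= => /andP[t0 t1] <-.
  have -> : p + t%:C%C * (q - p) - p = t%:C%C * d by rewrite /d; ring.
  by rewrite dotZr; split; [rewrite /cross !reimE; ring|nra|nra].
have crossA eps : cross d (m + eps%:C%C * n - p) = cross d (m - p) + eps * cross d n.
  by rewrite /cross !reimE; ring.
have dotA eps : dot d (m + eps%:C%C * n - p) = dot d (m - p) + eps * dot d n.
  by rewrite /dot !reimE; ring.
have [/(far_affine (cross d n))[r r0 hr]|c0] := ltP (cross d (m - p)) 0.
  by exists r => // eps /hr lt /seg[]; rewrite crossA; lra.
have [c0'|c1] := ltP 0 (cross d (m - p)).
  have : - cross d (m - p) < 0 by lra.
  by move=> /(far_affine (- cross d n))[r r0 hr]; exists r => // eps /hr lt /seg[]; rewrite crossA; lra.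
have [/(far_affine (dot d n))[r r0 hr]|d1] := ltP (dot d (m - p)) 0.
  by exists r => // eps /hr lt /seg[_]; rewrite dotA; lra.
have [|d2] := ltP (dot d d - dot d (m - p)) 0.
  by move=> /(far_affine (- dot d n))[r r0 hr]; exists r => // eps /hr lt /seg[_ _]; rewrite dotA; lra.
case: mN; exists (dot d (m - p) / dot d d) => /=.
  by rewrite in_itv /= divr_ge0 ?(ltW d0) //= ler_pdivrMr // mul1r; lra.
have cz : cross d (m - p) = 0 by lra.
apply/eqP; rewrite -subr_eq0; apply/eqP/dot_eq0.
rewrite -/d; set k := _ / _.
have -> : p + k%:C%C * d - m = k%:C%C * d - (m - p) by ring.
move: (m - p) cz @k => y cz k.
(* Lagrange's identity: a vector with zero cross and dot product against a nonzero [d] vanishes. *)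
have : dot d d * dot (k%:C%C * d - y) (k%:C%C * d - y) = 0.
  have -> : dot d d * dot (k%:C%C * d - y) (k%:C%C * d - y) =
     (k * dot d d - dot d y) ^+ 2 + cross d y ^+ 2.
    by rewrite /dot /cross !reimE; ring.
  by rewrite cz /k divfK ?gt_eqF // subrr; ring.
by move/eqP; rewrite mulf_eq0 gt_eqF //= => /eqP.
Qed.

End Corner.

(** * Open sets, rays and interiors of corners *)

Section Topology.
Import numFieldNormedType.Exports.
Local Open Scope classical_set_scope.
Variable R : realType.
Local Notation C := R[i].
Local Notation edge := (edge R).
Implicit Types (e f : edge) (x y z v m n : C) (A : set C).

(** Radii of balls in this topology are elements of [R[i]]; a positive one is real. *)
Lemma nbhs_cplx z A : nbhs (z : (R[i])^o) (A : set (R[i])^o) <->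
  exists2 q : R, 0 < q & forall h : C, `|h| < q%:C%C -> A (z + h).
Proof.
split.
  move=> /nbhs_ballP[[q q'] /=]; rewrite ltcE /= => /andP[/eqP -> q0] hA.
  exists q => // h hq; apply: hA; rewrite /ball /= opprD addrA subrr sub0r normrN.
  exact: hq.
move=> [q q0 hA]; apply/nbhs_ballP; exists q%:C%C => /=; first by rewrite ltcR.
move=> y; rewrite /ball /= => hq; have -> : y = z + (y - z) by rewrite addrC subrK.
by apply: hA; rewrite -normrN opprB.
Qed.

Lemma near_right_ex (P : R -> Prop) : (\forall eps \near (0 : R)^'+, P eps) ->
  exists2 q : R, 0 < q & forall eps, 0 < eps < q -> P eps.
Proof.
move=> /nbhs_ballP[q /= q0 h]; exists q => // eps /andP[e0 eq]; apply: h => //=.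
by rewrite /ball /= sub0r normrN gtr0_norm.
Qed.

Lemma open_set_ray A m n : open_set A -> A m ->
  exists2 q : R, 0 < q & forall eps : R, 0 < eps < q -> A (m + eps%:C%C * n).
Proof.
rewrite /open_set openE => oA Am; have /nbhs_cplx[q q0 hq] := oA _ Am.
pose N := complex.Re `|n|; have N0 : 0 <= N.
  by have := normr_ge0 n; rewrite lecE => /andP[].
have NE : `|n| = N%:C%C by rewrite /N normE.
exists (q / (N + 1)) => [|eps /andP[e0]]; first by rewrite divr_gt0 // ltr_wpDl.
rewrite ltr_pdivlMr ?ltr_wpDl // => eq; apply: hq.
rewrite normrM NE normc_def /= expr0n addr0 sqrtr_sqr gtr0_norm // -rmorphM ltcR.
by nra.
Qed.

Lemma open_corner_interior e f A : corner_pair e f -> open_corner e f `<=` A ->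
  open_corner e f `<=` interior (A : set (R[i])^o).
Proof.
move=> h cA z [s [t [s0 t0 st zE]]]; apply/nbhs_cplx.
set a := oth e f - cor e f in zE; set b := oth f e - cor e f in zE.
have X0 : cross a b != 0 by exact: cross_corner_neq0.
(* A displacement of norm less than [r] changes each coordinate by less than [r * M]. Below, [r] is
   taken so that [r * M] is half the smallest of the three margins [s], [t] and [1 - (s + t)]; the
   changes of both coordinates together then fit into the last one. *)
pose M := (`|complex.Re a| + `|complex.Im a| + `|complex.Re b| + `|complex.Im b|) / `|cross a b| + 1.
have M0 : 0 < M by rewrite ltr_wpDl // divr_ge0 // !addr_ge0.
have bound (k y : C) (r : R) : `|y| < r%:C%C ->
   `|complex.Re k| + `|complex.Im k| <= (M - 1) * `|cross a b| -> `|cross k y / cross a b| < r * M.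
  move=> hy hk; have r0 : 0 < r by rewrite -ltcR; exact: (le_lt_trans (normr_ge0 y) hy).
  have yR : `|complex.Re y| < r by rewrite -ltcR; apply: le_lt_trans (normc_ge_Re _) hy.
  have yI : `|complex.Im y| < r.
    rewrite -ltcR; apply: le_lt_trans hy.
    by rewrite normE lecR -sqrtr_sqr ler_wsqrtr // /dot -!expr2 lerDr sqr_ge0.
  rewrite normrM normfV ltr_pdivrMr ?normr_gt0 //.
  have : `|cross k y| <= `|complex.Re k| * `|complex.Im y| + `|complex.Im k| * `|complex.Re y|.
    by rewrite /cross -!normrM; apply: ler_normB.
  have : 0 < `|cross a b| by rewrite normr_gt0.
  move: (`|complex.Re k|) (normr_ge0 (complex.Re k)) (`|complex.Im k|) (normr_ge0 (complex.Im k)) hk => k1 k10 k2 k20 hk.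
  move: (`|cross k y|) (`|cross a b|) hk => c X hk X1 hc.
  nra.
pose r := Num.min s (Num.min t (1 - (s + t))) / (2 * M).
have r0 : 0 < r by rewrite divr_gt0 ?mulr_gt0 // !lt_min s0 t0 subr_gt0 st.
have rM : r * M = Num.min s (Num.min t (1 - (s + t))) / 2.
  by rewrite /r; field; rewrite gt_eqF.
exists r => // y hy; apply: cA.
have MX : (M - 1) * `|cross a b| = `|complex.Re a| + `|complex.Im a| + `|complex.Re b| + `|complex.Im b|.
  by rewrite /M addrK divfK // normr_eq0.
have ha : `|cross a y / cross a b| < r * M.
  by apply: bound hy _; rewrite MX -addrA lerDl addr_ge0.
have hb : `|cross b y / cross a b| < r * M.
  by apply: bound hy _; rewrite MX -addrA lerDr addr_ge0.
have m1 : Num.min s (Num.min t (1 - (s + t))) <= s by rewrite ge_min lexx.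
have m2 : Num.min s (Num.min t (1 - (s + t))) <= t by rewrite !ge_min lexx orbT.
have m3 : Num.min s (Num.min t (1 - (s + t))) <= 1 - (s + t) by rewrite !ge_min lexx !orbT.
exists (s + cross y b / cross a b), (t + cross a y / cross a b).
have cE : cross y b / cross a b = - (cross b y / cross a b).
  by rewrite -mulNr; congr (_ / _); rewrite /cross; ring.
rewrite cE; move: ha hb; rewrite !ltr_norml rM => /andP[? ?] /andP[? ?].
split; [lra|lra|lra|].
rewrite -cE zE -/a -/b {1}(cross_basis y X0) !rmorphD; ring.
Qed.

Lemma open_corner_open e f : corner_pair e f -> open_set (open_corner e f).
Proof.
by move=> h; rewrite /open_set openE; apply: open_corner_interior h _.
Qed.

(** Moving [z] slightly towards the centroid of the second triangle enters its interior without
    leaving the first open corner. *)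
Lemma open_closed_corner_meet e f e' f' z : corner_pair e f ->
  open_corner e f z -> closed_corner e' f' z ->
  exists2 z', open_corner e f z' & open_corner e' f' z'.
Proof.
move=> h hz [s [t [s0 t0 st zE]]].
rewrite /hapex /hsrc /hdst /= in zE.
set v := cor e' f' in zE; set a := oth e' f' - v in zE; set b := oth f' e' - v in zE.
have [q q0 hq] := open_set_ray (v + (1 / 3)%:C%C * a + (1 / 3)%:C%C * b - z) (open_corner_open h) hz.
pose eps := Num.min q 1 / 2.
have m0 : 0 < Num.min q 1 by rewrite lt_min q0 ltr01.
have mq : Num.min q 1 <= q by rewrite ge_min lexx.
have m1 : Num.min q 1 <= 1 by rewrite ge_min lexx orbT.
have e0 : 0 < eps by rewrite /eps; lra.
have e1 : eps < 1 by rewrite /eps; lra.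
exists (z + eps%:C%C * (v + (1 / 3)%:C%C * a + (1 / 3)%:C%C * b - z)).
  by apply: hq; rewrite /eps; apply/andP; split; lra.
exists ((1 - eps) * s + eps / 3), ((1 - eps) * t + eps / 3); split; [nra|nra|nra|].
rewrite -/v -/a -/b zE; clear zE hq; clearbody eps a b v.
by apply: complex_ext; rewrite !reimE; field.
Qed.

End Topology.

(** * The arcs of a configuration tile the domain *)

Section DomainArcs.
Import numFieldNormedType.Exports.
Local Open Scope classical_set_scope.
Variables (R : realType) (delta : R) (G : plane_graph R) (D : fk_data R).
Hypothesis delta_gt0 : 0 < delta.
Hypothesis planarG : planar_embedded G.
Hypothesis dom : fk_domain delta G D.
Local Notation C := R[i].
Local Notation edge := (edge R).
Implicit Types (e f : edge) (al : edge * edge) (x y z v m n : C) (c : config D)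
  (r : rhombus R) (h : Defs.half R).

Definition Lambda_edge e : Prop := Lambda_adj delta G e.1 e.2.

Lemma Lambda_edge_neq e : Lambda_edge e -> e.1 != e.2.
Proof.
move=> L; rewrite -subr_eq0 -dot_gt0 (Lambda_norm L).
by rewrite exprn_gt0.
Qed.

(* Up to relabelling the rhombus, an arc goes around [w1] or around [u1]. *)
Definition rhombus_arc al : Prop := exists u1 w1 u2 w2,
  is_rhombus delta G (Rhombus u1 w1 u2 w2) /\
  (al = ((u1, w1), (u2, w1)) \/ al = ((u1, w1), (u1, w2))).

Lemma rhombus_arcs_arc r (b : bool) al :
  is_rhombus delta G r -> al \in rhombus_arcs b r -> rhombus_arc al.
Proof.
case: r => u1 w1 u2 w2 hr; case: b => /=; rewrite !inE => /orP[/eqP ->|/eqP ->].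
- by exists u1, w1, u2, w2; split=> //; left.
- by exists u1, w2, u2, w1; split; [exact: rhombus_swap_w|left].
- by exists u1, w1, u2, w2; split=> //; right.
- by exists u2, w1, u1, w2; split; [exact: rhombus_swap_u|right].
Qed.

Lemma rhombus_arc_edges al : rhombus_arc al ->
  Lambda_edge al.1 /\ Lambda_edge al.2.
Proof.
by move=> [u1 [w1 [u2 [w2 [[/= _ _ [? ?] [? ?]] [->|->]]]]]].
Qed.

Lemma rhombus_arc_corner al : rhombus_arc al ->
  corner_pair al.1 al.2.
Proof.
move=> [u1 [w1 [u2 [w2 [hr E]]]]].
have [/= par nz] := rhombus_parallelogram planarG hr.
case: hr => /= adj12 _ _ _; case: E => -> /=; split=> /=; rewrite ?/orient /oth /=.
- right; split=> // e; apply: (adj_irrefl planarG (u := u1)); by rewrite {2}e.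
- have -> : (u2 == u1) = false.
    by apply/eqP => e; apply: (adj_irrefl planarG (u := u1)); rewrite -{2}e.
  have -> : u2 - u1 = (w1 - u1) + (w2 - u1) by rewrite addrACA par; ring.
  move: nz; congr (_ != _); rewrite /cross !reimE; ring.
- by left.
- by rewrite eqxx.
Qed.

Lemma rhombus_arc_sub al : rhombus_arc al -> exists r,
  [/\ is_rhombus delta G r, al.1 \in rhombus_edges r, al.2 \in rhombus_edges r,
   closed_corner al.1 al.2 `<=` rhombus_set r &
   forall e, e \in rhombus_edges r -> closed_corner al.1 al.2 (mid e) -> e = al.1 \/ e = al.2].
Proof.
move=> ha; have hc := rhombus_arc_corner ha.
move: ha hc => [u1 [w1 [u2 [w2 [hr E]]]]] hc; exists (Rhombus u1 w1 u2 w2).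
have [/= par nz] := rhombus_parallelogram planarG hr.
have u12 : (u1 == u2) = false.
  apply/eqP => e; case: hr => /= adj12 _ _ _.
  by apply: (adj_irrefl planarG (u := u1)); rewrite {2}e.
have w2E : w2 = u1 + u2 - w1 by rewrite -par; ring.
split=> //.
- by case: E => ->; rewrite /= !inE eqxx.
- by case: E => ->; rewrite /= !inE eqxx ?orbT.
- case: E => -> z [s [t [s0 t0 st ->]]]; rewrite /hapex /hsrc /hdst /= /cor /oth /= ?u12 ?(eq_sym u2) ?u12 ?eqxx /=.
    exists (1 - s), t; split; [lra|lra|].
    by rewrite /= w2E; apply: complex_ext; rewrite !reimE; ring.
  by exists s, t; split; [lra|lra|].
- move=> e; rewrite !inE => /or4P eE [s [t [s0 t0 st mE]]].
  have [] := corner_coord hc mE.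
  have X0 := cross_corner_neq0 hc.
  (* The midpoints of the two sides not touched by the arc have coordinates 1 and 1/2 in some order,
     beyond the diagonal where the sum is 1. *)
  have key (s' t' : R) : 1 < s' + t' ->
      mid e = cor al.1 al.2 + s'%:C%C * (oth al.1 al.2 - cor al.1 al.2) +
        t'%:C%C * (oth al.2 al.1 - cor al.1 al.2) -> False.
    move=> st' mE'; have [sE tE] := corner_coord hc mE; have [sE' tE'] := corner_coord hc mE'.
    by move: st'; rewrite sE' tE' -sE -tE ltNge st.
  move=> _ _; case: E => al_E; rewrite al_E in key *; rewrite /cor /oth /= ?u12 ?(eq_sym u2) ?u12 ?eqxx /= in key.
    case: eE => /eqP eE; rewrite ?eE /=; auto; exfalso; rewrite eE in key.
      by apply: (key 1 (1 / 2)); [lra|rewrite /mid /= w2E; apply: complex_ext; rewrite !reimE; field].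
    by apply: (key (1 / 2) 1); [lra|rewrite /mid /= w2E; apply: complex_ext; rewrite !reimE; field].
  have u2E : u2 = w1 + w2 - u1 by rewrite par; ring.
  case: eE => /eqP eE; rewrite ?eE /=; auto; exfalso; rewrite eE in key.
    by apply: (key 1 (1 / 2)); [lra|rewrite /mid /= u2E; apply: complex_ext; rewrite !reimE; field].
  by apply: (key (1 / 2) 1); [lra|rewrite /mid /= u2E; apply: complex_ext; rewrite !reimE; field].
Qed.

Lemma mid_closed_corner_side al e : rhombus_arc al -> Lambda_edge e ->
  closed_corner al.1 al.2 (mid e) -> e = al.1 \/ e = al.2.
Proof.
move=> /rhombus_arc_sub[r [hr _ _ sub side]] L h; apply: side => //.
by case: e L h => u w L h; apply: (mid_in_rhombus delta_gt0 planarG hr L); apply: sub.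
Qed.

(* The corners cut off by the arcs [s] tile the cell [A]. *)
Definition arcs_of_cell (A : set C) (s : seq (edge * edge)) : Prop :=
  [/\ forall al, al \in s -> rhombus_arc al,
      forall al, al \in s -> closed_corner al.1 al.2 `<=` A,
      forall z, A z -> exists2 al, al \in s & closed_corner al.1 al.2 z &
      forall al be z, al \in s -> be \in s ->
        open_corner al.1 al.2 z -> open_corner be.1 be.2 z -> al = be].

(** Each choice of arcs cuts the rhombus along a diagonal: the black one for arcs around white
    vertices, the white one otherwise. All claims are read off in the coordinates [s], [t] of the
    parallelogram. *)
Lemma rhombus_arcs_cell r (b : bool) : is_rhombus delta G r ->
  arcs_of_cell (rhombus_set r) (rhombus_arcs b r).
Proof.
case: r => u1 w1 u2 w2 hr.
have [/= par nz] := rhombus_parallelogram planarG hr.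
have u12 : (u1 == u2) = false.
  apply/eqP => e; case: hr => /= adj12 _ _ _.
  by apply: (adj_irrefl planarG (u := u1)); rewrite {2}e.
have u2E : u2 = w1 + w2 - u1 by rewrite par; ring.
have cE z s t : z = u1 + s%:C%C * (w1 - u1) + t%:C%C * (w2 - u1) ->
    s = cross (z - u1) (w2 - u1) / cross (w1 - u1) (w2 - u1) /\
    t = cross (w1 - u1) (z - u1) / cross (w1 - u1) (w2 - u1).
  move=> ->; have -> (v x y : C) : v + x + y - v = x + y by ring.
  by have [-> ->] := cross_coord (w1 - u1) (w2 - u1) s t; rewrite !mulfK.
have uniq z s t s' t' : z = u1 + s%:C%C * (w1 - u1) + t%:C%C * (w2 - u1) ->
    z = u1 + s'%:C%C * (w1 - u1) + t'%:C%C * (w2 - u1) -> s = s' /\ t = t'.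
  by move=> /cE[-> ->] /cE[-> ->].
split=> [al|al|z|al be z].
- exact: rhombus_arcs_arc.
- case: b; rewrite !inE => /orP[] /eqP -> z [s [t [s0 t0 st ->]]]; rewrite /hapex /hsrc /hdst /= /cor /oth /= ?u12 ?(eq_sym u2) ?u12 ?eqxx /=.
  + exists (1 - s), t; split; [lra|lra|].
    by rewrite /= u2E; apply: complex_ext; rewrite !reimE; ring.
  + exists t, (1 - s); split; [lra|lra|].
    by rewrite /= u2E; apply: complex_ext; rewrite !reimE; ring.
  + by exists s, t; split; [lra|lra|].
  + exists (1 - t), (1 - s); split; [lra|lra|].
    by rewrite /= u2E; apply: complex_ext; rewrite !reimE; ring.
- move=> [s [t [/andP[s0 s1] /andP[t0 t1] ->]]] /=; case: b.
    have [ts|/ltW st] := leP t s.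
      exists ((u1, w1), (u2, w1)); first by rewrite inE eqxx.
      exists (1 - s), t; split; [lra|lra|lra|].
      rewrite /hapex /hsrc /hdst /cor /oth /= ?u12 ?(eq_sym u2) ?u12 u2E /=.
      by apply: complex_ext; rewrite !reimE; ring.
    exists ((u1, w2), (u2, w2)); first by rewrite !inE eqxx orbT.
    exists (1 - t), s; split; [lra|lra|lra|].
    rewrite /hapex /hsrc /hdst /cor /oth /= ?u12 ?(eq_sym u2) ?u12 u2E /=.
    by apply: complex_ext; rewrite !reimE; ring.
  have [st|/ltW st] := leP (s + t) 1.
    exists ((u1, w1), (u1, w2)); first by rewrite inE eqxx.
    by exists s, t; split=> //; rewrite /hapex /hsrc /hdst /cor /oth /= eqxx.
  exists ((u2, w1), (u2, w2)); first by rewrite !inE eqxx orbT.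
  exists (1 - t), (1 - s); split; [lra|lra|lra|].
  rewrite /hapex /hsrc /hdst /cor /oth /= eqxx u2E /=.
  by apply: complex_ext; rewrite !reimE; ring.
- case: b; rewrite !inE => /orP[] /eqP -> /orP[] /eqP -> //= [s [t [s0 t0 st zE]]] [s' [t' [s0' t0' st' zE']]];
   exfalso; move: zE zE'; rewrite /cor /oth /= ?u12 ?(eq_sym u2) ?u12 ?eqxx /= => zE zE'.
  + have [] := uniq z (1 - s) t t' (1 - s').
      by rewrite zE u2E; apply: complex_ext; rewrite !reimE; ring.
      by rewrite zE' u2E; apply: complex_ext; rewrite !reimE; ring.
    by lra.
  + have [] := uniq z t (1 - s) (1 - s') t'.
      by rewrite zE u2E; apply: complex_ext; rewrite !reimE; ring.
      by rewrite zE' u2E; apply: complex_ext; rewrite !reimE; ring.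
    by lra.
  + have [] := uniq z s t (1 - t') (1 - s').
      by rewrite zE.
      by rewrite zE' u2E; apply: complex_ext; rewrite !reimE; ring.
    by lra.
  + have [] := uniq z s' t' (1 - t) (1 - s).
      by rewrite zE'.
      by rewrite zE u2E; apply: complex_ext; rewrite !reimE; ring.
    by lra.
Qed.

Lemma half_arc_cell h (al : edge * edge) : rhombus_arc al ->
  half_set h = closed_corner al.1 al.2 -> arcs_of_cell (half_set h) [:: al].
Proof.
move=> ha hE; split=> [be|be|z|be ga z]; rewrite ?inE ?hE.
- by move/eqP->.
- by move/eqP->.
- by move=> hz; exists al; rewrite ?inE.
- by move=> /eqP-> /eqP->.
Qed.

Lemma white_half_arcP h : h \in white_halves D ->
  rhombus_arc (white_half_arc h) /\
  half_set h = closed_corner (white_half_arc h).1 (white_half_arc h).2.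
Proof.
move=> /(fk_white dom)[u hr]; split.
  by exists (hapex h), (hsrc h), u, (hdst h); split=> //; right.
by rewrite /closed_corner /oth /cor /= eqxx; case: h {hr} => [[? ?] ?].
Qed.

Lemma black_half_arcP h : h \in black_halves D ->
  rhombus_arc (black_half_arc h) /\
  half_set h = closed_corner (black_half_arc h).1 (black_half_arc h).2.
Proof.
move=> /(fk_black dom)[w hr]; split.
  by exists (hsrc h), (hapex h), (hdst h), w; split=> //; left.
rewrite /closed_corner /oth /cor /=; case: eqP => [e|_].
  case: hr => /= adj12 _ _ _.
  by case: (adj_irrefl planarG (u := hsrc h)); rewrite {2}e.
rewrite eq_sym; case: eqP => [e|_].
  case: hr => /= adj12 _ _ _.
  by case: (adj_irrefl planarG (u := hsrc h)); rewrite {2}e.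
by case: h {hr} => [[? ?] ?].
Qed.

(** Grouped in the order of [cells D], so that disjointness of cells transfers to arcs by index. *)
Definition cell_arcs (c : config D) : seq (seq (edge * edge)) :=
  [seq rhombus_arcs (c k) (@inner R D k) | k <- enum 'I_(ninner D)]
  ++ [seq [:: al] | al <- half_arcs D].

Lemma arcsE (c : config D) : arcs c = flatten (cell_arcs c).
Proof. by rewrite /cell_arcs flatten_cat flatten_seq1. Qed.

Lemma size_cell_arcs (c : config D) : size (cell_arcs c) = size (cells D).
Proof. by rewrite !(size_cat, size_map). Qed.

Lemma cell_arcsP (c : config D) i : (i < size (cells D))%N ->
  arcs_of_cell (nth set0 (cells D) i) (nth [::] (cell_arcs c) i).
Proof.
move=> ilt; move: (ilt); rewrite /cells /cell_arcs.
move: (enum 'I_(ninner D)) => en; rewrite !nth_cat !size_cat !size_map => jlt0.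
case: ifPn => [lt|].
  have k0 : 'I_(ninner D) by case: (en) lt => [|k0].
  rewrite !(nth_map k0) //; apply: rhombus_arcs_cell; exact: fk_inner dom _.
rewrite -leqNgt => ge; set j := (i - _)%N.
have jlt : (j < size (white_halves D ++ black_halves D))%N.
  by rewrite /j; lia.
have h0 : Defs.half R by case: (white_halves D ++ black_halves D) jlt => //.
have al0 : edge * edge by exact: ((0, 0), (0, 0)).
rewrite (nth_map h0) // (nth_map al0); last first.
  by rewrite /half_arcs size_cat !size_map -size_cat.
rewrite /half_arcs !nth_cat size_map; case: ifPn => [lt|].
  rewrite (nth_map h0) //.
  have [? ?] := white_half_arcP (mem_nth h0 lt); exact: half_arc_cell.
rewrite -leqNgt => ge'; rewrite (nth_map h0); last first.
  by move: jlt; rewrite size_cat; lia.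
have lt : (j - size (white_halves D) < size (black_halves D))%N.
  by move: jlt; rewrite size_cat; lia.
have [? ?] := black_half_arcP (mem_nth h0 lt); exact: half_arc_cell.
Qed.

Lemma arcs_cell (c : config D) al : al \in arcs c ->
  exists2 i, (i < size (cells D))%N & al \in nth [::] (cell_arcs c) i.
Proof.
rewrite arcsE => /flattenP[s /(nthP [::])[i + <-]]; rewrite size_cell_arcs => ilt hal.
by exists i.
Qed.

Lemma arcs_rhombus (c : config D) al : al \in arcs c -> rhombus_arc al.
Proof. by move=> /arcs_cell[i ilt]; have [h _ _ _] := cell_arcsP c ilt; apply: h. Qed.

Lemma arcs_corner (c : config D) al : al \in arcs c -> corner_pair al.1 al.2.
Proof. by move=> /arcs_rhombus/rhombus_arc_corner. Qed.

(** Open corners lie in the interiors of their cells, which are pairwise disjoint; within one cell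
    the tiling decides. *)
Lemma arcs_disjoint (c : config D) al be z : al \in arcs c -> be \in arcs c ->
  open_corner al.1 al.2 z -> open_corner be.1 be.2 z -> al = be.
Proof.
move=> ha hb za zb; have ca := arcs_corner ha; have cb := arcs_corner hb.
have [i ilt hi] := arcs_cell ha; have [j jlt hj] := arcs_cell hb.
have [_ si _ di] := cell_arcsP c ilt; have [_ sj _ _] := cell_arcsP c jlt.
have ij : i = j.
  apply: (fk_disjoint dom) => //; exists z; split.
    apply: open_corner_interior ca _ _ za => y hy; apply: (si _ hi).
    exact: open_corner_closed.
  apply: open_corner_interior cb _ _ zb => y hy; apply: (sj _ hj).
  exact: open_corner_closed.
by subst j; apply: di hi hj za zb.
Qed.

Lemma arcs_cells (c : config D) al : al \in arcs c -> forall z, closed_corner al.1 al.2 z ->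
  exists2 i, (i < size (cells D))%N & nth set0 (cells D) i z.
Proof.
move=> /arcs_cell[i ilt hi] z hz; exists i => //.
by have [_ si _ _] := cell_arcsP c ilt; apply: si hi _ hz.
Qed.

Lemma Omega_arcs (c : config D) z : Omega D z -> exists2 al, al \in arcs c & closed_corner al.1 al.2 z.
Proof.
move=> [[i ilt hz] _]; have [_ _ cov _] := cell_arcsP c ilt.
have [al hal alz] := cov _ hz; exists al => //; rewrite arcsE; apply/flattenP.
by exists (nth [::] (cell_arcs c) i) => //; rewrite mem_nth ?size_cell_arcs.
Qed.


Lemma arc_rel_rhombus (c : config D) e f : arc_rel c e f -> rhombus_arc (e, f) \/ rhombus_arc (f, e).
Proof. by move=> /orP[] /arcs_rhombus; [left|right]. Qed.

Lemma arc_relC (c : config D) e f : arc_rel c e f = arc_rel c f e.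
Proof. by rewrite /arc_rel orbC. Qed.

Lemma arc_rel_corner (c : config D) e f : arc_rel c e f -> corner_pair e f.
Proof. by move=> /arc_rel_rhombus[] /rhombus_arc_corner // /corner_pairC. Qed.

Lemma arc_rel_Lambda (c : config D) e f : arc_rel c e f -> Lambda_edge e.
Proof. by move=> /arc_rel_rhombus[] /rhombus_arc_edges[]. Qed.

Lemma arc_rel_mid (c : config D) e f e' : arc_rel c e f -> Lambda_edge e' ->
  closed_corner e f (mid e') -> e' = e \/ e' = f.
Proof.
move=> h L; have hc := arc_rel_corner h; case: (arc_rel_rhombus h).
  by move=> ha hz; apply: (mid_closed_corner_side ha L hz).
move=> ha; rewrite -(closed_cornerC hc) => hz.
by case: (mid_closed_corner_side ha L hz); auto.
Qed.

Lemma arc_rel_arc (c : config D) e f : arc_rel c e f -> exists2 al, al \in arcs c &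
  [/\ al = (e, f) \/ al = (f, e), open_corner al.1 al.2 = open_corner e f &
      closed_corner al.1 al.2 = closed_corner e f].
Proof.
move=> h; have hc := arc_rel_corner h.
case/orP: h => h; first by exists (e, f) => //; split=> //; left.
by exists (f, e) => //; rewrite /= (open_cornerC hc) (closed_cornerC hc); split=> //; right.
Qed.

Lemma arc_rel_disjoint (c : config D) e f e' f' z : arc_rel c e f -> arc_rel c e' f' ->
  open_corner e f z -> open_corner e' f' z -> (e = e' /\ f = f') \/ (e = f' /\ f = e').
Proof.
move=> /arc_rel_arc[al ha [E <- _]] /arc_rel_arc[be hb [E' <- _]] z1 z2.
have := arcs_disjoint ha hb z1 z2.
by case: E E' => -> [] -> [-> ->]; [left|right|right|left].
Qed.

Lemma mem_edgesP (c : config D) e : reflect (exists f, arc_rel c e f) (e \in edges D).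
Proof.
have sides al : al \in half_arcs D -> al \in arcs c by move=> h; rewrite /arcs mem_cat h orbT.
have inn k (al : edge * edge) : al \in rhombus_arcs (c k) (inner k) -> al \in arcs c.
  move=> h; rewrite /arcs mem_cat; apply/orP; left; apply/flattenP.
  exists (rhombus_arcs (c k) (inner k)) => //.
  by apply: (map_f (fun k => rhombus_arcs (c k) (inner k))); rewrite mem_enum.
apply: (iffP idP).
  rewrite /edges mem_cat => /orP[] /flattenP[s /mapP[x]].
    move=> _ -> he; have {he} : exists f, (e, f) \in rhombus_arcs (c x) (inner x) \/
        (f, e) \in rhombus_arcs (c x) (inner x).
      move: he; rewrite /rhombus_edges !inE; case: (c x) => /or4P[] /eqP ->.
      - by exists (ru2 (inner x), rw1 (inner x)); left; rewrite /= inE eqxx.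
      - by exists (ru2 (inner x), rw2 (inner x)); left; rewrite /= !inE eqxx orbT.
      - by exists (ru1 (inner x), rw1 (inner x)); right; rewrite /= inE eqxx.
      - by exists (ru1 (inner x), rw2 (inner x)); right; rewrite /= !inE eqxx orbT.
      - by exists (ru1 (inner x), rw2 (inner x)); left; rewrite /= inE eqxx.
      - by exists (ru1 (inner x), rw1 (inner x)); right; rewrite /= inE eqxx.
      - by exists (ru2 (inner x), rw2 (inner x)); left; rewrite /= !inE eqxx orbT.
      - by exists (ru2 (inner x), rw1 (inner x)); right; rewrite /= !inE eqxx orbT.
    by move=> [f [/inn h|/inn h]]; exists f; rewrite /arc_rel h ?orbT.
  move=> /sides h -> ; rewrite !inE => /orP[] /eqP ->.
    by exists x.2; rewrite /arc_rel -surjective_pairing h.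
  by exists x.1; rewrite /arc_rel -surjective_pairing h orbT.
move=> [f]; rewrite /edges mem_cat => h.
have {h} [al hal he] : exists2 al, al \in arcs c & e = al.1 \/ e = al.2.
  by case/orP: h => h; [exists (e, f)|exists (f, e)] => //; [left|right].
move: hal; rewrite /arcs mem_cat => /orP[/flattenP[s /mapP[k _ ->] hal]|hal]; apply/orP.
  left; apply/flattenP; exists (rhombus_edges (inner k)).
    by apply: (map_f (fun k => rhombus_edges (inner k))); rewrite mem_enum.
  move: hal; case: (c k); rewrite !inE => /orP[] /eqP E; move: he; rewrite E /= => -[] ->; rewrite !eqxx ?orbT //.
right; apply/flattenP; exists [:: al.1; al.2]; last first.
  by rewrite !inE; case: he => ->; rewrite eqxx ?orbT.
exact: (map_f (fun al : edge * edge => [:: al.1; al.2])).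
Qed.

Lemma not_segment_mid e e' : Lambda_edge e -> Lambda_edge e' -> e <> e' ->
  ~ segment e'.1 e'.2 (mid e) /\ ~ segment e'.2 e'.1 (mid e).
Proof.
case: e e' => u w [u' w'] L L' ne; split=> -[t /=]; rewrite in_itv /= => ht tE; apply: ne.
  exact: (mid_on_edge delta_gt0 planarG L L' ht).
apply: (mid_on_edge (t := 1 - t) delta_gt0 planarG L L'); first by lra.
by rewrite -tE; apply: complex_ext; rewrite !reimE; ring.
Qed.

Lemma half_arcs_arcs (c : config D) al : al \in half_arcs D -> arc_rel c al.1 al.2.
Proof. by move=> h; rewrite /arc_rel /arcs -surjective_pairing mem_cat h orbT. Qed.

Lemma halves_arc h : h \in white_halves D ++ black_halves D -> exists2 al, al \in half_arcs D &
  [/\ cor al.1 al.2 = hapex h, oth al.1 al.2 = hsrc h & oth al.2 al.1 = hdst h].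
Proof.
rewrite mem_cat => /orP[hw|hb].
  exists (white_half_arc h); first by rewrite /half_arcs mem_cat map_f.
  by rewrite /cor /oth /= eqxx.
exists (black_half_arc h); first by rewrite /half_arcs mem_cat (map_f (@black_half_arc R)) ?orbT.
have [w [/= adj12 _ _ _]] := fk_black dom hb.
have ne : (hsrc h == hdst h) = false.
  by apply/eqP => e; apply: (adj_irrefl planarG (u := hsrc h)); rewrite {2}e.
by rewrite /cor /oth /= (eq_sym (hdst h)) ne.
Qed.

(* Points of a boundary diagonal are in the closed but not in the open corner. *)
Lemma diagonal_corner h z : h \in white_halves D ++ black_halves D ->
  segment (hsrc h) (hdst h) z -> exists al, [/\ al \in half_arcs D,
    closed_corner al.1 al.2 z, ~ open_corner al.1 al.2 z & forall e, (e = al.1 \/ e = al.2) -> z <> mid e].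
Proof.
move=> /halves_arc[al hal [cE o1 o2]] [t /=]; rewrite in_itv /= => /andP[t0 t1] zE.
have c : config D := [ffun => true].
have hc := arc_rel_corner (half_arcs_arcs c hal).
exists al; split=> //.
- exists (1 - t), t; split; [lra|lra|lra|].
  by rewrite /hapex /hsrc /hdst /= cE o1 o2 -zE; apply: complex_ext; rewrite !reimE; ring.
- move=> [s' [t' [? ? st zE']]].
  have zE2 : z = cor al.1 al.2 + (1 - t)%:C%C * (oth al.1 al.2 - cor al.1 al.2) +
      t%:C%C * (oth al.2 al.1 - cor al.1 al.2).
    by rewrite cE o1 o2 -zE; apply: complex_ext; rewrite !reimE; ring.
  have [sE tE] := corner_coord hc zE'; have [sE2 tE2] := corner_coord hc zE2.
  by move: st; rewrite sE tE -sE2 -tE2; lra.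
- have zE2 : z = cor al.1 al.2 + (1 - t)%:C%C * (oth al.1 al.2 - cor al.1 al.2) +
      t%:C%C * (oth al.2 al.1 - cor al.1 al.2).
    by rewrite cE o1 o2 -zE; apply: complex_ext; rewrite !reimE; ring.
  have [sE2 tE2] := corner_coord hc zE2.
  move=> e he ze.
  have [s' [t' [st zE']]] : exists s' t' : R, s' + t' = 1 / 2 /\
      z = cor al.1 al.2 + s'%:C%C * (oth al.1 al.2 - cor al.1 al.2) +
      t'%:C%C * (oth al.2 al.1 - cor al.1 al.2).
    case: he => E; [exists (1 / 2), 0|exists 0, (1 / 2)]; (split; first lra); rewrite ze E.
      by rewrite (mid_corner hc) rmorph0 mul0r addr0.
    by rewrite (mid_corner (corner_pairC hc)) (corC hc) rmorph0 mul0r addr0.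
  have [sE tE] := corner_coord hc zE'.
  by move: st; rewrite sE tE -sE2 -tE2; lra.
Qed.

Lemma mid_Omega e : e \in edges D -> e <> edge_a D -> e <> edge_b D -> Omega D (mid e).
Proof.
move=> eD ea eb; pose c : config D := [ffun => true].
have [f ef] := mem_edgesP c e eD; have L := arc_rel_Lambda ef.
split.
  have [i ilt hi] : exists2 i, (i < size (cells D))%N & nth set0 (cells D) i (mid e).
    have hm := mid_closed_corner (arc_rel_corner ef).
    case/orP: (ef) => /arcs_cells; apply => //=.
    by rewrite (closed_cornerC (arc_rel_corner ef)).
  by exists i.
move=> [[[h hh hm]|ha]|hb].
- have [al [hal hz _ hne]] := diagonal_corner hh hm.
  by apply: (hne e) => //; apply: arc_rel_mid (half_arcs_arcs c hal) L hz.
- exact: (not_segment_mid L (fk_a dom : Lambda_edge (edge_a D)) ea).1.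
- exact: (not_segment_mid L (fk_b dom : Lambda_edge (edge_b D)) eb).2.
Qed.

(** The points of the domain close to the midpoint on the given side are covered by finitely many
    closed corners. A corner not containing the midpoint stays away from it, and a corner at [e] on
    the other side contains none of these points. *)
Lemma side_covered (c : config D) e (r : R) : Lambda_edge e -> r != 0 ->
  (exists2 q, 0 < q & forall eps, 0 < eps < q -> Omega D (mid e + (eps * r)%:C%C * edge_normal e)) ->
  exists2 f, arc_rel c e f & 0 < r * orient e f.
Proof.
move=> L r0 [q q0 hq]; apply: contrapT => H.
have [q' q0' hq'] : exists2 q', 0 < q' & forall eps, 0 < eps < q' ->
    forall al, al \in arcs c -> ~ closed_corner al.1 al.2 (mid e + (eps * r)%:C%C * edge_normal e).
  have each al : al \in arcs c -> exists2 q', 0 < q' & forall eps, 0 < eps < q' ->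
      ~ closed_corner al.1 al.2 (mid e + (eps * r)%:C%C * edge_normal e).
    move=> hal; have hc := arcs_corner hal.
    have [hm|hm] := pselect (closed_corner al.1 al.2 (mid e)); last first.
      have [p p0 hp] := far_closed_corner (r%:C%C * edge_normal e) hc hm.
      by exists p => // eps /hp; rewrite mulrA -rmorphM.
    have {hm} [f [hf cE]] : exists f, arc_rel c e f /\
        closed_corner al.1 al.2 = closed_corner e f.
      case: (mid_closed_corner_side (arcs_rhombus hal) L hm) => ->.
        by exists al.2; rewrite /arc_rel -surjective_pairing hal.
      exists al.1; rewrite /arc_rel -surjective_pairing hal orbT; split=> //.
      by rewrite -(closed_cornerC hc).
    exists 1 => // eps /andP[e0 _]; rewrite cE.
    have hcf := arc_rel_corner hf; have [k kE] := near_mid_coord r hcf.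
    move=> [s [t [s0 t0 st zE]]]; have [_ tE] := corner_coord hcf zE.
    have [_ tE'] := corner_coord hcf (kE eps).
    move: t0; rewrite tE -tE' pmulr_rge0 //.
    have [_ o0] := hcf.
    have -> : r * dot (e.2 - e.1) (e.2 - e.1) / orient e f =
       (r * orient e f) * (dot (e.2 - e.1) (e.2 - e.1) / orient e f ^+ 2).
      by field.
    rewrite pmulr_lge0; last first.
      apply: divr_gt0; last by rewrite exprn_even_gt0.
      by rewrite dot_gt0 subr_eq0 eq_sym Lambda_edge_neq.
    rewrite le_eqVlt eq_sym mulf_eq0 (negbTE r0) (negbTE o0) /= => ro.
    by apply: H; exists f.
  (* One radius for all arcs: the minimum of finitely many. *)
  elim: (arcs c) each => [|al s IH] each; first by exists 1.
  have [q1 q10 h1] := each al (mem_head _ _).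
  have [be hbe|q2 q20 h2] := IH; first by apply: each; rewrite inE hbe orbT.
  exists (Num.min q1 q2) => [|eps]; first by rewrite lt_min q10.
  rewrite lt_min => /and3P[e0 e1 e2] be; rewrite inE => /orP[/eqP->|hbe].
    by apply: h1; rewrite e0.
  by apply: h2 => //; rewrite e0.
pose eps := Num.min q q' / 2.
have m0 : 0 < Num.min q q' by rewrite lt_min q0.
have mq : Num.min q q' <= q by rewrite ge_min lexx.
have mq' : Num.min q q' <= q' by rewrite ge_min lexx orbT.
have e1 : 0 < eps < q by rewrite /eps; apply/andP; split; lra.
have e2 : 0 < eps < q' by rewrite /eps; apply/andP; split; lra.
have [al hal hz] := Omega_arcs c (hq _ e1).
exact: hq' e2 _ hal hz.
Qed.

(** An arc on the outer side would have an open corner containing points just outside. Such points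
    lie in a cell and off the boundary: the corner is disjoint from all boundary diagonals, and
    moving along the normal leaves the segments of [a] and [b]. They would thus belong to
    [Omega D]. *)
Lemma boundary_orient (c : config D) e f (r : R) : (e = edge_a D \/ e = edge_b D) ->
  arc_rel c e f ->
  (exists2 q, 0 < q & forall eps, 0 < eps < q -> ~ Omega D (mid e + (eps * r)%:C%C * edge_normal e)) ->
  ~ 0 < r * orient e f.
Proof.
move=> eab ef [q q0 hq] ro.
have hc := arc_rel_corner ef; have L := arc_rel_Lambda ef.
have ne := Lambda_edge_neq L.
have r0 : r != 0 by apply: contraTneq ro => ->; rewrite mul0r ltxx.
have [p p0 hp] := near_mid_open_corner hc ne ro.
have La : Lambda_edge (edge_a D) by exact: fk_a dom.
have Lb : Lambda_edge (edge_b D) by exact: fk_b dom.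
have perp (x y : C) (eps : R) : x <> y -> 0 < eps -> (x = e.1 /\ y = e.2 \/ x = e.2 /\ y = e.1) ->
    ~ segment x y (mid e + (eps * r)%:C%C * edge_normal e).
  move=> xy e0 E [t _ tE].
  have : dot (edge_normal e) (x + t%:C%C * (y - x)) = dot (edge_normal e) (mid e + (eps * r)%:C%C * edge_normal e) by rewrite tE.
  have -> : dot (edge_normal e) (mid e + (eps * r)%:C%C * edge_normal e) =
      dot (edge_normal e) e.1 + eps * r * dot (e.2 - e.1) (e.2 - e.1).
    by rewrite /mid /edge_normal /dot !reimE; field.
  have -> : dot (edge_normal e) (x + t%:C%C * (y - x)) = dot (edge_normal e) e.1.
    by case: E => -[-> ->]; rewrite /edge_normal /dot !reimE; ring.
  move=> /eqP; rewrite -subr_eq0 opprD addrA subrr sub0r oppr_eq0 !mulf_eq0 (gt_eqF e0) (negbTE r0) /=.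
  by rewrite gt_eqF // dot_gt0 subr_eq0 eq_sym.
have segfar e' x y : Lambda_edge e' -> (x = e'.1 /\ y = e'.2 \/ x = e'.2 /\ y = e'.1) ->
    exists2 q', 0 < q' & forall eps, 0 < eps < q' -> ~ segment x y (mid e + (eps * r)%:C%C * edge_normal e).
  move=> L' E; have ne' := Lambda_edge_neq L'.
  have xy : x != y by case: E => -[-> ->] //; rewrite eq_sym.
  have [ee|ee] := pselect (e = e').
    exists 1 => // eps /andP[e0 _]; apply: perp => //; first exact/eqP.
    by rewrite ee.
  have mN : ~ segment x y (mid e).
    by case: E => -[-> ->]; [exact: (not_segment_mid L L' ee).1|exact: (not_segment_mid L L' ee).2].
  have [q' q0' h'] := far_segment (r%:C%C * edge_normal e) xy mN.
  by exists q' => // eps /h'; rewrite mulrA -rmorphM.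
have [qa qa0 ha] := segfar (edge_a D) (ab D) (aw D) La (or_introl (conj erefl erefl)).
have [qb qb0 hb] := segfar (edge_b D) (bw D) (bb D) Lb (or_intror (conj erefl erefl)).
pose M := Num.min (Num.min q p) (Num.min qa qb); pose eps := M / 2.
have M0 : 0 < M by rewrite !lt_min q0 p0 qa0 qb0.
have Mq : M <= q by rewrite !ge_min lexx.
have Mp : M <= p by rewrite !ge_min lexx !orbT.
have Ma : M <= qa by rewrite !ge_min lexx !orbT.
have Mb : M <= qb by rewrite !ge_min lexx !orbT.
have small s : M <= s -> 0 < eps < s by rewrite /eps => ?; apply/andP; split; lra.
have hz := hp _ (small _ Mp).
apply: (hq _ (small _ Mq)); split.
  have hzc := open_corner_closed hz.
  have [i ilt hi] : exists2 i, (i < size (cells D))%N & nth set0 (cells D) i (mid e + (eps * r)%:C%C * edge_normal e).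
    case/orP: (ef) => /arcs_cells; apply => //=.
    by rewrite (closed_cornerC hc).
  by exists i.
move=> [[[h hh hm]|hm]|hm].
- have [al [hal hzc hzo _]] := diagonal_corner hh hm.
  have [z' z1 z2] := open_closed_corner_meet hc hz hzc.
  have ha' := half_arcs_arcs c hal.
  have hc' := arc_rel_corner ha'.
  case: (arc_rel_disjoint ef ha' z1 z2) => -[eE fE]; apply: hzo; rewrite -eE -fE //.
  by rewrite open_cornerC.
- exact: ha (small _ Ma) hm.
- exact: hb (small _ Mb) hm.
Qed.

Lemma edge_a_neq_b : edge_a D <> edge_b D.
Proof. exact: fk_ab dom. Qed.

Lemma half_rayE (p q : C) (eps : R) : p + ((1 / 2) +i* eps)%C * (q - p) =
  (1 / 2)%:C%C * (p + q) + eps%:C%C * ('i%C * (q - p)).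
Proof.
have -> : ((1 / 2) +i* eps)%C = (1 / 2)%:C%C + eps%:C%C * 'i%C :> C.
  by simpc.
by apply: complex_ext; rewrite !reimE; field.
Qed.

(** At an edge other than [a] and [b] the midpoint is interior to the open domain; at [a] the domain
    lies on the left of the edge from black to white, which is the side of the normal. *)
Lemma ahead_exists (c : config D) e : e \in edges D \/ e = edge_a D -> e <> edge_b D ->
  exists2 f, arc_rel c e f & 0 < orient e f.
Proof.
move=> eD eb.
have L : Lambda_edge e by case: eD => [/(mem_edgesP c)[f /arc_rel_Lambda //]|->]; exact: fk_a dom.
suff [q q0 hq] : exists2 q : R, 0 < q & forall eps, 0 < eps < q -> Omega D (mid e + (eps * 1)%:C%C * edge_normal e).
  have [|f hf o] := side_covered c L (oner_neq0 _); first by exists q.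
  by exists f; rewrite // -[orient _ _]mul1r.
have [ea|ea] := eqVneq e (edge_a D).
  have [/(_ (1 / 2))] := fk_ccw_a dom; have -> : 0 < (1 / 2 : R) < 1 by lra.
  move=> /(_ isT) /near_right_ex[q q0 hq] _; exists q => // eps /hq; by rewrite half_rayE ea mulr1.
case: eD => [eD|/eqP]; last by rewrite (negbTE ea).
have [q q0 hq] := open_set_ray (edge_normal e) (fk_open dom) (mid_Omega eD (elimN eqP ea) eb).
by exists q => // eps /hq; rewrite mulr1.
Qed.

Lemma behind_exists (c : config D) e : e \in edges D \/ e = edge_b D -> e <> edge_a D ->
  exists2 f, arc_rel c e f & orient e f < 0.
Proof.
move=> eD ea.
have L : Lambda_edge e by case: eD => [/(mem_edgesP c)[f /arc_rel_Lambda //]|->]; exact: fk_b dom.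
suff [q q0 hq] : exists2 q : R, 0 < q & forall eps, 0 < eps < q -> Omega D (mid e + (eps * -1)%:C%C * edge_normal e).
  have [||f hf o] := side_covered c (r := -1) L; first by rewrite oppr_eq0 oner_neq0.
    by exists q.
  by exists f; rewrite // -oppr_gt0 -mulN1r.
(* The boundary runs through [b] from white to black, so the domain lies opposite to the normal. *)
have [eb|eb] := eqVneq e (edge_b D).
  have [/(_ (1 / 2))] := fk_ccw_b dom; have -> : 0 < (1 / 2 : R) < 1 by lra.
  move=> /(_ isT) /near_right_ex[q q0 hq] _; exists q => // eps /hq; congr (Omega D _).
  by rewrite half_rayE eb mulrN1 /mid /edge_normal /= rmorphN; ring.
case: eD => [eD|/eqP]; last by rewrite (negbTE eb).
have [q q0 hq] := open_set_ray (- edge_normal e) (fk_open dom) (mid_Omega eD ea (elimN eqP eb)).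
by exists q => // eps /hq; congr (Omega D _); rewrite mulrN1 rmorphN mulNr mulrN.
Qed.

Lemma not_behind_a (c : config D) f : arc_rel c (edge_a D) f -> 0 < orient (edge_a D) f.
Proof.
move=> h; have [_ o0] := arc_rel_corner h.
rewrite lt_neqAle eq_sym o0 leNgt -oppr_gt0 -mulN1r.
apply/negP; apply: boundary_orient (or_introl erefl) h _.
have [_ /(_ (1 / 2))] := fk_ccw_a dom; have -> : 0 < (1 / 2 : R) < 1 by lra.
move=> /(_ isT) /near_right_ex[q q0 hq]; exists q => // eps /hq; congr (~ Omega D _).
by rewrite half_rayE mulrN1.
Qed.

Lemma not_ahead_b (c : config D) f : arc_rel c (edge_b D) f -> orient (edge_b D) f < 0.
Proof.
move=> h; have [_ o0] := arc_rel_corner h.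
rewrite lt_neqAle o0 leNgt -[orient _ _]mul1r.
apply/negP; apply: boundary_orient (or_intror erefl) h _.
have [_ /(_ (1 / 2))] := fk_ccw_b dom; have -> : 0 < (1 / 2 : R) < 1 by lra.
move=> /(_ isT) /near_right_ex[q q0 hq]; exists q => // eps /hq; congr (~ Omega D _).
by rewrite half_rayE mulr1 /mid /edge_normal /= rmorphN; ring.
Qed.

(** An arc followed in the direction that keeps black vertices on the left; this makes the
    undirected [arc_rel] deterministic both ways. *)
Definition step (c : config D) e f : bool := arc_rel c e f && (0 < orient e f).

(** Two corners on the same side of [e] share the points just beyond its midpoint, hence belong to
    the same arc. *)
Lemma step_inj_r (c : config D) e f f' : step c e f -> step c e f' -> f = f'.
Proof.
move=> /andP[h o] /andP[h' o'].
have hc := arc_rel_corner h; have hc' := arc_rel_corner h'.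
have ne := Lambda_edge_neq (arc_rel_Lambda h).
have [|q q0 hq] := near_mid_open_corner (r := 1) hc ne; first by rewrite mul1r.
have [|q' q0' hq'] := near_mid_open_corner (r := 1) hc' ne; first by rewrite mul1r.
pose M := Num.min q q'.
have M0 : 0 < M by rewrite lt_min q0.
have Mq : M <= q by rewrite ge_min lexx.
have Mq' : M <= q' by rewrite ge_min lexx orbT.
have [||[_ ->] //|[-> ->] //] := arc_rel_disjoint h h' (hq (M / 2) _) (hq' (M / 2) _).
- by apply/andP; split; lra.
- by apply/andP; split; lra.
Qed.

Lemma step_asym (c : config D) e f : step c e f -> ~~ step c f e.
Proof.
move=> /andP[h o]; rewrite /step (orientC (arc_rel_corner h)) oppr_gt0 negb_and -leNgt.
by rewrite (ltW o) orbT.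
Qed.

Lemma step_inj_l (c : config D) e e' f : step c e f -> step c e' f -> e = e'.
Proof.
move=> /andP[h o] /andP[h' o'].
have hc := corner_pairC (arc_rel_corner h); have hc' := corner_pairC (arc_rel_corner h').
have ne : f.1 != f.2 by move: h; rewrite arc_relC => /arc_rel_Lambda/Lambda_edge_neq.
rewrite -oppr_lt0 -(orientC (arc_rel_corner h)) in o.
rewrite -oppr_lt0 -(orientC (arc_rel_corner h')) in o'.
have [|q q0 hq] := near_mid_open_corner (r := -1) hc ne; first by rewrite mulN1r oppr_gt0.
have [|q' q0' hq'] := near_mid_open_corner (r := -1) hc' ne; first by rewrite mulN1r oppr_gt0.
pose M := Num.min q q'.
have M0 : 0 < M by rewrite lt_min q0.
have Mq : M <= q by rewrite ge_min lexx.
have Mq' : M <= q' by rewrite ge_min lexx orbT.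
rewrite arc_relC in h; rewrite arc_relC in h'.
have [||[_ ->] //|[-> ->] //] := arc_rel_disjoint h h' (hq (M / 2) _) (hq' (M / 2) _).
- by apply/andP; split; lra.
- by apply/andP; split; lra.
Qed.

End DomainArcs.

(** * Turning along an arc and around a loop *)

Section Turning.
Variables (R : realType) (delta : R) (G : plane_graph R) (D : fk_data R).
Hypothesis delta_gt0 : 0 < delta.
Hypothesis planarG : planar_embedded G.
Hypothesis dom : fk_domain delta G D.
Local Notation C := R[i].
Local Notation edge := (edge R).
Implicit Types (e f : edge) (c : config D).

Lemma step_turn c e f : step c e f -> exists2 rho : R, 0 < rho &
  [/\ - pi < turn e f < pi, edge_normal f = expi (turn e f) * edge_normal e &
    mid f - mid e = rho%:C%C * (edge_normal e * expi (turn e f / 2))].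
Proof.
move=> /andP[h o]; have hc := arc_rel_corner delta_gt0 planarG dom h.
have hcf := corner_pairC hc.
have Le := arc_rel_Lambda delta_gt0 planarG dom h.
have Lf : Lambda_edge delta G f by apply: (arc_rel_Lambda delta_gt0 planarG dom (c := c) (f := e)); rewrite arc_relC.
set a := oth e f - cor e f; set b := oth f e - cor e f.
have na : dot a a = delta ^+ 2.
  by rewrite -(Lambda_norm Le) /a /oth /cor; case: ifP => _; rewrite /dot !reimE; ring.
have nb : dot b b = delta ^+ 2.
  by rewrite -(Lambda_norm Lf) /b -(corC hc) /oth /cor; case: ifP => _; rewrite /dot !reimE; ring.
have D0 : 0 < delta ^+ 2 by rewrite exprn_gt0.
have a0 : a != 0 by rewrite -dot_gt0 na.
have b0 : b != 0 by rewrite -dot_gt0 nb.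
have ba0 : b / a != 0 by rewrite mulf_neq0 // invr_eq0.
have tE : turn e f = arg (b / a) by rewrite turnE.
set t := turn e f in tE *.
have ba : b = expi t * a.
  apply: (mulIf (_ : a^-1 != 0)); first by rewrite invr_eq0.
  rewrite mulfK // tE expi_argE //; rewrite normrM normfV !normE na nb divff ?divr1 //.
  by apply/eqP => -[/eqP]; rewrite sqrtr_eq0 leNgt D0.
have crossE : cross a b = delta ^+ 2 * sin t.
  by rewrite ba -na /cross /dot !reimE; ring.
have tb : - pi < t <= pi by rewrite tE arg_bounds.
have X0 := cross_corner_neq0 hc; rewrite -/a -/b crossE in X0.
have tpi : t < pi.
  rewrite lt_neqAle; case/andP: tb => _ ->; rewrite andbT.
  by apply: contra X0 => /eqP ->; rewrite sinpi mulr0.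
have {tb} tb : - pi < t < pi by case/andP: tb => -> _.
have chord : mid f - mid e = (sin (t / 2))%:C%C * ('i%C * a * expi (t / 2)).
  rewrite (mid_corner hc) (mid_corner hcf) (corC hc) -/a -/b.
  have := expi_chord 0 t; rewrite expi0 subr0 add0r => ch.
  have -> : cor e f + (1 / 2)%:C%C * b - (cor e f + (1 / 2)%:C%C * a) =
    (1 / 2)%:C%C * ((expi t - 1) * a) by rewrite ba; ring.
  rewrite ch rmorphM.
  have h2 : (1 / 2)%:C%C * 2%:C%C = 1 :> C by rewrite -rmorphM mul1r mulVf // pnatr_eq0.
  transitivity ((1 / 2)%:C%C * 2%:C%C * ((sin (t / 2))%:C%C * ('i%C * a * expi (t / 2)))); last by rewrite h2 mul1r.
  by ring.
have oE := orientE hc; rewrite -/a -/b crossE in oE.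
have nE : edge_normal e = (if e.1 == f.1 then 1 else -1) * ('i%C * a).
  by rewrite /edge_normal /a /oth /cor; case: ifP => _; ring.
have nF : edge_normal f = (if e.1 == f.1 then 1 else -1) * ('i%C * b).
  by rewrite /edge_normal /b -(corC hc) /oth /cor (eq_sym f.1); case: ifP => _; ring.
have normF : edge_normal f = expi t * edge_normal e by rewrite nE nF ba; ring.
have sin_sign (x : R) : 0 <= x < pi -> 0 <= sin x by move=> ?; apply: sin_ge0_pi; lra.
have p0 := pi_gt0 R.
rewrite oE in o.
move: o nE; case: ifP => _; rewrite ?mul1r ?mulN1r ?oppr_gt0 ?pmulr_rgt0 ?pmulr_rlt0 // => st nE.
  have t0 : 0 < t.
    rewrite ltNge; apply/negP => t0; have : 0 <= sin (- t) by apply: sin_sign; lra.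
    by rewrite sinN oppr_ge0 leNgt st.
  exists (sin (t / 2)); first by apply: sin_gt0_pi; lra.
  by split=> //; rewrite chord nE.
have t0 : t < 0.
  rewrite ltNge; apply/negP => t0; have : 0 <= sin t by apply: sin_sign; lra.
  by rewrite leNgt st.
exists (- sin (t / 2)).
  by rewrite -sinN; apply: sin_gt0_pi; lra.
by split=> //; rewrite chord nE rmorphN; ring.
Qed.

(** Hopf's theorem for the midpoint polygon: its exterior angles are averages of consecutive turns,
    and over a period these averages have the same sum as the turns. *)
Lemma loop_turning c (g : nat -> edge) n : (0 < n)%N ->
  (forall k, step c (g k) (g k.+1)) -> (forall k, g (k + n)%N = g k) ->
  (forall i j, g i = g j -> i = j %[mod n]) ->
  let s := \sum_(k < n) turn (g k) (g k.+1) in s = 2 * pi \/ s = - (2 * pi).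
Proof.
move=> n0 st per inj s.
have L k : Lambda_edge delta G (g k) by case/andP: (st k) => /(arc_rel_Lambda delta_gt0 planarG dom).
have ar k : arc_rel c (g k) (g k.+1) by case/andP: (st k).
have cp k : corner_pair (g k) (g k.+1) by exact: (arc_rel_corner delta_gt0 planarG dom (ar k)).
(* A cycle of length 1 or 2 would contain a step and its reverse. *)
have n3 : (2 < n)%N.
  case: n n0 per {inj s} => [|[|[|n]]] // _ per.
    have := step_asym delta_gt0 planarG dom (st 0%N); have := st 0%N.
    by have := per 0%N; rewrite add0n => -> ->.
  have := step_asym delta_gt0 planarG dom (st 0%N); have := st 1%N.
  by have := per 0%N; rewrite add0n => -> ->.
pose P k := mid (g k).
(* Without its ends, a chord lies in the open corner of its arc. Such corners are disjoint for
   distinct arcs and contain no midpoint of an edge; the midpoints themselves determine their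
   edges. *)
have sP : simple_polygon n P.
  split=> [k|i j x y hx hy E]; first by rewrite /P per.
  have endpt k k' (z : R) : 0 <= z < 1 -> P k = P k' + z%:C%C * (P k'.+1 - P k') -> k = k' %[mod n].
    move=> /andP[z0 z1] kE; move: z0; rewrite le_eqVlt => /orP[/eqP z0|z0].
      apply: inj; move: kE; rewrite -z0 rmorph0 mul0r addr0 /P.
      case: (g k) (g k') (L k) (L k') => [u w] [u' w'] L1 L2; exact: (mid_inj delta_gt0 planarG L1 L2).
    exfalso; have op : open_corner (g k') (g k'.+1) (mid (g k)).
      by rewrite -/(P k) kE; apply: chord_open_corner (cp k') _; rewrite z0.
    have := arc_rel_mid delta_gt0 planarG dom (ar k') (L k) (open_corner_closed op).
    case=> ek; rewrite ek in op; first exact: mid_open_corner (cp k') op.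
    rewrite -(open_cornerC (cp k')) in op.
    exact: mid_open_corner (corner_pairC (cp k')) op.
  have [x0|x0] := eqVneq x 0.
    by apply: (endpt i j y hy); rewrite -E x0 rmorph0 mul0r addr0.
  have [y0|y0] := eqVneq y 0.
    by apply/esym; apply: (endpt j i x hx); rewrite E y0 rmorph0 mul0r addr0.
  have xp : 0 < x < 1 by case/andP: hx => ? ->; rewrite lt_neqAle eq_sym x0 andbT.
  have yp : 0 < y < 1 by case/andP: hy => ? ->; rewrite lt_neqAle eq_sym y0 andbT.
  have z1 := chord_open_corner (cp i) xp.
  have z2 := chord_open_corner (cp j) yp.
  rewrite -E in z2.
  case: (arc_rel_disjoint delta_gt0 planarG dom (ar i) (ar j) z1 z2) => -[e1 e2]; first exact: inj.
  by have := step_asym delta_gt0 planarG dom (st i); rewrite e1 e2 st.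
pose t k := turn (g k) (g k.+1).
have turnP k : arg ((P k.+2 - P k.+1) / (P k.+1 - P k)) = (t k + t k.+1) / 2.
  have [r r0 [tb nE cE]] := step_turn (st k).
  have [r' r0' [tb' _ cE']] := step_turn (st k.+1).
  rewrite /P cE cE' nE -/(t k) -/(t k.+1) in tb tb' *.
  have ne : edge_normal (g k) != 0.
    apply: mulf_neq0; first by rewrite eq_complex /= oner_eq0 andbF.
    by rewrite subr_eq0 eq_sym (Lambda_edge_neq delta_gt0 (L k)).
  have -> : r'%:C%C * (expi (t k) * edge_normal (g k) * expi (t k.+1 / 2)) /
      (r%:C%C * (edge_normal (g k) * expi (t k / 2))) = (r' / r)%:C%C * expi ((t k + t k.+1) / 2).
    have -> : (t k + t k.+1) / 2 = t k + t k.+1 / 2 - t k / 2 by field.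
    have rn : r%:C%C != 0 :> C by apply/eqP => -[/eqP]; rewrite gt_eqF.
    rewrite expiB expiD rmorphM fmorphV /=; field.
    by rewrite rn ne expi_neq0.
  by rewrite argE ?divr_gt0 //; lra.
have := turning_sum n3 sP; rewrite /=.
under eq_bigr do rewrite turnP.
suff -> : \sum_(k < n) (t k + t k.+1) / 2 = s by [].
rewrite -mulr_suml big_split /=.
have -> : \sum_(k < n) t k.+1 = \sum_(k < n) t k.
  have := per 0%N; have := per 1%N; rewrite add0n add1n.
  case: n {n0 n3 per inj s sP} => [|n] h1 h0; first by rewrite !big_ord0.
  by rewrite big_ord_recr big_ord_recl /= addrC /t h1 h0.
by rewrite -/s /t; field.
Qed.

End Turning.

Lemma n_comp_set (T : finType) (e : rel T) (P : pred T) :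
  n_comp e [pred x | P x] = #|[set x | (fingraph.root e x == x) && P x]|.
Proof. by apply: eq_card => x; rewrite !inE. Qed.

(** * Cycles under multiplication by a transposition *)

Section Permutations.
Variable T : finType.
Implicit Types (s : {perm T}) (x y a : T).

Lemma iter_avoid s x y a : (forall k, iter k (tperm x y * s)%g a \notin pred2 x y) ->
  forall k, iter k s a = iter k (tperm x y * s)%g a.
Proof.
move=> av; elim=> // k IH; rewrite !iterS IH permM.
by have := av k; rewrite !inE negb_or => /andP[h1 h2]; rewrite tpermD // eq_sym.
Qed.

Lemma mem_porbit_iter s x k : iter k s x \in porbit s x.
Proof. by rewrite -permX mem_porbit. Qed.

Lemma porbit_iter s x y : y \in porbit s x -> exists2 k, (k < #|porbit s x|)%N & y = iter k s x.
Proof. by rewrite porbit_traject => /trajectP[k kn ->]; exists k. Qed.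

(** Along an orbit that avoids [x] and [y] the two permutations agree. *)
Lemma porbit_avoid s x y a : x \notin porbit (tperm x y * s)%g a ->
  y \notin porbit (tperm x y * s)%g a ->
  x \notin porbit s a /\ y \notin porbit s a.
Proof.
move=> nx ny.
have av k : iter k (tperm x y * s)%g a \notin pred2 x y.
  rewrite !inE negb_or; apply/andP; split; apply/eqP => e.
    by have := mem_porbit_iter (tperm x y * s)%g a k; rewrite e (negbTE nx).
  by have := mem_porbit_iter (tperm x y * s)%g a k; rewrite e (negbTE ny).
have sub z : z \in porbit s a -> z \in porbit (tperm x y * s)%g a.
  by move=> /porbit_iter[k _ ->]; rewrite (iter_avoid av) mem_porbit_iter.
by split; [apply: contra nx|apply: contra ny]; apply: sub.
Qed.

Lemma sub_path_belast (r r' : rel T) x p :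
  (forall y z, y \in belast x p -> r y z -> r' y z) -> path r x p -> path r' x p.
Proof.
elim: p x => //= y p IH x sub /andP[xy py]; rewrite (sub x) ?inE ?eqxx //=.
by apply: IH py => u v hu; apply: sub; rewrite inE hu orbT.
Qed.

End Permutations.

(** * The interface and the loops as cycles of a permutation *)

Section Interface.
Variables (R : realType) (delta : R) (G : plane_graph R) (D : fk_data R).
Hypothesis delta_gt0 : 0 < delta.
Hypothesis planarG : planar_embedded G.
Hypothesis dom : fk_domain delta G D.
Local Notation C := R[i].
Local Notation edge := (edge R).
Implicit Types (e f : edge) (c : config D).

(** An arbitrary choice: membership in [edges D] does not depend on the configuration. *)
Let c0 : config D := [ffun => true].

Lemma a_in_edges : edge_a D \in edges D.
Proof.
apply/(mem_edgesP c0).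
have [f hf _] := ahead_exists delta_gt0 planarG dom c0 (or_intror erefl) (edge_a_neq_b dom).
by exists f.
Qed.

Lemma b_in_edges : edge_b D \in edges D.
Proof.
apply/(mem_edgesP c0).
have [f hf _] := behind_exists delta_gt0 planarG dom c0 (or_intror erefl) (nesym (edge_a_neq_b dom)).
by exists f.
Qed.

Local Notation E := (seq_sub (edges D)).
Definition sub_a : E := SeqSub a_in_edges.
Definition sub_b : E := SeqSub b_in_edges.

Lemma step_edges c e f : step c e f -> e \in edges D /\ f \in edges D.
Proof.
move=> /andP[h _]; split; apply/(mem_edgesP c); first by exists f.
by exists e; rewrite arc_relC.
Qed.

Lemma step_neq_b c f : ~~ step c (edge_b D) f.
Proof.
apply/negP => /andP[h o]; have := not_ahead_b delta_gt0 planarG dom h.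
by rewrite ltNge ltW.
Qed.

Lemma step_neq_a c e : ~~ step c e (edge_a D).
Proof.
apply/negP => /andP[h o]; have hc := arc_rel_corner delta_gt0 planarG dom h.
rewrite arc_relC in h; have := not_behind_a delta_gt0 planarG dom h.
by rewrite (orientC hc) oppr_gt0 ltNge ltW.
Qed.

(** The default value is reached exactly at [sub_b], which has no outgoing step, and supplies the
    closing link. *)
Definition succ c (x : E) : E := odflt sub_a [pick y : E | step c (ssval x) (ssval y)].

Lemma succ_step c x : x != sub_b -> step c (ssval x) (ssval (succ c x)).
Proof.
move=> xb; rewrite /succ; case: pickP => //= no.
have [||f hf o] := @ahead_exists _ _ _ _ delta_gt0 planarG dom c (ssval x).
- by left; exact: ssvalP.
- by move=> e; move/eqP: xb; apply; apply: val_inj.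
have st : step c (ssval x) f by rewrite /step hf.
by have := no (SeqSub (step_edges st).2); rewrite /= st.
Qed.

Lemma succ_b c : succ c sub_b = sub_a.
Proof.
by rewrite /succ; case: pickP => //= y; rewrite (negbTE (step_neq_b _ _)).
Qed.

Lemma step_succ c (x y : E) : step c (ssval x) (ssval y) -> y = succ c x.
Proof.
move=> h; apply: val_inj; apply: (step_inj_r delta_gt0 planarG dom h); apply: succ_step.
by apply: contraTneq h => ->; exact: step_neq_b.
Qed.

Lemma succ_inj c : injective (succ c).
Proof.
move=> x y; have [->|xb] := eqVneq x sub_b; have [->|yb] := eqVneq y sub_b => //.
- rewrite succ_b => h; have := succ_step c yb; rewrite -h.
  by rewrite (negbTE (step_neq_a _ _)).
- rewrite succ_b => h; have := succ_step c xb; rewrite h.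
  by rewrite (negbTE (step_neq_a _ _)).
- move=> h; apply: val_inj; apply: (step_inj_l delta_gt0 planarG dom (succ_step c xb)).
  by rewrite h; exact: succ_step.
Qed.

(* Closing up the interface from [b] to [a] turns the configuration into a permutation. *)
Definition sigma c : {perm E} := perm (@succ_inj c).

Lemma sigma_step c x : x != sub_b -> step c (ssval x) (ssval (sigma c x)).
Proof. by rewrite permE; exact: succ_step. Qed.

Lemma sigma_b c : sigma c sub_b = sub_a.
Proof. by rewrite permE succ_b. Qed.

Lemma step_sigma c (x y : E) : step c (ssval x) (ssval y) -> sigma c x = y.
Proof. by move=> h; rewrite permE -(step_succ h). Qed.

(** [interface] picks some undirected simple path. It must follow [step]: nothing enters [a], and
    going against a step later would revisit the edge just left. Directed paths ending at [b] are
    then unique. *)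
Lemma interface_unique c g : path (step c) (edge_a D) g -> uniq (edge_a D :: g) ->
  last (edge_a D) g = edge_b D -> interface c = edge_a D :: g.
Proof.
have sub : subrel (step c) (arc_rel c) by move=> e f /andP[].
move=> pg ug lg; rewrite /interface; congr cons.
have xg : [set g : seq edge | [&& path (arc_rel c) (edge_a D) g, uniq (edge_a D :: g) &
   last (edge_a D) g == edge_b D]]%classic g.
  by apply/and3P; split; [exact: sub_path pg|exact: ug|apply/eqP].
(* The induction carries the invariant that no predecessor of the current edge lies ahead on the
   path. *)
have directed p : forall x, (forall y, step c y x -> y \notin p) -> uniq (x :: p) ->
    path (arc_rel c) x p -> path (step c) x p.
  elim: p => //= y p IH x px /and3P[]; rewrite inE negb_or => /andP[xy xp] yp up /andP[axy py].
  have sxy : step c x y.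
    rewrite /step axy /=; have hc := arc_rel_corner delta_gt0 planarG dom axy.
    have [_ o0] := hc; rewrite lt_neqAle eq_sym o0 leNgt; apply/negP => o.
    have : step c y x by rewrite /step arc_relC axy (orientC hc) oppr_gt0.
    by move=> /px; rewrite inE eqxx.
  rewrite sxy /=; apply: IH => //=; last by rewrite yp.
  by move=> z /(step_inj_l delta_gt0 planarG dom sxy) <-.
(* Since [b] has no outgoing step, neither path is a proper prefix of the other. *)
have det p : forall q x, path (step c) x p -> path (step c) x q ->
    last x p = edge_b D -> last x q = edge_b D -> p = q.
  elim: p => [|y p IH] [|z q] x //=.
  - by move=> _ /andP[+ _] xb; rewrite xb (negbTE (step_neq_b _ _)).
  - by move=> /andP[+ _] _ _ xb; rewrite xb (negbTE (step_neq_b _ _)).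
  - move=> /andP[xy py] /andP[xz qz] lp lq.
    have yz := step_inj_r delta_gt0 planarG dom xy xz; subst z.
    by rewrite (IH q y).
case: xgetP => [g' _|/(_ g)//] /and3P[pg' ug' /eqP lg'].
apply: (det g' g (edge_a D)) => //; apply: directed => // y.
by rewrite (negbTE (step_neq_a _ _)).
Qed.

Definition orbit_a c : seq E := traject (sigma c) sub_a #|porbit (sigma c) sub_a|.

Lemma orbit_aP c x : (x \in orbit_a c) = (x \in porbit (sigma c) sub_a).
Proof. by rewrite porbit_traject. Qed.

Lemma orbit_a_cons c : exists p, [/\ orbit_a c = sub_a :: p, last sub_a p = sub_b,
  path (frel (sigma c)) sub_a p & uniq (sub_a :: p)].
Proof.
have := uniq_traject_porbit (sigma c) sub_a; rewrite -/(orbit_a c).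
have := iter_porbit (sigma c) sub_a; rewrite /orbit_a.
case n : #|porbit (sigma c) sub_a| => [|m].
  by have := card_porbit_neq0 (sigma c) sub_a; rewrite n.
rewrite iterS => it; rewrite trajectS => u; exists (traject (sigma c) (sigma c sub_a) m).
split=> //; last exact: fpath_traject.
rewrite last_traject; apply: (@perm_inj _ (sigma c)).
by rewrite it sigma_b.
Qed.

Lemma interface_path c : exists p, [/\ orbit_a c = sub_a :: p,
  path (step c) (edge_a D) (map (@ssval _ _) p), uniq (edge_a D :: map (@ssval _ _) p) &
  last (edge_a D) (map (@ssval _ _) p) = edge_b D].
Proof.
have [p [oE lp pp up]] := orbit_a_cons c; exists p; split=> //.
- have : path (fun x y => step c (ssval x) (ssval y)) sub_a p.
    have ub : sub_b \notin belast sub_a p.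
      by move: up; rewrite lastI rcons_uniq lp => /andP[].
    apply: sub_path_belast pp => y z hy /eqP <-; apply: sigma_step.
    by apply: contra ub => /eqP <-.
  by rewrite -[edge_a D]/(ssval sub_a) path_map.
- by have := up; rewrite -(map_inj_uniq val_inj).
- by rewrite (last_map (@ssval _ _) p sub_a) lp.
Qed.

Lemma interfaceE c : interface c = map (@ssval _ _) (orbit_a c).
Proof. by have [p [-> pp up lp]] := interface_path c; apply: interface_unique. Qed.

Lemma mem_interface c (x : E) : (ssval x \in interface c) = (x \in porbit (sigma c) sub_a).
Proof. by rewrite interfaceE mem_map ?orbit_aP //; exact: val_inj. Qed.

Let arcE c : rel E := [rel e f : E | arc_rel c (ssval e) (ssval f)].

Lemma arcE_sym c : symmetric (arcE c).
Proof. by move=> x y; rewrite /arcE /= arc_relC. Qed.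

Lemma arcE_sigma c x y : arcE c x y -> y = sigma c x \/ x = sigma c y.
Proof.
rewrite /arcE /= => h; have hc := arc_rel_corner delta_gt0 planarG dom h; have [_ o0] := hc.
have [gt0|le0] := ltP 0 (orient (ssval x) (ssval y)).
  by left; rewrite (@step_sigma c x y) // /step h.
right; rewrite (@step_sigma c y x) // /step arc_relC h (orientC hc) oppr_gt0 /=.
by rewrite lt_neqAle o0.
Qed.

Lemma connect_porbit c x y : connect (arcE c) x y -> y \in porbit (sigma c) x.
Proof.
move=> /connectP[p]; elim: p x => [|z p IH] x /=; first by move=> _ ->; exact: porbit_id.
move=> /andP[xz pz] ly; have := IH z pz ly.
suff -> : porbit (sigma c) z = porbit (sigma c) x by [].
by case: (arcE_sigma xz) => ->; rewrite -[sigma c _]/(iter 1 (sigma c) _) -permX porbit_perm.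
Qed.

(** Off the cycle of [sub_a] the artificial link from [sub_b] is never followed, so every move of
    [sigma] is an arc. *)
Lemma porbit_connect c x y : x \notin porbit (sigma c) sub_a ->
  y \in porbit (sigma c) x -> connect (arcE c) x y.
Proof.
move=> xa /porbit_iter[k _ ->]; elim: k => [|k IH]; first exact: connect0.
apply: connect_trans IH _; apply: connect1; rewrite iterS /arcE /=.
have nb : iter k (sigma c) x != sub_b.
  apply: contra xa => /eqP e; rewrite porbit_sym -(sigma_b c) -e -iterS.
  exact: mem_porbit_iter.
by have /andP[] := sigma_step c nb.
Qed.

(** Off the interface, the components of the graph of arcs are the cycles of [sigma]; the additional
    cycle is the closed-up interface. *)
Lemma nloops_porbits c : (nloops c).+1 = #|porbits (sigma c)|.
Proof.
have sym : connect_sym (arcE c) by exact: sym_connect_sym (arcE_sym c).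
pose A : {set E} := [set x : E | (fingraph.root (arcE c) x == x) && (x \notin porbit (sigma c) sub_a)].
have -> : nloops c = #|A|.
  rewrite /nloops n_comp_set; congr #|pred_of_set _|.
  by apply/setP => x; rewrite !inE -mem_interface inE.
rewrite (cardsD1 (porbit (sigma c) sub_a)) imset_f // add1n; congr S.
have inA : {in A &, injective (porbit (sigma c))}.
  move=> x y; rewrite !inE => /andP[/eqP rx xa] /andP[/eqP ry ya] e.
  rewrite -rx -ry; apply/eqP; rewrite root_connect //; apply: porbit_connect xa _.
  by rewrite e porbit_id.
rewrite -(card_in_imset inA); apply: eq_card => S; rewrite !inE.
apply/imsetP/andP => [[x]|[Sa /imsetP[x _ SE]]].
  rewrite !inE => /andP[rx xa] ->; split; last exact: imset_f.
  by rewrite eq_porbit_mem.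
have xa : x \notin porbit (sigma c) sub_a by move: Sa; rewrite SE eq_porbit_mem.
have cr := connect_root (arcE c) x.
have rE : porbit (sigma c) (fingraph.root (arcE c) x) = porbit (sigma c) x.
  by apply/eqP; rewrite eq_porbit_mem; exact: connect_porbit cr.
exists (fingraph.root (arcE c) x); last by rewrite rE SE.
by rewrite !inE root_root // eqxx /= -eq_porbit_mem rE eq_porbit_mem.
Qed.

End Interface.

(** * Total turning along a list of edges *)

Section PathTurn.
Variable R : realType.
Local Notation edge := (edge R).
Implicit Types (x y : edge) (p q : seq edge).

Fixpoint path_turn x p : R := if p is y :: p' then turn x y + path_turn y p' else 0.

Lemma path_turn_cat x p q : path_turn x (p ++ q) = path_turn x p + path_turn (last x p) q.
Proof. by elim: p x => [|y p IH] x /=; rewrite ?add0r // IH addrA. Qed.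

Lemma path_turnE d x p q : path_turn x p =
  \sum_(0 <= k < size p) turn (nth d (x :: p ++ q) k) (nth d (x :: p ++ q) k.+1).
Proof.
elim: p x => [|y p IH] x /=; first by rewrite big_geq.
by rewrite big_nat_recl // IH.
Qed.

Lemma path_turn_traject (T : Type) (v : T -> edge) (s : T -> T) (x : T) n :
  path_turn (v x) (map v (traject s (s x) n)) =
  \sum_(k < n) turn (v (iter k s x)) (v (iter k.+1 s x)).
Proof.
elim: n x => [|n IH] x /=; first by rewrite big_ord0.
rewrite IH big_ord_recl /=; congr (_ + _); apply: eq_bigr => k _.
by rewrite -!iterS !iterSr.
Qed.

End PathTurn.

(** * The effect of a flip on the interface and its phases *)

Section Flip.
Variables (R : realType) (delta : R) (G : plane_graph R) (D : fk_data R).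
Hypothesis delta_gt0 : 0 < delta.
Hypothesis planarG : planar_embedded G.
Hypothesis dom : fk_domain delta G D.
Local Notation C := R[i].
Local Notation edge := (edge R).
Local Notation E := (seq_sub (edges D)).
Implicit Types (e f : edge) (c : config D).

Local Notation sigma := (sigma delta_gt0 planarG dom).
Local Notation sub_a := (sub_a delta_gt0 planarG dom).
Local Notation sub_b := (sub_b delta_gt0 planarG dom).

Lemma wind_from_aE c p q : interface c = edge_a D :: p ++ q ->
  uniq (edge_a D :: p ++ q) ->
  wind_from_a c (last (edge_a D) p) = path_turn (edge_a D) p.
Proof.
move=> iE u; rewrite /wind_from_a iE.
have -> : index (last (edge_a D) p) (edge_a D :: p ++ q) = size p.
  rewrite -cat_cons index_cat mem_last index_last //.
  by move: u; rewrite -cat_cons cat_uniq => /andP[].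
by rewrite (path_turnE (edge_a D) _ p q).
Qed.

Definition phase c e : C :=
  if e \in interface c then expi (- (wind_from_b c e / 2)) else 0.

(** The winding from [b] back to [e] is minus the turning of the part [q] that remains after [e]. *)
Lemma phase_split c p q e : interface c = edge_a D :: p ++ q ->
  uniq (edge_a D :: p ++ q) -> last (edge_a D) (p ++ q) = edge_b D ->
  last (edge_a D) p = e -> phase c e = expi (path_turn e q / 2).
Proof.
move=> iE u lb le; rewrite /phase iE -cat_cons mem_cat -le mem_last /=.
congr (expi _); rewrite /wind_from_b (wind_from_aE iE u).
have := @wind_from_aE c (p ++ q) [::]; rewrite cats0 => /(_ iE u).
by rewrite lb => ->; rewrite path_turn_cat; lra.
Qed.

(* The loop through [e2] is inserted into the interface right after [e1]; its total
   turning is [2 * pi] modulo [4 * pi] by Hopf's theorem. *)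
Lemma flip_phases c c' e1 e2 x1 x2 (T T' eps : R) :
  (forall e f, e != e1 -> e != e2 -> step c e f -> step c' e f) ->
  step c e1 x1 -> step c e2 x2 -> step c' e1 x2 -> step c' e2 x1 ->
  turn e1 x1 = T -> turn e2 x2 = T -> turn e1 x2 = T' -> turn e2 x1 = T' ->
  eps = 1 \/ eps = -1 -> T' = T + eps * pi ->
  e1 \in interface c -> e2 \notin interface c ->
  exists t0 : R,
    [/\ phase c e1 = expi t0, phase c x1 = expi (t0 - T / 2),
        phase c e2 = 0 & phase c x2 = 0] /\
    [/\ phase c' e1 = expi t0, phase c' x1 = expi (t0 - T / 2),
        phase c' e2 = expi t0 * (eps%:C%C * 'i%C) & phase c' x2 = expi (t0 - T' / 2)].
Proof.
move=> same s11 s22 s12 s21 t11 t22 t12 t21 epsE TE i1 i2.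
have [m1 mx1] := step_edges s11; have [m2 mx2] := step_edges s22.
pose y1 : E := SeqSub m1; pose y2 : E := SeqSub m2.
set s := sigma c.
have sy1 : ssval (s y1) = x1 by rewrite (@step_sigma _ _ _ _ delta_gt0 planarG dom c y1 (SeqSub mx1)).
have sy2 : ssval (s y2) = x2 by rewrite (@step_sigma _ _ _ _ delta_gt0 planarG dom c y2 (SeqSub mx2)).
have y1a : y1 \in porbit s sub_a by rewrite -mem_interface.
have y2a : y2 \notin porbit s sub_a by rewrite -mem_interface.
have y1b : y1 != sub_b.
  by apply: contraTneq s11 => /(congr1 (@ssval _ _)) /= ->; exact: (step_neq_b delta_gt0 planarG dom).
have [p [oE lp pp up]] := orbit_a_cons delta_gt0 planarG dom c.
have orb z : (z \in sub_a :: p) = (z \in porbit s sub_a) by rewrite -oE orbit_aP.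
have := y1a; rewrite -orb => /splitPl spl.
case: spl oE lp pp up orb => p1 p2 l1 oE lp pp up orb.
have [p3 p2E] : exists p3, p2 = s y1 :: p3.
  case: p2 oE lp pp up orb => [|z p3] oE lp pp up orb.
    by move: lp; rewrite cats0 l1 => e; rewrite e eqxx in y1b.
  by exists p3; move: pp; rewrite cat_path l1 /= => /and3P[_ /eqP -> _].
subst p2.
have [m nE] : exists m, #|porbit s y2| = m.+1.
  by case: #|porbit s y2| (card_porbit_neq0 s y2) => // m _; exists m.
pose l := traject s (s (s y2)) m.
have lastl : last (s y2) l = y2.
  by rewrite /l last_traject -iterSr -nE iter_porbit.
have porb2 : porbit s (s y2) = porbit s y2 by have := porbit_perm s 1 y2; rewrite expg1.
have lE : s y2 :: l = traject s (s y2) #|porbit s (s y2)| by rewrite porb2 nE.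
have ul : uniq (s y2 :: l) by rewrite lE uniq_traject_porbit.
have ml z : (z \in s y2 :: l) = (z \in porbit s y2) by rewrite lE -porbit_traject porb2.
have dis z : z \in porbit s y2 -> z \notin porbit s sub_a.
  by move=> h; apply: contra y2a => h'; rewrite -(eq_porbit_mem s) in h;
   rewrite -eq_porbit_mem -(eqP h) eq_porbit_mem.
pose r' := [rel x y : E | step c' (ssval x) (ssval y)].
have step' z : z != sub_b -> z != y1 -> z != y2 -> r' z (s z).
  move=> zb z1 z2; rewrite /r' /=; apply: same; last exact: (sigma_step c zb).
  - by apply: contra z1 => /eqP e; apply/eqP/val_inj.
  - by apply: contra z2 => /eqP e; apply/eqP/val_inj.
have sub_path' x q : fpath s x q -> sub_b \notin belast x q -> y1 \notin belast x q ->
    y2 \notin belast x q -> path r' x q.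
  move=> pq b0 b1 b2; apply: sub_path_belast pq => u v hu /eqP <-.
  by apply: step'; apply: contraTneq hu => ->.
have oa : sub_a :: p1 ++ s y1 :: p3 = rcons (belast sub_a p1) y1 ++ s y1 :: p3.
  by rewrite -l1 -lastI.
have ob : sub_a :: p1 ++ s y1 :: p3 = rcons (belast sub_a p1 ++ y1 :: belast (s y1) p3) sub_b.
  rewrite oa cat_rcons -cats1 -catA /=; congr (_ ++ _ :: _).
  rewrite cats1; have -> : sub_b = last (s y1) p3 by rewrite -lp last_cat.
  by rewrite -lastI.
have := up; rewrite ob rcons_uniq mem_cat inE !negb_or cat_uniq /= => /andP[/and3P[b1 b2 b3]].
case/and4P=> _ /norP[h1 h2] h3 _.
have inorb z : z \in belast sub_a p1 ++ y1 :: belast (s y1) p3 -> z \in porbit s sub_a.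
  by move=> h; rewrite -orb ob mem_rcons inE h orbT.
(* The new interface: up to [y1], once around the loop from [s y2] to [y2], then on from [s y1].
   Only the moves out of [y1] and [y2] have changed. *)
have pE' : path r' sub_a (p1 ++ (s y2 :: l) ++ s y1 :: p3).
  move: pp; rewrite cat_path => /andP[pp1]; rewrite l1 /= => /andP[_ pp3].
  rewrite cat_path l1 [path _ y1 _]/= cat_path lastl [path _ y2 _]/=; apply/and5P; split.
  - apply: sub_path' => //; apply: contra y2a => h.
    by apply: inorb; rewrite mem_cat h.
  - by rewrite /= sy2.
  - apply: sub_path'; first exact: fpath_traject.
    + apply/negP => /mem_belast; rewrite ml => /dis/negP; apply.
      by rewrite -orb ob mem_rcons inE eqxx.
    + by apply/negP => /mem_belast; rewrite ml => /dis/negP.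
    + by move: ul; rewrite lastI lastl rcons_uniq => /andP[].
  - by rewrite /= sy1.
  - apply: sub_path' => //; apply: contra y2a => h.
    by apply: inorb; rewrite mem_cat inE h !orbT.
have uE' : uniq (sub_a :: p1 ++ (s y2 :: l) ++ s y1 :: p3).
  have -> : uniq (sub_a :: p1 ++ (s y2 :: l) ++ s y1 :: p3) =
            uniq ((s y2 :: l) ++ (sub_a :: p1) ++ s y1 :: p3).
    by apply: perm_uniq; rewrite -cat_cons perm_catCA.
  rewrite cat_uniq cat_cons; apply/and3P; split=> //; apply/hasPn => z.
  by rewrite orb => za; apply/negP; rewrite ml => /dis/negP.
pose v := map (@ssval _ (edges D)).
have iE : interface c = edge_a D :: (v p1 ++ v (s y1 :: p3)).
  by rewrite (interfaceE delta_gt0 planarG dom) oE /= map_cat.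
have uE : uniq (edge_a D :: (v p1 ++ v (s y1 :: p3))).
  by rewrite /v -map_cat -[edge_a D]/(ssval sub_a) -map_cons map_inj_uniq //; exact: val_inj.
have lE1 : last (edge_a D) (v p1 ++ v (s y1 :: p3)) = edge_b D.
  by rewrite /v -map_cat -[edge_a D]/(ssval sub_a) last_map lp.
have iE' : interface c' = edge_a D :: (v p1 ++ (v (s y2 :: l) ++ v (s y1 :: p3))).
  rewrite /v -!map_cat; apply: (interface_unique delta_gt0 planarG dom).
  - by rewrite -[edge_a D]/(ssval sub_a) path_map.
  - by rewrite -[edge_a D]/(ssval sub_a) -map_cons map_inj_uniq //; exact: val_inj.
  - by rewrite -[edge_a D]/(ssval sub_a) last_map !last_cat /= -[edge_b D]/(ssval sub_b) -lp last_cat.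
have uE2 : uniq (edge_a D :: (v p1 ++ (v (s y2 :: l) ++ v (s y1 :: p3)))).
  by rewrite /v -!map_cat -[edge_a D]/(ssval sub_a) -map_cons map_inj_uniq //; exact: val_inj.
have lE2 : last (edge_a D) (v p1 ++ (v (s y2 :: l) ++ v (s y1 :: p3))) = edge_b D.
  by rewrite -lE1 /v !last_cat.
have lv1 : last (edge_a D) (v p1) = e1 by rewrite -[edge_a D]/(ssval sub_a) last_map l1.
have lvl : last x2 (v l) = e2 by rewrite -sy2 last_map lastl.
have vx1 : v (s y1 :: p3) = x1 :: v p3 by rewrite /= sy1.
have vx2 : v (s y2 :: l) = x2 :: v l by rewrite /= sy2.
rewrite vx1 in iE uE lE1; rewrite vx1 vx2 in iE' uE2 lE2.
have loop : path_turn x2 (v l) + T = 2 * pi \/ path_turn x2 (v l) + T = - (2 * pi).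
  have nb k : iter k s y2 != sub_b.
    apply: contraNneq (dis _ (mem_porbit_iter s y2 k)) => ->.
    by rewrite -orb ob mem_rcons inE eqxx.
  have per k : iter (k + m.+1) s y2 = iter k s y2 by rewrite iterD -nE iter_porbit.
  have perM k q : iter (k + q * m.+1) s y2 = iter k s y2.
    by elim: q => [|q IH]; rewrite ?addn0 // mulSn addnCA addnC per.
  have inj i j : ssval (iter i s y2) = ssval (iter j s y2) -> i = j %[mod m.+1].
    move=> /val_inj; rewrite {1}(divn_eq i m.+1) {1}(divn_eq j m.+1) ![(_ * _ + _)%N]addnC !perM.
    have := uniq_traject_porbit s y2; rewrite nE => u.
    have lt k : (k %% m.+1 < m.+1)%N by rewrite ltn_mod.
    rewrite -!(nth_traject s (lt _)) => /eqP.
    by rewrite nth_uniq ?size_traject // => /eqP.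
  have := @loop_turning _ _ _ _ delta_gt0 planarG dom c (fun k => ssval (iter k s y2)) m.+1 isT
    (fun k => sigma_step c (nb k)) (fun k => congr1 _ (per k)) inj.
  rewrite /= -(path_turn_traject (@ssval _ (edges D)) s y2) /= -/l -/(v l) sy2 t22.
  by rewrite addrC.
(* In [c] the interface turns by [T + B] from [e1] to [b], so this [t0] is its half-winding at
   [e1]. *)
pose B := path_turn x1 (v p3); exists ((T + B) / 2).
have x2N : x2 \notin interface c.
  by rewrite -sy2 (mem_interface delta_gt0 planarG dom) dis // -ml mem_head.
(* In each of the four sign cases the exponent is 0, [2 * pi] or [- (2 * pi)]; this is where the
   direction of the loop drops out. *)
have full : expi (eps * pi + (path_turn x2 (v l) + T) / 2) = 1 :> C.
  have e0 : expi 0 = 1 :> C by exact: expi0.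
  have e2p : expi (pi + pi) = 1 :> C by rewrite -(expi2pi R); congr expi; ring.
  case: epsE => ->; case: loop => ->.
  - by rewrite -e2p; congr expi; field.
  - by rewrite -e0; congr expi; field.
  - by rewrite -e0; congr expi; field.
  - by rewrite -[RHS]invr1 -e2p -expiN; congr expi; field.
split; split.
- by rewrite (phase_split iE uE lE1 lv1) /= t11.
- have h : v p1 ++ x1 :: v p3 = (v p1 ++ [:: x1]) ++ v p3 by rewrite -catA.
  rewrite h in iE uE lE1; rewrite (phase_split iE uE lE1) ?last_cat //.
  by congr expi; rewrite /B; field.
- by rewrite /phase (negbTE i2).
- by rewrite /phase (negbTE x2N).
- rewrite (phase_split iE' uE2 lE2 lv1) /= path_turn_cat /= lvl t12 t21 -/B.
  by rewrite -[RHS]mulr1 -full -expiD; congr expi; rewrite TE; field.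
- have h : v p1 ++ (x2 :: v l) ++ x1 :: v p3 = (v p1 ++ (x2 :: v l) ++ [:: x1]) ++ v p3.
    by rewrite -!catA.
  rewrite h in iE' uE2 lE2; rewrite (phase_split iE' uE2 lE2) ?last_cat //.
  by congr expi; rewrite /B; field.
- have h : v p1 ++ (x2 :: v l) ++ x1 :: v p3 = (v p1 ++ (x2 :: v l)) ++ x1 :: v p3.
    by rewrite -!catA.
  rewrite h in iE' uE2 lE2; rewrite (phase_split iE' uE2 lE2) ?last_cat //= t21 -/B.
  have -> : eps%:C%C * 'i%C = expi (eps * pi / 2) :> C.
    case: epsE => ->; first by rewrite mul1r expi_pihalf rmorph1 mul1r.
    rewrite mulN1r mulNr expiN expi_pihalf rmorphN rmorph1 mulN1r.
    have i0 : 'i%C != 0 :> C by rewrite eq_complex /= oner_eq0 andbF.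
    by apply: (mulfI i0); rewrite mulfV // mulrN -expr2 sqr_i opprK.
  by rewrite -expiD; congr expi; rewrite TE; field.
- have h : v p1 ++ (x2 :: v l) ++ x1 :: v p3 = (v p1 ++ [:: x2]) ++ (v l ++ x1 :: v p3).
    by rewrite -!catA.
  rewrite h in iE' uE2 lE2; rewrite (phase_split iE' uE2 lE2) ?last_cat //= path_turn_cat /= lvl t21 -/B.
  by rewrite -[RHS]mulr1 -full -expiD; congr expi; rewrite TE; field.
Qed.

(** A transposition of points in different cycles merges these cycles. *)
Lemma flip_nloops c c' (y1 y2 : E) : sigma c' = (tperm y1 y2 * sigma c)%g -> y1 != y2 ->
  y2 \notin porbit (sigma c) y1 -> nloops c = (nloops c').+1.
Proof.
move=> sE ne n12; have := porbits_mul_tperm (sigma c) y2 y1; rewrite /= tpermC -sE n12.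
rewrite eq_sym ne -!nloops_porbits /=; lia.
Qed.


(** * Arcs and turns inside one rhombus *)

Lemma arcs_off (k : 'I_(ninner D)) c c' al : (forall j, j != k -> c j = c' j) ->
  al \in arcs c -> al \in arcs c' \/ al \in rhombus_arcs (c k) (inner k).
Proof.
move=> cc; rewrite /arcs !mem_cat => /orP[/flattenP[s /mapP[j jD ->] hal]|->]; last by left; rewrite orbT.
have [jk|jk] := eqVneq j k; first by right; rewrite -jk.
left; apply/orP; left; apply/flattenP; exists (rhombus_arcs (c' j) (inner j)).
  exact: (map_f (fun j => rhombus_arcs (c' j) (inner j))).
by rewrite -cc.
Qed.

Lemma rhombus_arcs_rel (k : 'I_(ninner D)) c al : al \in rhombus_arcs (c k) (inner k) -> al \in arcs c.
Proof.
move=> h; rewrite /arcs mem_cat; apply/orP; left; apply/flattenP.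
exists (rhombus_arcs (c k) (inner k)) => //.
by apply: (map_f (fun k => rhombus_arcs (c k) (inner k))); rewrite mem_enum.
Qed.

(** [e1] and [e2] are the opposite sides through which the rhombus is entered. From [e1], the exit
    around its white end is [xw] and the one around its black end is [xb]; from [e2] they are
    exchanged. [phi] is the angle at the black vertices: with black on the left, the turn is [phi]
    around black and, clockwise, [pi - phi] around white. *)
Record rhombus_steps (k : 'I_(ninner D)) (e1 e2 xw xb : edge) (phi : R) : Prop := RhombusSteps {
  rs_phi : 0 < phi < pi;
  rs_theta : theta (inner k) = phi / 2;
  rs_white : forall c, c k ->
    [/\ step c e1 xw, step c e2 xb, turn e1 xw = phi - pi & turn e2 xb = phi - pi];
  rs_black : forall c, ~~ c k ->
    [/\ step c e1 xb, step c e2 xw, turn e1 xb = phi & turn e2 xw = phi];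
  rs_off : forall c c' e f, (forall j, j != k -> c j = c' j) -> e != e1 -> e != e2 ->
    step c e f -> step c' e f;
  rs_neq : e1 != e2;
  rs_opp : edge_normal e2 = - edge_normal e1 /\ edge_normal xb = - edge_normal xw;
  rs_edges : rhombus_edges (inner k) =i [:: e1; e2; xw; xb] }.

Lemma rhombus_steps_sym k e1 e2 xw xb phi :
  rhombus_steps k e1 e2 xw xb phi -> rhombus_steps k e2 e1 xb xw phi.
Proof.
move=> [h1 h2 h3 h4 h5 h6 [h7 h8] h9]; split=> //.
- by move=> c /h3[].
- by move=> c /h4[].
- by move=> c c' e f cc n2 n1; exact: h5.
- by rewrite eq_sym.
- by rewrite h7 h8 !opprK.
- by move=> e; rewrite h9 !inE orbCA; congr (_ || (_ || _)); rewrite orbC.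
Qed.

(** The sign of the cross product selects the labelling in which the sides joining equal indices are
    entered. The hypotheses on arcs and edges hold for [inner k] up to an exchange of its white
    vertices, which covers both orientations. *)
Lemma rhombus_steps_labelled k u1 w1 u2 w2 :
  is_rhombus delta G (Rhombus u1 w1 u2 w2) -> 0 < cross (w1 - u1) (w2 - u1) ->
  theta (inner k) = `|arg ((w2 - u1) / (w1 - u1))| / 2 \/ theta (inner k) = `|arg ((w1 - u1) / (w2 - u1))| / 2 ->
  (forall e f, (((e, f) \in rhombus_arcs true (inner k)) || ((f, e) \in rhombus_arcs true (inner k)))
     = ((e, f) \in [:: ((u1, w1), (u2, w1)); ((u2, w1), (u1, w1)); ((u2, w2), (u1, w2)); ((u1, w2), (u2, w2))])) ->
  (forall e f, (((e, f) \in rhombus_arcs false (inner k)) || ((f, e) \in rhombus_arcs false (inner k)))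
     = ((e, f) \in [:: ((u1, w1), (u1, w2)); ((u1, w2), (u1, w1)); ((u2, w2), (u2, w1)); ((u2, w1), (u2, w2))])) ->
  rhombus_edges (inner k) =i [:: (u1, w1); (u2, w2); (u2, w1); (u1, w2)] ->
  exists phi, rhombus_steps k (u1, w1) (u2, w2) (u2, w1) (u1, w2) phi.
Proof.
move=> hr X0 thE arT arF edE.
have [/= par nz] := rhombus_parallelogram planarG hr.
have u12 : (u1 == u2) = false.
  apply/eqP => e; case: hr => /= adj12 _ _ _.
  by apply: (adj_irrefl planarG (u := u1)); rewrite {2}e.
set a := w1 - u1 in X0 thE nz; set b := w2 - u1 in X0 thE nz.
have a0 : a != 0 by apply: contraNneq nz => ->; rewrite /cross !reimE; apply/eqP; ring.
have b0 : b != 0 by apply: contraNneq nz => ->; rewrite /cross !reimE; apply/eqP; ring.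
have [r [phi [r0 hphi zE]]] := polarP (mulf_neq0 b0 (invr_neq0 a0)).
have aphi : arg (b / a) = phi by rewrite zE argE.
have p0 := pi_gt0 R.
have sphi : 0 < sin phi.
  have bE : b = r%:C%C * expi phi * a by rewrite -zE divfK.
  move: X0; have -> : cross a b = r * sin phi * dot a a by rewrite bE /cross /dot !reimE; ring.
  by rewrite pmulr_lgt0 ?dot_gt0 // pmulr_rgt0.
have {} hphi : 0 < phi < pi.
  case/andP: hphi => h1 h2; apply/andP; split.
    rewrite ltNge; apply/negP => h; have : 0 <= sin (- phi) by apply: sin_ge0_pi; lra.
    by rewrite sinN oppr_ge0 leNgt sphi.
  by rewrite lt_neqAle h2 andbT; apply: contraTneq sphi => ->; rewrite sinpi ltxx.
have u2E : u2 = w1 + w2 - u1 by rewrite par; ring.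
have aN : arg (- (b / a)) = phi - pi.
  have -> : - (b / a) = r%:C%C * expi (phi - pi).
    by rewrite zE expiB expi_pi invrN1 mulrN1 mulrN.
  by rewrite argE //; lra.
exists phi.
have o1 : orient (u1, w1) (u2, w1) = cross a b.
  by rewrite /orient /oth /= eq_sym u12 u2E /a /b /cross !reimE; ring.
have o2 : orient (u2, w2) (u1, w2) = cross a b.
  by rewrite /orient /oth /= u12 u2E /a /b /cross !reimE; ring.
have o3 : orient (u1, w1) (u1, w2) = cross a b by rewrite /orient /oth /= eqxx.
have o4 : orient (u2, w2) (u2, w1) = cross a b.
  by rewrite /orient /oth /= eqxx u2E /a /b /cross !reimE; ring.
have relT c e f : c k -> ((e, f) \in rhombus_arcs true (inner k)) || ((f, e) \in rhombus_arcs true (inner k)) ->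
    arc_rel c e f.
  by move=> ck h; rewrite /arc_rel; apply/orP; case/orP: h => h; [left|right];
    apply: (@rhombus_arcs_rel k); rewrite ck.
have relF c e f : ~~ c k -> ((e, f) \in rhombus_arcs false (inner k)) || ((f, e) \in rhombus_arcs false (inner k)) ->
    arc_rel c e f.
  by move=> /negbTE ck h; rewrite /arc_rel; apply/orP; case/orP: h => h; [left|right];
    apply: (@rhombus_arcs_rel k); rewrite ck.
have white c : c k -> step c (u1, w1) (u2, w1) /\ step c (u2, w2) (u1, w2).
  by move=> ck; rewrite /step o1 o2 X0 !relT // arT !inE eqxx ?orbT.
have black c : ~~ c k -> step c (u1, w1) (u1, w2) /\ step c (u2, w2) (u2, w1).
  by move=> ck; rewrite /step o3 o4 X0 !relF // arF !inE eqxx ?orbT.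
split=> //.
- case: thE => ->; first by rewrite aphi gtr0_norm //; case/andP: hphi.
  have -> : a / b = r^-1%:C%C * expi (- phi).
    by rewrite -[a / b]invrK invfM invrK mulrC zE invfM expiN fmorphV.
  by rewrite argE ?invr_gt0 // ?normrN ?gtr0_norm; lra.
- move=> c /white[s1 s2]; split=> //; rewrite /turn /= ?u12 ?(eq_sym u2) ?u12.
    by rewrite -aN; congr arg; rewrite u2E -[u1 - w1]opprB -/a invrN mulrN; congr (- (_ / _)); rewrite /b; ring.
  rewrite -aN; congr arg; have -> : u2 - w2 = a by rewrite u2E /a; ring.
  by rewrite -mulNr; congr (_ / _); rewrite /b; ring.
- move=> c /black[s1 s2]; split=> //; rewrite /turn /= eqxx //.
  rewrite -aphi; congr arg; have -> : w2 - u2 = - a by rewrite u2E /a; ring.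
  by rewrite invrN mulrN -mulNr; congr (_ / _); rewrite u2E /b; ring.
(* A step along an arc of this rhombus starts at one of the two entering sides; every other arc is
   common to both configurations. *)
- move=> c c' e f cc n1 n2 /[dup] st /andP[h o]; rewrite /step o andbT.
  have cc' al := @arcs_off k c c' al cc.
  have {h} : arc_rel c' e f \/ ((e, f) \in rhombus_arcs (c k) (inner k)) || ((f, e) \in rhombus_arcs (c k) (inner k)).
    by case/orP: h => /cc' [h|h]; [left|right|left|right]; rewrite /arc_rel h ?orbT.
  case=> // h; exfalso; move: h.
  have asym x y : step c x y -> step c y x -> False.
    by move=> sxy; apply/negP; exact: (step_asym delta_gt0 planarG dom sxy).
  case ck : (c k).
    have [s1 s2] := white c ck.
    rewrite arT !inE => /or4P[] /eqP[e1E fE]; rewrite e1E fE in st n1 n2.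
    - by rewrite eqxx in n1.
    - exact: asym s1 st.
    - by rewrite eqxx in n2.
    - exact: asym s2 st.
  have [s1 s2] := black c (negbT ck).
  rewrite arF !inE => /or4P[] /eqP[e1E fE]; rewrite e1E fE in st n1 n2.
  - by rewrite eqxx in n1.
  - exact: asym s1 st.
  - by rewrite eqxx in n2.
  - exact: asym s2 st.
- by rewrite xpair_eqE u12.
- by rewrite /edge_normal /= u2E; split; ring.
Qed.

Lemma rhombus_stepsP k : exists e1 e2 xw xb phi, rhombus_steps k e1 e2 xw xb phi.
Proof.
have hr := fk_inner dom k.
have [par nz] := rhombus_parallelogram planarG hr.
case iE : (inner k) hr par nz => [u1 w1 u2 w2] hr /= par nz.
have rel4 (b : bool) e f : ((e, f) \in rhombus_arcs b (Rhombus u1 w1 u2 w2)) || ((f, e) \in rhombus_arcs b (Rhombus u1 w1 u2 w2)) =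
    ((e, f) \in if b then [:: ((u1, w1), (u2, w1)); ((u2, w1), (u1, w1)); ((u2, w2), (u1, w2)); ((u1, w2), (u2, w2))]
     else [:: ((u1, w1), (u1, w2)); ((u1, w2), (u1, w1)); ((u2, w2), (u2, w1)); ((u2, w1), (u2, w2))]).
  by case: b; rewrite !inE !xpair_eqE; do ! case: eqP => _ //=.
have [X0|X0] := ltP 0 (cross (w1 - u1) (w2 - u1)).
  have [|e f|e f|e|phi h] := @rhombus_steps_labelled k u1 w1 u2 w2 hr X0.
  - by left; rewrite iE.
  - by rewrite iE (rel4 true).
  - by rewrite iE (rel4 false).
  - by rewrite iE !inE; do ! case: eqP => _ //=.
  by exists (u1, w1), (u2, w2), (u2, w1), (u1, w2), phi.
have X0' : 0 < cross (w2 - u1) (w1 - u1).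
  have -> : cross (w2 - u1) (w1 - u1) = - cross (w1 - u1) (w2 - u1) by rewrite /cross; ring.
  by rewrite oppr_gt0 lt_neqAle nz.
have [|e f|e f|e|phi h] := @rhombus_steps_labelled k u1 w2 u2 w1 (rhombus_swap_w hr) X0'.
- by right; rewrite iE.
- by rewrite iE (rel4 true) !inE; do ! case: eqP => _ //=.
- by rewrite iE (rel4 false) !inE; do ! case: eqP => _ //=.
- by rewrite iE !inE; do ! case: eqP => _ //=.
by exists (u1, w2), (u2, w1), (u2, w2), (u1, w1), phi.
Qed.

(** * The trigonometric identity behind the cancellation *)

Lemma cos_piquarter : Num.sqrt 2 * cos (pi / 4) = 1 :> R /\ Num.sqrt 2 * sin (pi / 4) = 1 :> R.
Proof.
have p0 := pi_gt0 R.
have c0 : 0 < cos (pi / 4 : R) by apply: cos_gt0_pihalf; lra.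
have sc : sin (pi / 4) = cos (pi / 4) :> R.
  have := tan_piquarter R; rewrite /tan => /(canRL (divfK (lt0r_neq0 c0))) ->.
  by rewrite mul1r.
suff h : Num.sqrt 2 * cos (pi / 4) = 1 :> R by rewrite sc.
have h2 : (Num.sqrt 2 * cos (pi / 4)) ^+ 2 = 1 :> R.
  by have := cos2Dsin2 (pi / 4 : R); rewrite exprMn sqr_sqrtr // sc; lra.
have /eqP := h2; rewrite sqrf_eq1 => /orP[/eqP //|/eqP hN].
have : 0 <= Num.sqrt 2 * cos (pi / 4 : R) by rewrite mulr_ge0 ?sqrtr_ge0 // ltW.
by rewrite hN; lra.
Qed.

(** After division by a common phase, the first term is the configuration with the additional loop
    and the second is its flip. [psi] is half the absolute turn of the first at the rhombus, so the
    two weight angles are [pi / 2 - psi] and [psi]; [eps] is 1 when the first goes around white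
    vertices. With [x = psi / 2], the factor [Num.sqrt 2] turns the sine of [pi / 4 - x] into
    [cos x - sin x]. *)
Lemma flip_identity (eps psi : R) : eps = 1 \/ eps = -1 ->
  (Num.sqrt 2 * sin ((pi / 2 - psi) / 2))%:C%C * (1 - expi (eps * psi)) +
  (sin (psi / 2))%:C%C *
    (1 + eps%:C%C * 'i%C - expi (- eps * (pi / 2 - psi)) - expi (eps * psi)) = 0 :> C.
Proof.
have -> : (pi / 2 - psi) / 2 = pi / 4 - psi / 2 by field.
have -> : psi = psi / 2 + psi / 2 by field.
have -> : (psi / 2 + psi / 2) / 2 = psi / 2 by field.
move: (psi / 2) => x; have [hc hs] := cos_piquarter.
have -> : Num.sqrt 2 * sin (pi / 4 - x) = cos x - sin x.
  by rewrite sinB mulrBr !mulrA hc hs !mul1r.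
have s1 := cos2Dsin2 x; have c1 : cos x ^+ 2 = 1 - sin x ^+ 2 by rewrite -s1; ring.
case=> ->.
  have -> : - 1 * (pi / 2 - (x + x)) = x + x - pi / 2 by ring.
  rewrite mul1r expiB expi_pihalf expiD.
  have -> : 'i%C^-1 = - 'i%C :> C.
    have i0 : 'i%C != 0 :> C by rewrite eq_complex /= oner_eq0 andbF.
    by apply: (mulfI i0); rewrite mulfV // mulrN -expr2 sqr_i opprK.
  apply: complex_ext; rewrite !reimE /=; move: c1; move: (cos x) (sin x) => c s; rewrite expr2 => c1; ring: c1.
have -> : - -1 * (pi / 2 - (x + x)) = pi / 2 + - x + - x by ring.
rewrite mulN1r opprD !expiD expi_pihalf.
apply: complex_ext; rewrite !reimE cosN sinN /=; move: c1; move: (cos x) (sin x) => c s; rewrite expr2 => c1; ring: c1.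
Qed.

(** * Pairing each configuration with its flip *)

Definition flip (k : 'I_(ninner D)) c : config D := [ffun j => if j == k then ~~ c j else c j].

Lemma flipK k : involutive (flip k).
Proof. by move=> c; apply/ffunP => j; rewrite !ffunE; case: eqP => // _; rewrite negbK. Qed.

Lemma flip_off k c j : j != k -> c j = flip k c j.
Proof. by rewrite ffunE => /negbTE ->. Qed.

Lemma flip_on k c : flip k c k = ~~ c k.
Proof. by rewrite ffunE eqxx. Qed.

Lemma weight_flip k c : exists K : R,
  weight c = Num.sqrt 2 ^+ nloops c * (sin (theta_config c k / 2) * K) /\
  weight (flip k c) = Num.sqrt 2 ^+ nloops (flip k c) * (sin (theta_config (flip k c) k / 2) * K).
Proof.
exists (\prod_(j < ninner D | j != k) sin (theta_config c j / 2)).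
rewrite /weight (bigD1 k) //=; split=> //; rewrite (bigD1 k) //=; congr (_ * (_ * _)).
by apply: eq_bigr => j jk; rewrite /theta_config -flip_off.
Qed.

Definition phase_sum (e1 e2 xw xb : edge) c : C :=
  phase c e1 + phase c e2 - phase c xw - phase c xb.

Lemma theta_config_phi k e1 e2 xw xb phi c : rhombus_steps k e1 e2 xw xb phi ->
  theta_config c k = if c k then phi / 2 else pi / 2 - phi / 2.
Proof. by move=> h; rewrite /theta_config /theta_star (rs_theta h). Qed.

(** A flip exchanges the exits of the two entering sides and keeps all other moves, including the
    link from [sub_b]. *)
Lemma flip_sigma k e1 e2 xw xb phi c (y1 y2 : E) : rhombus_steps k e1 e2 xw xb phi ->
  ssval y1 = e1 -> ssval y2 = e2 -> sigma (flip k c) = (tperm y1 y2 * sigma c)%g.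
Proof.
move=> h h1 h2; apply/permP => z; rewrite permM.
have st1 (b : config D) : b k -> step b e1 xw /\ step b e2 xb by move=> /(rs_white h)[].
have st2 (b : config D) : ~~ b k -> step b e1 xb /\ step b e2 xw by move=> /(rs_black h)[].
have val_sigma (b : config D) (y x : E) e : step b (ssval y) e -> ssval x = e -> sigma b y = x.
  by move=> hs xe; apply: step_sigma; rewrite xe.
have main (b : config D) (x1 x2 : edge) : step b (ssval y1) x1 -> step b (ssval y2) x2 ->
    step (flip k b) (ssval y1) x2 -> step (flip k b) (ssval y2) x1 ->
    sigma (flip k b) y1 = sigma b y2 /\ sigma (flip k b) y2 = sigma b y1.
  move=> s1 s2 s3 s4; have [_ m1] := step_edges s1; have [_ m2] := step_edges s2.
  by rewrite (val_sigma b y1 (SeqSub m1) _ s1) // (val_sigma b y2 (SeqSub m2) _ s2) //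
    (val_sigma (flip k b) y1 (SeqSub m2) _ s3) // (val_sigma (flip k b) y2 (SeqSub m1) _ s4).
have [f1 f2] : sigma (flip k c) y1 = sigma c y2 /\ sigma (flip k c) y2 = sigma c y1.
  case ck : (c k).
    have [s1 s2] := st1 c ck; have [s3 s4] := st2 (flip k c) ltac:(by rewrite flip_on ck).
    by apply: (main c xw xb); rewrite ?h1 ?h2.
  have [s1 s2] := st2 c (negbT ck); have [s3 s4] := st1 (flip k c) ltac:(by rewrite flip_on ck).
  by apply: (main c xb xw); rewrite ?h1 ?h2.
case: tpermP => [->|->|/eqP z1 /eqP z2] //.
have [->|zb] := eqVneq z sub_b; first by rewrite !sigma_b.
apply: step_sigma; apply: (rs_off h (fun j jk => flip_off c jk) _ _ (sigma_step c zb)).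
  by apply: contra z1 => /eqP e; apply/eqP/val_inj; exact: (etrans e (esym h1)).
by apply: contra z2 => /eqP e; apply/eqP/val_inj; exact: (etrans e (esym h2)).
Qed.

Lemma flip_cancel k e1 e2 xw xb phi c : rhombus_steps k e1 e2 xw xb phi ->
  e1 \in interface c -> e2 \notin interface c ->
  (weight c)%:C%C * phase_sum e1 e2 xw xb c +
  (weight (flip k c))%:C%C * phase_sum e1 e2 xw xb (flip k c) = 0.
Proof.
move=> h i1 i2.
have off e f : e != e1 -> e != e2 -> step c e f -> step (flip k c) e f.
  exact: (rs_off h (fun j jk => flip_off c jk)).
have [K [wE wE']] := weight_flip k c.
have [_ m1] : True /\ e1 \in edges D.
  split=> //; case ck : (c k).
    by have [/step_edges[]] := rs_white h ck.
  by have [/step_edges[]] := rs_black h (negbT ck).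
have [_ m2] : True /\ e2 \in edges D.
  split=> //; case ck : (c k).
    by have [_ /step_edges[]] := rs_white h ck.
  by have [_ /step_edges[]] := rs_black h (negbT ck).
have nl : nloops c = (nloops (flip k c)).+1.
  have fs := @flip_sigma _ _ _ _ _ _ c (SeqSub m1) (SeqSub m2) h erefl erefl.
  apply: (flip_nloops fs); first by rewrite -val_eqE /= (rs_neq h).
  have y1a : SeqSub m1 \in porbit (sigma c) sub_a by rewrite -(mem_interface delta_gt0 planarG dom).
  have y2a : SeqSub m2 \notin porbit (sigma c) sub_a by rewrite -(mem_interface delta_gt0 planarG dom).
  by apply: contra y2a => h'; move: y1a; rewrite -!eq_porbit_mem => /eqP <-; rewrite eq_porbit_mem.
rewrite wE wE' (theta_config_phi c h) (theta_config_phi (flip k c) h) flip_on nl exprS.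
set Q := _ ^+ _.
case ck : (c k) => /=.
  have [s1 s2 t1 t2] := rs_white h ck.
  have [s3 s4 t3 t4] := rs_black h (c := flip k c) ltac:(by rewrite flip_on ck).
  have TE : phi = phi - pi + 1 * pi by ring.
  have [t0 [[p1 p2 p3 p4] [q1 q2 q3 q4]]] :=
    flip_phases off s1 s2 s3 s4 t1 t2 t3 t4 (or_introl erefl) TE i1 i2.
  rewrite /phase_sum p1 p2 p3 p4 q1 q2 q3 q4.
  (* Around white the turn of [c] is [phi - pi], hence this [psi] and [eps = 1]; when [c] goes
     around black the turn is [phi], and [psi = phi / 2] with [eps = -1]. *)
  have id := flip_identity (pi / 2 - phi / 2) (or_introl erefl : (1 : R) = 1 \/ 1 = -1).
  have e1E : t0 - (phi - pi) / 2 = t0 + 1 * (pi / 2 - phi / 2) by field.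
  have e2E : t0 - phi / 2 = t0 + - 1 * (pi / 2 - (pi / 2 - phi / 2)) by field.
  have e3E : pi / 2 - (pi / 2 - phi / 2) = phi / 2 by ring.
  rewrite e1E e2E !(expiD t0) e3E in id *.
  rewrite [RHS](_ : _ = (Q * K)%:C%C * expi t0 * 0); last by rewrite mulr0.
  by rewrite -id !rmorphM /=; ring.
have [s1 s2 t1 t2] := rs_black h (negbT ck).
have [s3 s4 t3 t4] := rs_white h (c := flip k c) ltac:(by rewrite flip_on ck).
have TE : phi - pi = phi + -1 * pi by ring.
have [t0 [[p1 p2 p3 p4] [q1 q2 q3 q4]]] :=
  flip_phases off s1 s2 s3 s4 t1 t2 t3 t4 (or_intror erefl) TE i1 i2.
rewrite /phase_sum p1 p2 p3 p4 q1 q2 q3 q4.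
have id := flip_identity (phi / 2) (or_intror erefl : (-1 : R) = 1 \/ -1 = -1).
have e1E : t0 - phi / 2 = t0 + -1 * (phi / 2) by field.
have e2E : t0 - (phi - pi) / 2 = t0 + - -1 * (pi / 2 - phi / 2) by field.
rewrite e1E e2E !(expiD t0).
rewrite [RHS](_ : _ = (Q * K)%:C%C * expi t0 * 0); last by rewrite mulr0.
by rewrite -id !rmorphM /=; ring.
Qed.


Lemma rhombus_steps_mem k e1 e2 xw xb phi c : rhombus_steps k e1 e2 xw xb phi ->
  e1 \in edges D /\ e2 \in edges D.
Proof.
move=> h; case ck : (c k).
  by have [/step_edges[? _] /step_edges[? _] _ _] := rs_white h ck.
by have [/step_edges[? _] /step_edges[? _] _ _] := rs_black h (negbT ck).
Qed.

Lemma phase_step0 c e x : step c e x -> e \notin interface c -> phase c x = 0.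
Proof.
move=> st; have [me mx] := step_edges st.
rewrite -[e]/(ssval (SeqSub me)) (mem_interface delta_gt0 planarG dom) => h.
rewrite /phase -[x]/(ssval (SeqSub mx)) (mem_interface delta_gt0 planarG dom) ifN //.
apply: contra h; rewrite -(@step_sigma _ _ _ _ delta_gt0 planarG dom c (SeqSub me) (SeqSub mx)) //.
by rewrite -[fun_of_perm _ _]/(iter 1 (sigma c) (SeqSub me)) -permX -!eq_porbit_mem porbit_perm.
Qed.

Lemma phase_sum0 k e1 e2 xw xb phi c : rhombus_steps k e1 e2 xw xb phi ->
  e1 \notin interface c -> e2 \notin interface c -> phase_sum e1 e2 xw xb c = 0.
Proof.
move=> h i1 i2; have [p1 p2] : phase c e1 = 0 /\ phase c e2 = 0.
  by rewrite /phase (negbTE i1) (negbTE i2).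
have [p3 p4] : phase c xw = 0 /\ phase c xb = 0.
  case ck : (c k).
    by have [s1 s2 _ _] := rs_white h ck; rewrite (phase_step0 s1 i1) (phase_step0 s2 i2).
  by have [s1 s2 _ _] := rs_black h (negbT ck); rewrite (phase_step0 s1 i1) (phase_step0 s2 i2).
by rewrite /phase_sum p1 p2 p3 p4 !subr0 addr0.
Qed.

Lemma phase_sum_sym e1 e2 xw xb c : phase_sum e2 e1 xb xw c = phase_sum e1 e2 xw xb c.
Proof. by rewrite /phase_sum; ring. Qed.

Lemma flip_cancel_sym k e1 e2 xw xb phi c : rhombus_steps k e1 e2 xw xb phi ->
  (e1 \in interface c) != (e2 \in interface c) ->
  (weight c)%:C%C * phase_sum e1 e2 xw xb c +
  (weight (flip k c))%:C%C * phase_sum e1 e2 xw xb (flip k c) = 0.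
Proof.
move=> h; case i1 : (e1 \in _); case i2 : (e2 \in _) => // _.
  by apply: (flip_cancel h); rewrite ?i1 ?i2.
rewrite -(phase_sum_sym e1 e2 xw xb c) -(phase_sum_sym e1 e2 xw xb (flip k c)).
by apply: (flip_cancel (rhombus_steps_sym h)); rewrite ?i1 ?i2.
Qed.

(* A flip inside the interface splits off a loop: afterwards exactly one of the
   two entering edges is still on the interface. *)
Lemma flip_cancel_all k e1 e2 xw xb phi c : rhombus_steps k e1 e2 xw xb phi ->
  (weight c)%:C%C * phase_sum e1 e2 xw xb c +
  (weight (flip k c))%:C%C * phase_sum e1 e2 xw xb (flip k c) = 0.
Proof.
move=> h; have [m1 m2] := rhombus_steps_mem c h.
pose y1 : E := SeqSub m1; pose y2 : E := SeqSub m2.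
have s' : sigma (flip k c) = (tperm y1 y2 * sigma c)%g by exact: (flip_sigma c h).
have s : sigma c = (tperm y1 y2 * sigma (flip k c))%g.
  by have := flip_sigma (flip k c) h (erefl : ssval y1 = e1) (erefl : ssval y2 = e2); rewrite flipK.
have i1 b : (e1 \in interface b) = (y1 \in porbit (sigma b) sub_a).
  exact: (mem_interface delta_gt0 planarG dom b y1).
have i2 b : (e2 \in interface b) = (y2 \in porbit (sigma b) sub_a).
  exact: (mem_interface delta_gt0 planarG dom b y2).
have [eq|ne] := eqVneq (e1 \in interface c) (e2 \in interface c); last exact: flip_cancel_sym h ne.
have [in1|nin1] := boolP (e1 \in interface c); last first.
  have nin2 : e2 \notin interface c by rewrite -eq.
  have [n1 n2] : e1 \notin interface (flip k c) /\ e2 \notin interface (flip k c).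
    by rewrite i1 i2; apply: porbit_avoid; rewrite -s -?i1 -?i2.
  by rewrite (phase_sum0 h nin1 nin2) (phase_sum0 h n1 n2) !mulr0 addr0.
have in2 : e2 \in interface c by rewrite -eq.
have := @flip_cancel_sym _ _ _ _ _ _ (flip k c) h; rewrite flipK addrC; apply.
have same : y1 \in porbit (sigma c) y2.
  move: in1 in2; rewrite i1 i2 -!eq_porbit_mem => /eqP e /eqP e'.
  by rewrite e e'.
(* The number of cycles rises by one from [c] to its flip, so multiplying by the same transposition
   again must lower it: the two points are then in different cycles. *)
have split : y1 \notin porbit (sigma (flip k c)) y2.
  have y12 : y1 != y2 by rewrite -val_eqE /= (rs_neq h).
  have p1 := porbits_mul_tperm (sigma c) y1 y2.
  have p2 := porbits_mul_tperm (sigma (flip k c)) y1 y2.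
  rewrite /= -s' same y12 in p1; rewrite /= -s y12 in p2.
  by apply/negP => hin; rewrite hin in p2; move: p1 p2 => /=; lia.
rewrite i1 i2; apply/eqP => eqi; have [in3|nin3] := boolP (y1 \in porbit (sigma (flip k c)) sub_a).
  have in4 : y2 \in porbit (sigma (flip k c)) sub_a by rewrite -eqi.
  move: in3 in4; rewrite -!eq_porbit_mem => /eqP e /eqP e'.
  by move: split; rewrite -eq_porbit_mem e e' eqxx.
have nin4 : y2 \notin porbit (sigma (flip k c)) sub_a by rewrite -eqi.
rewrite s' in nin3 nin4; have [] := porbit_avoid nin3 nin4.
by rewrite -i1 in1.
Qed.

(** * From the cancellation to the projection property *)

Lemma fermionE e : fermion D delta e =
  ((Num.sqrt (2 * delta))^-1)%:C%C * \sum_c (prob c)%:C%C * phase c e.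
Proof. by []. Qed.

Lemma fermion_balance k e1 e2 xw xb phi : rhombus_steps k e1 e2 xw xb phi ->
  fermion D delta e1 + fermion D delta e2 = fermion D delta xw + fermion D delta xb.
Proof.
move=> h; apply/eqP; rewrite -subr_eq0 opprD addrA !fermionE -!mulrDr -!mulrBr.
rewrite -big_split /= -!sumrB.
pose f c := (weight c)%:C%C * phase_sum e1 e2 xw xb c.
(* Reindexing one copy by the involution [flip k] pairs each configuration with its flip; twice the
   sum vanishes. *)
have f0 : \sum_(c : config D) f c = 0.
  have : \sum_(c : config D) f c + \sum_(c : config D) f c = 0.
    rewrite {2}(reindex_inj (inv_inj (flipK k))) /= -big_split /=.
    by apply: big1 => c _; apply: flip_cancel_all h.
  by move/eqP; rewrite -mulr2n mulrn_eq0 => /eqP.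
apply/eqP; rewrite (eq_bigr (fun c => ((\sum_(c' : config D) weight c')^-1)%:C%C * f c)).
  by rewrite -mulr_sumr f0 !mulr0.
by move=> c _; rewrite /f /phase_sum /prob rmorphM /=; ring.
Qed.

Lemma path_turn_normal c e q : path (step c) e q ->
  edge_normal (last e q) = expi (path_turn e q) * edge_normal e.
Proof.
elim: q e => [|y q IH] e /=; first by rewrite expi0 mul1r.
move=> /andP[st pq]; have [_ _ [_ nE _]] := step_turn delta_gt0 planarG dom st.
by rewrite IH // nE expiD mulrA [X in _ = X * _]mulrC.
Qed.

(** On the interface, the square of the phase times [edge_normal e] is [edge_normal] at [b], that is
    [delta]. So the phase is [Num.sqrt delta] times one of the two square roots, and the sign goes
    into [r]. *)
Lemma phase_line c e (s : C) : s ^+ 2 = (edge_normal e)^-1 -> exists r : R, phase c e = r%:C%C * s.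
Proof.
move=> sE; have [ei|ei] := boolP (e \in interface c); last first.
  by exists 0; rewrite /phase (negbTE ei) rmorph0 mul0r.
have [p0 [oE pp up lp]] := interface_path delta_gt0 planarG dom c.
have iE : interface c = edge_a D :: map (@ssval _ _) p0.
  exact: (interface_unique delta_gt0 planarG dom).
move: ei iE pp up lp; move: (map _ p0) => g ei iE; rewrite iE in ei.
case/splitPl: ei iE => p q lE iE; rewrite cat_path => /andP[_ pq] up lp.
rewrite lE in pq; have := path_turn_normal pq.
have -> : last e q = edge_b D by rewrite -lp last_cat lE.
have -> : edge_normal (edge_b D) = delta%:C%C.
  rewrite /edge_normal /= -opprB (fk_b_normalized dom) mulrN mulrA -expr2 sqr_i.
  by rewrite mulN1r opprK.
move=> nE; rewrite (phase_split iE up lp lE).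
set t := path_turn e q in nE *.
have n0 : edge_normal e != 0.
  apply/eqP => n0; move: nE; rewrite n0 mulr0 => -[/eqP]; rewrite gt_eqF //.
have sq : expi (t / 2) ^+ 2 = ((Num.sqrt delta)%:C%C * s) ^+ 2.
  rewrite exprMn sE -rmorphXn /= sqr_sqrtr ?ltW // nE mulfK // expr2 -expiD.
  by congr expi; field.
move/eqP: sq; rewrite eqf_sqr => /orP[/eqP ->|/eqP ->]; first by exists (Num.sqrt delta).
by exists (- Num.sqrt delta); rewrite rmorphN mulNr.
Qed.

Lemma fermion_line e (s : C) : s ^+ 2 = (edge_normal e)^-1 ->
  exists r : R, fermion D delta e = r%:C%C * s.
Proof.
move=> sE; rewrite fermionE.
have [r ->] : exists r : R, \sum_(c : config D) (prob c)%:C%C * phase c e = r%:C%C * s.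
  apply: (big_ind (fun x => exists r : R, x = r%:C%C * s)).
  - by exists 0; rewrite rmorph0 mul0r.
  - by move=> _ _ [r ->] [r' ->]; exists (r + r'); rewrite rmorphD mulrDl.
  - by move=> c _; have [r ->] := phase_line c sE; exists (prob c * r); rewrite [LHS]mulrA -rmorphM.
by exists ((Num.sqrt (2 * delta))^-1 * r); rewrite [in RHS]rmorphM [LHS]mulrA.
Qed.

Lemma Proj_orthogonal (r r' : R) (s : C) : s != 0 ->
  Proj (r%:C%C * s + r'%:C%C * ('i%C * s)) s = r%:C%C * s.
Proof.
move=> s0; rewrite /Proj normE; set N := Num.sqrt _.
have d0 : 0 < dot s s by rewrite dot_gt0.
have N0 : N != 0 by rewrite gt_eqF // sqrtr_gt0.
have NN : N ^+ 2 = dot s s by rewrite sqr_sqrtr // ltW.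
rewrite -fmorphV ![_ * (N^-1)%:C%C]mulrC ReZ.
have -> : complex.Re ((r%:C%C * s + r'%:C%C * ('i%C * s)) * (s^*)%C) = r * N ^+ 2.
  by rewrite NN /dot !reimE; ring.
by rewrite [LHS]mulrA -rmorphM; congr (_%:C%C * _); field.
Qed.

(** The normal of the opposite side is the negative, so its line is spanned by ['i * s], orthogonal
    to [s], and its value is removed by the projection. *)
Lemma fermion_proj e e' (s : C) : edge_normal e != 0 -> edge_normal e' = - edge_normal e ->
  s ^+ 2 = (edge_normal e)^-1 ->
  fermion D delta e = Proj (fermion D delta e + fermion D delta e') s.
Proof.
move=> n0 ne sE; have [r ->] := fermion_line sE.
have sE' : ('i%C * s) ^+ 2 = (edge_normal e')^-1 by rewrite exprMn sqr_i sE ne invrN mulN1r.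
have [r' ->] := fermion_line sE'.
rewrite Proj_orthogonal //; apply: contraNneq n0 => s0.
by move/eqP: sE; rewrite s0 expr0n /= eq_sym invr_eq0.
Qed.

Lemma fermion_projection (k : 'I_(ninner D)) : exists Fz : C,
  forall e, e \in rhombus_edges (inner k) ->
  forall s : C, s ^+ 2 = (edge_normal e)^-1 -> fermion D delta e = Proj Fz s.
Proof.
have [e1 [e2 [xw [xb [phi h]]]]] := rhombus_stepsP k.
have bal := fermion_balance h.
have n0 e : e \in rhombus_edges (inner k) -> edge_normal e != 0.
  move=> he; have [_ _ [L1 L2] [L3 L4]] := fk_inner dom k.
  have L : Lambda_edge delta G e.
    by move: he; rewrite !inE => /or4P[] /eqP ->.
  apply: mulf_neq0; first by rewrite eq_complex /= oner_eq0 andbF.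
  by rewrite subr_eq0 eq_sym (Lambda_edge_neq delta_gt0 L).
have [opp1 opp2] := rs_opp h.
(* By [bal] this is also the sum over the two exits, so each side can be projected from the sum over
   its own opposite pair. *)
exists (fermion D delta e1 + fermion D delta e2) => e he s sE.
have {} n0 := n0 e he; move: he; rewrite (rs_edges h) !inE => /or4P[] /eqP E; rewrite E in sE n0 *.
- exact: fermion_proj.
- by rewrite addrC; apply: fermion_proj => //; rewrite opp1 opprK.
- by rewrite bal; apply: fermion_proj.
- by rewrite bal addrC; apply: fermion_proj => //; rewrite opp2 opprK.
Qed.

End Flip.

Theorem proposition2p2 (R : realType) (delta eta : R) (G : plane_graph R)
    (D : fk_data R)
    (delta_gt0 : 0 < delta) (eta_gt0 : 0 < eta)
    (G_isoradial : isoradial delta G)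
    (G_angles : angles_bounded delta eta G)
    (D_domain : fk_domain delta G D)
    (k : 'I_(ninner D)) :
  let z := inner k in
  exists Fz : R[i],
    forall u w : R[i],
      u \in [:: ru1 z; ru2 z] -> w \in [:: rw1 z; rw2 z] ->
      forall s : R[i], s ^+ 2 = ('i%C * (w - u))^-1 ->
        fermion D delta (u, w) = Proj Fz s.
Proof.
have planarG : planar_embedded G by case: G_isoradial.
have [Fz hF] := fermion_projection delta_gt0 planarG D_domain k.
exists Fz => u w hu hw s sE; apply: (hF (u, w)) sE.
by move: hu hw; rewrite !inE => /orP[] /eqP -> /orP[] /eqP ->; rewrite eqxx ?orbT.
Qed.
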